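(* Let $G$ be a positive random variable with $E(|\log G|)<\infty$. For all $t\in(0,1)$: 1) The density of $D_1\left(\frac{G}{Y_t}\right)$ may be expressed in terms of $G$ as $$f_{D_1\left(\frac{G}{Y_t}\right)}(x)=\frac{\sin\left(\pi tF_G(1/x)\right)}{\pi}\,x^{t-1}\exp\left\{-t\,E\left(\left(\log\left|x-\frac1G\right|\right)1_{x\neq\frac1G}\right)\right\}$$ for $x>0$ and when $1/x$ is in the support of $F_G$. Otherwise, when $x>0$, replace $\sin\left(\pi tF_G(1/x)\right)$ by $\sin\left(\pi(1-t)\right)$ in this formula. 2) The following duality formula holds: $$f_{D_1\left(\frac{G}{Y_t}\right)}(x)=\frac{\sin\left(\pi tF_G(1/x)\right)}{\sin\left(\pi t(1-F_G(1/x))\right)}\,x^{t-2}\,f_{D_1\left(\frac{1}{GY_t}\right)}\left(\frac1x\right)e^{tE(\log G)} .$$ 3) Let $\Lambda_t:[0,\infty)\to[0,1]$ be defined by $$\Lambda_t(y):=1-\frac{1}{\pi t}\arctan\left(\frac{\sin(\pi t)}{\cos(\pi t)+y}\right).$$ Then $$F_G(1/x)=\Lambda_t\left(\frac{f_{D_1\left(\frac{G}{Y_t}\right)}(x)}{x^{t-2}f_{D_1\left(\frac{1}{GY_t}\right)}\left(\frac1x\right)e^{tE(\log G)}}\right).$$ 4) Equivalently, $$F_G(1/x)=\Lambda_t\left(\frac{E\left[(D_t(G)-x)_+^{-t}\right]}{E\left[(x-D_t(G))_+^{-t}\right]}\right).$$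
   Context: For a positive random variable $G$, $F_G$ denotes its cumulative distribution function, and $f_X$ denotes the density of a random variable $X$ (so identities between densities are understood for a.e. $x>0$). For $G$ positive with $E(\log^+(1/G))<\infty$ and $t>0$, $\Gamma_t(G)$ is a random variable with $$E(e^{-\lambda\Gamma_t(G)})=\exp\left\{-t\int_0^\infty(1-e^{-\lambda x})\frac{dx}{x}E(e^{-xG})\right\}=\exp\left\{-tE\left(\log\left(1+\frac\lambda G\right)\right)\right\}\quad(\lambda\ge0),$$ and $D_t(G)$ is the random variable whose law is characterized by $\Gamma_t(G)\stackrel{(law)}{=}\gamma_t\cdot D_t(G)$, with $\gamma_t$ a gamma variable of parameter $t$ independent of $D_t(G)$. $Y_t$ is a Bernoulli variable, independent of $G$, with $P(Y_t=1)=t=1-P(Y_t=0)$. The definitions above are extended to $G/Y_t$ and $1/(GY_t)$, which take the value $+\infty$ on $\{Y_t=0\}$, with the conventions $e^{-x\cdot\infty}=0$ and $\lambda/\infty=0$. Equivalently, $$D_1\left(\frac{G}{Y_t}\right)\stackrel{(law)}{=}\beta_{t,1-t}\cdot D_t(G),\qquad D_1\left(\frac{1}{GY_t}\right)\stackrel{(law)}{=}\beta_{t,1-t}\cdot D_t(1/G),$$ where $\beta_{t,1-t}$ is a beta variable with parameters $(t,1-t)$ independent of the other factor. $(a)_+^{-t}$ means $a^{-t}$ if $a>0$ and $0$ otherwise. In the definition of $\Lambda_t$ the determination of $\arctan$ is the one with values in $[0,\pi)$, so that $\Lambda_t$ is the inverse function of $x\mapsto \sin(\pi tx)/\sin(\pi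 t(1-x))$, extended by $\Lambda_t(+\infty)=1$.
   Formalization: In 1) the sin(πtF_G(1/x)) formula is proved for a.e. x>0, its replacement by sin(π(1-t)) only for 1/x above the support (false elsewhere: G=1, x>1). In 2) the quotient is stated for F_G(1/x)<1; if F_G(1/x)=1, f_{D_1(1/(GY_t))}(1/x)=0. 4) holds for a.e. x. *)

(* Defs.v *)
From HB Require Import structures.
From mathcomp Require Import all_boot all_order all_algebra.
From mathcomp Require Import all_classical all_reals all_analysis.
From mathcomp Require Import measurable_realfun.

Set Implicit Arguments.
Unset Strict Implicit.
Unset Printing Implicit Defensive.

Import Order.TTheory GRing.Theory Num.Theory.
Import numFieldNormedType.Exports.

Local Open Scope classical_set_scope.
Local Open Scope ring_scope.

Section gamma_law.
Context (R : realType) (t : R).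
Notation mu := (@lebesgue_measure R).

Definition Gamma : R := \int[mu]_(x in `]0, +oo[) (x `^ (t - 1) * expR (- x)).

Definition gamma_pdf (x : R) : R :=
  if 0 < x then x `^ (t - 1) * expR (- x) / Gamma else 0.

Lemma gamma_pdf_ge0 x : 0 <= gamma_pdf x.
Proof.
rewrite /gamma_pdf; case: ifPn => // x0.
rewrite divr_ge0// ?mulr_ge0 ?powR_ge0 ?expR_ge0//.
by apply: Rintegral_ge0 => y _; rewrite mulr_ge0 ?powR_ge0 ?expR_ge0.
Qed.

Lemma measurable_gamma_pdf : measurable_fun setT gamma_pdf.
Proof.
apply: measurable_fun_if => //; first exact: measurable_fun_ltr.
apply: measurable_funTS; apply: measurable_funM => //.
apply: measurable_funM; first exact: measurable_powR.
by apply: measurableT_comp => //; exact: measurable_expR.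
Qed.

Definition gamma_law : set (measurableTypeR R) -> \bar R :=
  fun A => (\int[mu]_(x in A) (gamma_pdf x)%:E)%E.

Let gamma_law0 : gamma_law set0 = 0%E.
Proof. by rewrite /gamma_law integral_set0. Qed.

Let gamma_law_ge0 A : (0 <= gamma_law A)%E.
Proof. by apply: integral_ge0 => x _; rewrite lee_fin gamma_pdf_ge0. Qed.

Let gamma_law_sigma_additive : semi_sigma_additive gamma_law.
Proof.
move=> /= F mF tF mUF; rewrite /gamma_law; apply: cvg_toP.
  apply: ereal_nondecreasing_is_cvgn => m n mn.
  apply: lee_sum_nneg_natr => // k _ _.
  by apply: integral_ge0 => /= x Fkx; rewrite lee_fin gamma_pdf_ge0.
rewrite ge0_integral_bigcup//=.
- apply: measurable_funTS; apply: measurableT_comp => //.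
  exact: measurable_gamma_pdf.
- by move=> x _; rewrite lee_fin gamma_pdf_ge0.
Qed.

HB.instance Definition _ := isMeasure.Build _ _ _ gamma_law
  gamma_law0 gamma_law_ge0 gamma_law_sigma_additive.

End gamma_law.

Definition independent_RV (R : realType) d (T : measurableType d)
    (P : probability T R) (X Y : {RV P >-> R}) : Prop :=
  forall A B : set R, measurable A -> measurable B ->
    P (X @^-1` A `&` Y @^-1` B) = (P (X @^-1` A) * P (Y @^-1` B))%E.

Definition bernoulli_RV (R : realType) d (T : measurableType d)
    (P : probability T R) (t : R) (Y : {RV P >-> R}) : Prop :=
  P (Y @^-1` [set 1]) = t%:E /\ P (Y @^-1` [set 0]) = (1 - t)%:E.

(* nu is the law of Gamma_t(H), for a positive H that may take the value +oo.
   Inversion in \bar R satisfies 0^-1 = +oo and +oo^-1 = 0, so the term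
   lambda / H vanishes where H = +oo. *)
Definition Gamma_law_of (R : realType) d (T : measurableType d)
    (P : probability T R) (t : R) (H : T -> \bar R)
    (nu : set (measurableTypeR R) -> \bar R) : Prop :=
  nu `]-oo, 0[%classic = 0%E /\
  forall lambda : R, 0 <= lambda ->
    (\int[nu]_x (expR (- lambda * x))%:E =
     expeR (- (t%:E * \int[P]_w lne (1 + lambda%:E / H w))))%E.

(* D has the law of D_t(H): the product of gamma_t and an independent copy of D
   (a product measure, pushed forward by multiplication) has the law of
   Gamma_t(H). *)
Definition is_D (R : realType) d (T : measurableType d) (P : probability T R)
    (t : R) (H : T -> \bar R) d' (T' : measurableType d')
    (P' : probability T' R) (D : {RV P' >-> R}) : Prop :=
  distribution P' D `]-oo, 0[%classic = 0%E /\
  Gamma_law_of P t H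
    (pushforward (gamma_law t \x distribution P' D)%E
       (fun z : measurableTypeR R * measurableTypeR R => z.1 * z.2)).

Definition is_density (R : realType) d (T : measurableType d)
    (P : probability T R) (X : {RV P >-> R}) (f : R -> R) : Prop :=
  [/\ measurable_fun setT f, (forall x, 0 <= f x) &
      forall A : set R, measurable A ->
        distribution P X A = (\int[@lebesgue_measure R]_(x in A) (f x)%:E)%E].

Definition F_ (R : realType) d (T : measurableType d) (P : probability T R)
    (X : {RV P >-> R}) (x : R) : R := fine (cdf X x).

Definition dist_support (R : realType) d (T : measurableType d)
    (P : probability T R) (X : {RV P >-> R}) : set R :=
  [set y | forall e : R, 0 < e -> (0 < distribution P X (ball y e))%E].

(* The sine is left as a parameter s, since it is the part of the formula that
   gets replaced when 1/x is outside of the support. *)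
Definition D1_density (R : realType) d (T : measurableType d)
    (P : probability T R) (G : {RV P >-> R}) (t s x : R) : \bar R :=
  ((s / pi * x `^ (t - 1))%:E *
   expeR (- (t%:E * 'E_P[fun w : T =>
     (ln `|x - (G w)^-1| * (x != (G w)^-1)%:R)%R])))%E.

(* The determination of arctan (a / b) in [0, pi[, for a >= 0; it is pi / 2
   when b = 0. *)
Definition arctan_quot (R : realType) (a b : R) : R :=
  if b == 0 then pi / 2
  else if a / b < 0 then atan (a / b) + pi else atan (a / b).

Definition Lambda_fin (R : realType) (t y : R) : R :=
  1 - (pi * t)^-1 * arctan_quot (sin (pi * t)) (cos (pi * t) + y).

(* Only used on [0, +oo]. *)
Definition Lambda (R : realType) (t : R) (y : \bar R) : R :=
  match y with
  | y'%:E => Lambda_fin t y'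
  | +oo%E => 1
  | -oo%E => 0
  end.

Definition pos_powR (R : realType) (a r : R) : R :=
  if 0 < a then a `^ r else 0.

(* Main.v *)
Require Import Defs.
From HB Require Import structures.
From mathcomp Require Import all_boot all_order all_algebra.
From mathcomp Require Import ring lra.
From mathcomp Require Import all_classical all_reals all_analysis.
From mathcomp Require Import measurable_realfun.

Import Order.TTheory GRing.Theory Num.Theory.
Import numFieldNormedType.Exports.

Set Implicit Arguments.
Unset Strict Implicit.
Unset Printing Implicit Defensive.

Local Open Scope classical_set_scope.
Local Open Scope ring_scope.


(* Proof idea. Both D = D_1(.) and D = D_t(.) satisfy E (z + D)^-tau =
   exp (- tau E log (z + A)) for z > 0, with A = 1/H. Differentiating in z gives
   E (z + D)^-(tau+1) = E (z + D)^-tau E (z + A)^-1; the right-hand side is the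
   Stieltjes transform of a beta mixture of independent copies of D and A, and
   a real Stieltjes transform determines the law. The bilinear identity therefore
   holds for complex z, and integrating it along a horizontal line from +oo gives
   the first identity for complex z, with no analytic continuation.
   Letting z tend to -x, with x > 0, the argument of the right-hand side tends to
   pi tau P(A < x) and its modulus to exp (- tau E log |A - x|), for every x such
   that A has no atom at x and E |A - x|^-t is finite, that is, for a.e. x.
   For tau = 1, Stieltjes inversion yields the density of D_1; for tau = t the real
   and imaginary parts of the left-hand side tend to linear combinations of
   E (D - x)_+^-t and E (x - D)_+^-t. The theorem then follows by trigonometry. *)

(** * Complex powers in real coordinates *)

Section complex_power.
Context {R : realType}.
Implicit Types (y c k x : R).

(** A real Stieltjes transform determines the law because repeated differentiation, evaluated at
    [z = 1], yields all moments of [1 / (1 + S)] weighted by a power of it; Bernstein approximation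
    on [[0, 1]] extends the equality of moments to continuous functions. The beta mixture comes from
    the formula [int_0^1 (c + v^(1/tau) d)^-(tau+1) dv = (c + d)^-tau c^-1]. For [D_1] pointwise
    boundary limits do not suffice: without domination the law could have a singular part. The
    Bernoulli factor provides the bound. There [A] is [0] with probability [1 - t] and otherwise
    equals a positive [B], so [E log |A - x| = t E log |B - x| + (1 - t) log x]. The second term is
    the origin of [x^(t-1)]. By Jensen the first contributes at most [E |B - x|^-t], and since
    [t < 1] this has an integral over bounded intervals that is bounded independently of the law of
    [B]. The same estimate makes almost every [x] admissible. *)

Lemma is_derive_chain (f g : R -> R) x a b l :
  is_derive (g x) 1 f a -> is_derive x 1 g b -> l = a * b ->
  is_derive x 1 (fun z => f (g z)) l.
Proof. by move=> fa gb ->; exact: is_derive1_comp. Qed.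

Lemma is_derive_mul (f g : R -> R) x a b l :
  is_derive x 1 f a -> is_derive x 1 g b -> l = a * g x + f x * b ->
  is_derive x 1 (fun z => f z * g z) l.
Proof.
move=> fa gb ->; have := @is_deriveM _ _ f g x 1 a b fa gb.
by move=> h; apply: is_derive_eq h _; rewrite /GRing.scale /=; ring.
Qed.

Lemma is_derive_mulc (f : R -> R) x a m l :
  is_derive x 1 f a -> l = m * a -> is_derive x 1 (fun z => m * f z) l.
Proof.
by move=> fa ->; apply: (is_derive_mul (is_derive_cst m x 1) fa); rewrite mul0r add0r.
Qed.

Lemma is_derive_addrc (f : R -> R) x a s :
  is_derive (x + s) 1 f a -> is_derive x 1 (fun z => f (z + s)) a.
Proof.
move=> fa; apply: (@is_derive_chain f (shift s) x a 1 _ fa); last by rewrite mulr1.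
exact: is_derive_shift.
Qed.

Lemma is_derive_addc (f : R -> R) x a s :
  is_derive (s + x) 1 f a -> is_derive x 1 (fun z => f (s + z)) a.
Proof.
rewrite addrC => fa; under eq_fun do rewrite addrC.
exact: is_derive_addrc.
Qed.

(* [c ^ -k] for [c > 0] *)
Definition rpow (k c : R) : R := expR (- k * ln c).

Lemma rpow_gt0 k c : 0 < rpow k c.
Proof. exact: expR_gt0. Qed.

Lemma rpow1 c : 0 < c -> rpow 1 c = c^-1.
Proof. by move=> c0; rewrite /rpow mulN1r expRN lnK. Qed.

Lemma rpowD k l c : rpow (k + l) c = rpow k c * rpow l c.
Proof. by rewrite /rpow -expRD; congr expR; ring. Qed.

Lemma rpowM k b c : 0 < b -> 0 < c -> rpow k (b * c) = rpow k b * rpow k c.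
Proof. by move=> b0 c0; rewrite /rpow lnM// mulrDr expRD. Qed.

Lemma ler_rpow k b c : 0 <= k -> 0 < b -> b <= c -> rpow k c <= rpow k b.
Proof.
move=> k0 b0 bc; rewrite /rpow ler_expR !mulNr lerN2 ler_wpM2l// ler_ln//.
by rewrite posrE (lt_le_trans b0).
Qed.

Lemma rpow_le1 k c : 0 <= k -> 1 <= c -> rpow k c <= 1.
Proof.
by move=> k0 c1; apply: (le_trans (ler_rpow k0 ltr01 c1)); rewrite /rpow ln1 mulr0 expR0.
Qed.

Lemma is_derive_rpow k c : 0 < c -> is_derive c 1 (rpow k) (- k * rpow (k + 1) c).
Proof.
move=> c0; rewrite /rpow.
apply: (@is_derive_chain expR (fun c => - k * ln c) c _ (- k * c^-1)).
  by apply: is_derive_mulc; first exact: is_derive1_ln.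
rewrite mulrCA; congr (_ * _).
by rewrite -/(rpow _ _) rpowD rpow1// mulrC.
Qed.

(* For [y > 0], [lmod y c + i larg y c] is the logarithm of [c + iy], and
   [(c + iy) ^ -k] is [cpow_re k y c - i cpow_im k y c]. *)
Definition lmod (y c : R) : R := ln (c ^+ 2 + y ^+ 2) / 2.

Definition larg (y c : R) : R := pi / 2 - atan (c / y).

Definition cpow_re (k y c : R) : R := expR (- k * lmod y c) * cos (k * larg y c).

Definition cpow_im (k y c : R) : R := expR (- k * lmod y c) * sin (k * larg y c).

Lemma sqrD_gt0 y c : 0 < y -> 0 < c ^+ 2 + y ^+ 2.
Proof. by move=> y0; rewrite ltr_wpDl ?sqr_ge0// exprn_gt0. Qed.

Lemma is_derive_lmod y c : 0 < y ->
  is_derive c 1 (lmod y) (c / (c ^+ 2 + y ^+ 2)).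
Proof.
move=> y0; rewrite /lmod.
have h : is_derive c 1 (fun c => ln (c ^+ 2 + y ^+ 2)) (2 * c / (c ^+ 2 + y ^+ 2)).
  apply: (@is_derive_chain (@ln R) (fun c => c ^+ 2 + y ^+ 2) c _ (2 * c)).
  - exact/is_derive1_ln/sqrD_gt0.
  - by apply: is_derive_eq; rewrite /GRing.scale /=; ring.
  - by rewrite mulrC.
under eq_fun do rewrite mulrC.
by apply: is_derive_mulc h _; field; rewrite gt_eqF// sqrD_gt0.
Qed.

Lemma is_derive_larg y c : 0 < y ->
  is_derive c 1 (larg y) (- (y / (c ^+ 2 + y ^+ 2))).
Proof.
move=> y0; rewrite /larg.
have h : is_derive c 1 (fun c => atan (c / y)) (y / (c ^+ 2 + y ^+ 2)).
  apply: (@is_derive_chain (@atan R) (fun c => c / y) c _ y^-1).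
  - under eq_fun do rewrite mulrC.
    by apply: is_derive_mulc => //; rewrite mulr1.
  - by field; rewrite (gt_eqF y0) addrC (gt_eqF (sqrD_gt0 _ y0)).
by have := is_deriveB (is_derive_cst (pi / 2 : R) c 1) h; rewrite sub0r.
Qed.

Lemma is_derive_expMlmod k y c : 0 < y ->
  is_derive c 1 (fun c => expR (- k * lmod y c))
    (- k * (c / (c ^+ 2 + y ^+ 2)) * expR (- k * lmod y c)).
Proof.
move=> y0; apply: (@is_derive_chain expR (fun c => - k * lmod y c) c
    (expR (- k * lmod y c)) (- k * (c / (c ^+ 2 + y ^+ 2)))).
  by apply: is_derive_mulc; first exact: is_derive_lmod.
by rewrite mulrC.
Qed.

Lemma expRNlmod y c : 0 < y -> expR (- lmod y c) = (Num.sqrt (c ^+ 2 + y ^+ 2))^-1.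
Proof.
move=> y0; have s0 := sqrD_gt0 c y0.
rewrite expRN; congr (_^-1); apply/eqP.
rewrite -(@eqrXn2 _ 2) ?expR_ge0 ?sqrtr_ge0// sqr_sqrtr ?ltW//.
have -> : expR (lmod y c) ^+ 2 = expR (lmod y c + lmod y c) by rewrite expRD expr2.
have -> : lmod y c + lmod y c = ln (c ^+ 2 + y ^+ 2) by rewrite /lmod; field.
by rewrite lnK.
Qed.

Lemma sqrt1D_div y c : 0 < y ->
  Num.sqrt (1 + (c / y) ^+ 2) = Num.sqrt (c ^+ 2 + y ^+ 2) / y.
Proof.
move=> y0; have -> : 1 + (c / y) ^+ 2 = (c ^+ 2 + y ^+ 2) * (y^-1) ^+ 2.
  by field; rewrite gt_eqF.
by rewrite sqrtrM ?ltW ?sqrD_gt0// sqrtr_sqr ger0_norm// invr_ge0 ltW.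
Qed.

Lemma sin_larg y c : 0 < y -> expR (- lmod y c) * sin (larg y c) = y / (c ^+ 2 + y ^+ 2).
Proof.
move=> y0; have s0 := sqrD_gt0 c y0.
have sq0 : 0 < Num.sqrt (c ^+ 2 + y ^+ 2) by rewrite sqrtr_gt0.
rewrite /larg -opprB sinN sinBpihalf opprK cos_atan expRNlmod// sqrt1D_div//.
by rewrite -[in RHS](sqr_sqrtr (ltW s0)); field; rewrite !gt_eqF.
Qed.

Lemma cos_larg y c : 0 < y -> expR (- lmod y c) * cos (larg y c) = c / (c ^+ 2 + y ^+ 2).
Proof.
move=> y0; have s0 := sqrD_gt0 c y0.
have sq0 : 0 < Num.sqrt (c ^+ 2 + y ^+ 2) by rewrite sqrtr_gt0.
rewrite /larg -opprB cosN cosBpihalf.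
have c0 : cos (atan (c / y)) != 0.
  by rewrite cos_atan invr_eq0 sqrt1D_div// gt_eqF// divr_gt0.
have -> : sin (atan (c / y)) = (c / y) * cos (atan (c / y)).
  by rewrite -{2}[c / y]atanK /tan divfK.
rewrite cos_atan expRNlmod// sqrt1D_div//.
by rewrite -[in RHS](sqr_sqrtr (ltW s0)); field; rewrite !gt_eqF.
Qed.

Lemma cpow_reD k l y c :
  cpow_re (k + l) y c = cpow_re k y c * cpow_re l y c - cpow_im k y c * cpow_im l y c.
Proof.
rewrite /cpow_re /cpow_im mulrDl cosD.
have -> : - (k + l) * lmod y c = - k * lmod y c + - l * lmod y c by ring.
by rewrite expRD; ring.
Qed.

Lemma cpow_imD k l y c :
  cpow_im (k + l) y c = cpow_im k y c * cpow_re l y c + cpow_re k y c * cpow_im l y c.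
Proof.
rewrite /cpow_re /cpow_im mulrDl sinD.
have -> : - (k + l) * lmod y c = - k * lmod y c + - l * lmod y c by ring.
by rewrite expRD; ring.
Qed.

Lemma cpow_re1 y c : 0 < y -> cpow_re 1 y c = c / (c ^+ 2 + y ^+ 2).
Proof. by move=> y0; rewrite /cpow_re mulN1r mul1r cos_larg. Qed.

Lemma cpow_im1 y c : 0 < y -> cpow_im 1 y c = y / (c ^+ 2 + y ^+ 2).
Proof. by move=> y0; rewrite /cpow_im mulN1r mul1r sin_larg. Qed.

(** Real part of [d/dc (c + iy) ^ -k = -k (c + iy) ^ -(k + 1)]: the factor [1 / (c + iy)] produced
    by differentiating the logarithm is the power [1] in the addition formulas. *)
Lemma is_derive_cpow_re k y c : 0 < y ->
  is_derive c 1 (cpow_re k y) (- k * cpow_re (k + 1) y c).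
Proof.
move=> y0.
have h : is_derive c 1 (fun c => cos (k * larg y c))
    (- sin (k * larg y c) * (k * - (y / (c ^+ 2 + y ^+ 2)))).
  apply: (@is_derive_chain (@cos R) (fun c => k * larg y c) c (- sin (k * larg y c))
    (k * - (y / (c ^+ 2 + y ^+ 2)))) => //.
  by apply: (is_derive_mulc (is_derive_larg c y0)).
apply: (is_derive_mul (is_derive_expMlmod k c y0) h).
by rewrite cpow_reD cpow_re1// cpow_im1// /cpow_re /cpow_im; ring.
Qed.

Lemma is_derive_cpow_im k y c : 0 < y ->
  is_derive c 1 (cpow_im k y) (- k * cpow_im (k + 1) y c).
Proof.
move=> y0.
have h : is_derive c 1 (fun c => sin (k * larg y c))
    (cos (k * larg y c) * (k * - (y / (c ^+ 2 + y ^+ 2)))).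
  apply: (@is_derive_chain (@sin R) (fun c => k * larg y c) c (cos (k * larg y c))
    (k * - (y / (c ^+ 2 + y ^+ 2)))) => //.
  by apply: (is_derive_mulc (is_derive_larg c y0)).
apply: (is_derive_mul (is_derive_expMlmod k c y0) h).
by rewrite cpow_imD cpow_re1// cpow_im1// /cpow_re /cpow_im; ring.
Qed.

Lemma expMlmod_le k y c : 0 <= k -> 0 < y -> expR (- k * lmod y c) <= rpow k y.
Proof.
move=> k0 y0; rewrite /rpow ler_expR !mulNr lerN2 ler_wpM2l// /lmod.
rewrite ler_pdivlMr// mulr_natr -lnXn// ler_ln ?posrE ?sqrD_gt0 ?exprn_gt0//.
by rewrite lerDr sqr_ge0.
Qed.

Lemma norm_cos_le1 x : `|cos x| <= 1.
Proof. by rewrite ler_norml cos_geN1 cos_le1. Qed.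

Lemma norm_sin_le1 x : `|sin x| <= 1.
Proof. by rewrite ler_norml sin_geN1 sin_le1. Qed.

Lemma norm_cpow_re_le k y c : `|cpow_re k y c| <= expR (- k * lmod y c).
Proof. by rewrite normrM ger0_norm ?expR_ge0// ler_piMr ?expR_ge0// norm_cos_le1. Qed.

Lemma norm_cpow_im_le k y c : `|cpow_im k y c| <= expR (- k * lmod y c).
Proof. by rewrite normrM ger0_norm ?expR_ge0// ler_piMr ?expR_ge0// norm_sin_le1. Qed.

Lemma is_derive_continuous (f : R -> R) x a : is_derive x 1 f a -> {for x, continuous f}.
Proof. by case=> df _; apply/differentiable_continuous/derivable1_diffP. Qed.

Lemma continuous_lmod y : 0 < y -> continuous (lmod y).
Proof. by move=> y0 c; apply: is_derive_continuous; exact: is_derive_lmod. Qed.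

Lemma continuous_larg y : 0 < y -> continuous (larg y).
Proof. by move=> y0 c; apply: is_derive_continuous; exact: is_derive_larg. Qed.

Lemma continuous_cpow_re k y : 0 < y -> continuous (cpow_re k y).
Proof. by move=> y0 c; apply: is_derive_continuous; exact: is_derive_cpow_re. Qed.

Lemma continuous_cpow_im k y : 0 < y -> continuous (cpow_im k y).
Proof. by move=> y0 c; apply: is_derive_continuous; exact: is_derive_cpow_im. Qed.

Lemma larg_ge0 y c : 0 <= larg y c.
Proof. by rewrite /larg subr_ge0 ltW// atan_ltpi2. Qed.

Lemma larg_lepi y c : larg y c <= pi.
Proof.
rewrite /larg; have := atan_gtNpi2 (c / y) => h.
have := @pi_gt0 R; lra.
Qed.

End complex_power.

(** * Beta mixtures of kernels *)

Section mixture.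
Context {R : realType}.
Notation mu := (@lebesgue_measure R).
Implicit Types (tau v c d a b z y s : R).

(* [mixw tau v] is beta (tau, 1)-distributed when [v] is uniform on [0, 1]. *)
Definition mixw (tau v : R) : R := v `^ tau^-1.

Lemma mixw_itv tau v : 0 < tau -> 0 <= v <= 1 -> 0 <= mixw tau v <= 1.
Proof.
move=> t0 /andP[v0 v1]; rewrite powR_ge0/= /mixw.
have <- : 1 `^ tau^-1 = 1 :> R by rewrite powR1.
by apply: ge0_ler_powR; rewrite ?nnegrE// ?invr_ge0 ltW.
Qed.

Lemma is_derive_mixw tau v : 0 < tau -> 0 < v ->
  is_derive v 1 (mixw tau) (mixw tau v / (tau * v)).
Proof.
move=> t0 v0; apply: (is_derive_eq (is_derive1_powR tau^-1 v0)).
have -> : v `^ (tau^-1 - 1) = v `^ tau^-1 * v^-1.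
  rewrite powRD; last by rewrite (gt_eqF v0) implybT.
  by rewrite powR_inv1 ?ltW.
by rewrite /mixw invfM; ring.
Qed.

Lemma mixw_cvg0 tau : 0 < tau -> mixw tau v @[v --> 0^'+] --> (0 : R).
Proof. by move=> t0; apply: powR_cvg0; rewrite invr_gt0. Qed.

Lemma mixw0 tau : 0 < tau -> mixw tau 0 = 0.
Proof. by move=> t0; rewrite /mixw powR0// gt_eqF ?invr_gt0. Qed.

Lemma mixw1 tau : mixw tau 1 = 1.
Proof. by rewrite /mixw powR1. Qed.

(** [v * psi (c + mixw tau v * d)] is a primitive of the integrand: [mixw tau] has derivative
    [b / (tau v)] at [v], with [b = mixw tau v], so the product rule gives exactly the formula
    assumed for [f]. As [mixw tau] need not be differentiable at [0], only one-sided limits are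
    taken at the end points. *)
Lemma integral_mixture (f psi psi' : R -> R) tau c d : 0 < tau ->
  (forall b, 0 <= b <= 1 ->
    is_derive (c + b * d) 1 psi (psi' (c + b * d))) ->
  (forall b, 0 <= b <= 1 -> {for c + b * d, continuous f}) ->
  (forall b, 0 <= b <= 1 ->
    f (c + b * d) = psi (c + b * d) + b * d / tau * psi' (c + b * d)) ->
  (\int[mu]_(v in `[0%R, 1%R]) (f (c + mixw tau v * d))%:E = (psi (c + d))%:E)%E.
Proof.
move=> t0 dpsi cf fE.
pose F v := v * psi (c + mixw tau v * d).
have mixI v : v \in `]0, 1[ -> 0 <= mixw tau v <= 1.
  by rewrite in_itv/= => /andP[v0 v1]; apply: mixw_itv => //; rewrite !ltW.
have dmix v : 0 < v ->
    is_derive v 1 (fun v => c + mixw tau v * d) (mixw tau v / (tau * v) * d).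
  move=> v0; have h := is_deriveD (is_derive_cst c v 1)
    (is_derive_mul (is_derive_mixw t0 v0) (is_derive_cst d v 1) erefl).
  by apply: is_derive_eq h _; rewrite add0r /cst mulr0 addr0.
have dF v : v \in `]0, 1[ -> is_derive v 1 F (f (c + mixw tau v * d)).
  move=> v01; have /andP[v0 v1] : 0 < v < 1 by move: v01; rewrite in_itv.
  have h := @is_derive_chain _ psi (fun v => c + mixw tau v * d) v _ _ _
    (dpsi _ (mixI _ v01)) (dmix _ v0) erefl.
  apply: (is_derive_mul (is_derive_id v 1) h).
  by rewrite fE ?mixI//; field; rewrite !gt_eqF.
have cv0 : (c + mixw tau v * d) @[v --> 0^'+] --> c + 0 * d.
  by apply: cvgD; [exact: cvg_cst|apply: cvgM; [exact: mixw_cvg0|exact: cvg_cst]].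
have cmix1 : {for 1, continuous (fun v => c + mixw tau v * d)}.
  exact: is_derive_continuous (dmix _ ltr01).
have cv1 : (c + mixw tau v * d) @[v --> 1^'-] --> c + 1 * d.
  apply: cvg_at_left_filter.
  by rewrite -{2}(mixw1 tau); exact: cmix1.
have I0 : 0 <= (0:R) <= 1 by rewrite lexx ler01.
have I1 : 0 <= (1:R) <= 1 by rewrite lexx ler01.
rewrite (@continuous_FTC2 _ (fun v => f (c + mixw tau v * d)) F)//.
- by rewrite /F mixw1 !mul1r mul0r sube0.
- apply/continuous_within_itvP; first exact: ltr01.
  split.
  + move=> v v01; apply: continuous_comp.
      apply: (is_derive_continuous (dmix _ _)).
      by move: v01; rewrite in_itv/= => /andP[].
    by apply: cf; exact: mixI.
  + rewrite mixw0//; apply: (cvg_comp _ _ cv0); exact: cf.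
  + rewrite mixw1; apply: (cvg_comp _ _ cv1); exact: cf.
- split.
  + by move=> v v01; have [] := dF _ v01.
  + rewrite {2}/F mul0r -[X in _ --> X](mul0r (psi (c + 0 * d))).
    apply: cvgM; first exact: cvg_at_right_filter.
    apply: (cvg_comp _ _ cv0); exact: (is_derive_continuous (dpsi _ I0)).
  + rewrite {2}/F mixw1; apply: cvgM; first exact: cvg_at_left_filter.
    apply: (cvg_comp _ _ cv1); exact: (is_derive_continuous (dpsi _ I1)).
- by move=> v v01; rewrite derive1E; have [_] := dF _ v01.
Qed.

(** Feynman parametrisation, with [psi c = c ^ -tau / (z + a)]. At [c = z + a + b (d - a)] the
    formula required of [f] collapses because [c - b (d - a) = z + a]. *)
Lemma integral_mixture_rpow tau z d a : 0 < tau -> 0 < z -> 0 <= d -> 0 <= a ->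
  (\int[mu]_(v in `[0%R, 1%R])
     (rpow (tau + 1) (z + (a + mixw tau v * (d - a))))%:E =
   (rpow tau (z + d) * rpow 1 (z + a))%:E)%E.
Proof.
move=> t0 z0 d0 a0.
have pos b : 0 <= b <= 1 -> 0 < (z + a) + b * (d - a).
  move=> /andP[b0 b1]; rewrite -addrA ltr_pwDl//.
  have : 0 <= b * d + (1 - b) * a by rewrite addr_ge0// mulr_ge0// subr_ge0.
  by move=> /le_trans; apply; lra.
under eq_integral do rewrite addrA.
apply: etrans; first apply: (@integral_mixture (rpow (tau + 1)) (fun c => rpow 1 (z + a) * rpow tau c)
  (fun c => rpow 1 (z + a) * (- tau * rpow (tau + 1) c))).
- exact: t0.
- by move=> b /pos b0; apply: is_derive_mulc; first exact: is_derive_rpow.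
- move=> b /pos b0; exact: (is_derive_continuous (is_derive_rpow _ b0)).
- move=> b /pos b0; rewrite rpowD !rpow1//; last by rewrite ltr_wpDr.
  by field; rewrite ?gt_eqF// ltr_wpDr.
- by rewrite (_ : z + a + (d - a) = z + d) 1?mulrC//; ring.
Qed.

(** The same [psi] as for real arguments, with [z = s + iy], of which only the real part is kept. *)
Lemma integral_mixture_cpow_re tau y s d a : 0 < tau -> 0 < y ->
  (\int[mu]_(v in `[0%R, 1%R])
     (cpow_re (tau + 1) y (s + (a + mixw tau v * (d - a))))%:E =
   (cpow_re tau y (s + d) * cpow_re 1 y (s + a) -
    cpow_im tau y (s + d) * cpow_im 1 y (s + a))%:E)%E.
Proof.
move=> t0 y0.
under eq_integral do rewrite addrA.
apply: etrans; first apply: (@integral_mixture (cpow_re (tau + 1) y)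
  (fun c => cpow_re 1 y (s + a) * cpow_re tau y c - cpow_im 1 y (s + a) * cpow_im tau y c)
  (fun c => cpow_re 1 y (s + a) * (- tau * cpow_re (tau + 1) y c) -
     cpow_im 1 y (s + a) * (- tau * cpow_im (tau + 1) y c))).
- exact: t0.
- move=> b b01; exact: (is_deriveB
    (is_derive_mulc (is_derive_cpow_re tau (s + a + b * (d - a)) y0) erefl)
    (is_derive_mulc (is_derive_cpow_im tau (s + a + b * (d - a)) y0) erefl)).
- move=> b b01; exact: continuous_cpow_re.
- move=> b b01; rewrite cpow_reD cpow_imD.
  have := @sqrD_gt0 _ y (s + a + b * (d - a)) y0.
  have := @sqrD_gt0 _ y (s + a) y0.
  rewrite !cpow_re1// !cpow_im1// => h1 h2.
  by field; rewrite (gt_eqF t0) (gt_eqF h1) (gt_eqF h2).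
- by rewrite (_ : s + a + (d - a) = s + d); [congr EFin; ring|ring].
Qed.

Lemma integral_mixture_cpow_im tau y s d a : 0 < tau -> 0 < y ->
  (\int[mu]_(v in `[0%R, 1%R])
     (cpow_im (tau + 1) y (s + (a + mixw tau v * (d - a))))%:E =
   (cpow_im tau y (s + d) * cpow_re 1 y (s + a) +
    cpow_re tau y (s + d) * cpow_im 1 y (s + a))%:E)%E.
Proof.
move=> t0 y0.
under eq_integral do rewrite addrA.
apply: etrans; first apply: (@integral_mixture (cpow_im (tau + 1) y)
  (fun c => cpow_re 1 y (s + a) * cpow_im tau y c + cpow_im 1 y (s + a) * cpow_re tau y c)
  (fun c => cpow_re 1 y (s + a) * (- tau * cpow_im (tau + 1) y c) +
     cpow_im 1 y (s + a) * (- tau * cpow_re (tau + 1) y c))).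
- exact: t0.
- move=> b b01; exact: (is_deriveD
    (is_derive_mulc (is_derive_cpow_im tau (s + a + b * (d - a)) y0) erefl)
    (is_derive_mulc (is_derive_cpow_re tau (s + a + b * (d - a)) y0) erefl)).
- move=> b b01; exact: continuous_cpow_im.
- move=> b b01; rewrite cpow_reD cpow_imD.
  have := @sqrD_gt0 _ y (s + a + b * (d - a)) y0.
  have := @sqrD_gt0 _ y (s + a) y0.
  rewrite !cpow_re1// !cpow_im1// => h1 h2.
  by field; rewrite (gt_eqF t0) (gt_eqF h1) (gt_eqF h2).
- by rewrite (_ : s + a + (d - a) = s + d); [congr EFin; ring|ring].
Qed.

End mixture.

(** * Stieltjes transforms *)

Section integral_lemmas.
Context d (T : measurableType d) (R : realType).

Lemma ae_Rdominated_cvg (mu : {measure set T -> \bar R}) (D : set T)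
    (f_ : nat -> T -> R) (f g : T -> R) :
  measurable D -> (forall n, measurable_fun D (f_ n)) -> measurable_fun D f ->
  {ae mu, forall x, D x -> f_ ^~ x @ \oo --> f x} ->
  mu.-integrable D (EFin \o g) ->
  {ae mu, forall x, forall n, D x -> `|f_ n x| <= g x} ->
  \int[mu]_(x in D) f_ n x @[n --> \oo] --> \int[mu]_(x in D) f x.
Proof.
move=> mD mf_ mf cvf ig fg.
have [||||intf _ h] := @dominated_convergence _ _ _ mu _ mD (fun n x => (f_ n x)%:E)
  (EFin \o f) (EFin \o g) _ _ _ ig _.
- by move=> n; exact/measurable_EFinP.
- exact/measurable_EFinP.
- apply: filterS cvf => x cvf Dx; apply: cvg_EFin; last exact: cvf.
  exact: nearW.
- by apply: filterS fg => x fg n Dx; rewrite lee_fin fg.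
- by apply: fine_cvg; rewrite fineK; [exact: h|exact: integrable_fin_num].
Qed.

Lemma Rdominated_cvg (mu : {measure set T -> \bar R}) (D : set T)
    (f_ : nat -> T -> R) (f g : T -> R) :
  measurable D -> (forall n, measurable_fun D (f_ n)) -> measurable_fun D f ->
  {ae mu, forall x, D x -> f_ ^~ x @ \oo --> f x} ->
  mu.-integrable D (EFin \o g) ->
  (forall n x, D x -> `|f_ n x| <= g x) ->
  \int[mu]_(x in D) f_ n x @[n --> \oo] --> \int[mu]_(x in D) f x.
Proof.
move=> mD mf_ mf cvf ig fg; apply: (ae_Rdominated_cvg mD mf_ mf cvf ig).
by apply: aeW => x n; exact: fg.
Qed.

Lemma bounded_integrable (P : probability T R) (f : T -> R) (K : R) :
  measurable_fun setT f -> (forall x, `|f x| <= K) -> P.-integrable setT (EFin \o f).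
Proof.
move=> mf fK; apply: measurable_bounded_integrable => //.
  by rewrite [X in (X < _)%E]probability_setT ltry.
by exists K; split; [exact: num_real|move=> z Kz x _ /=; exact: le_trans (fK x) (ltW Kz)].
Qed.

End integral_lemmas.

(** * Bernstein approximation *)

Section bernstein.
Context {R : realType}.
Implicit Types (f g : nat -> R) (u : R).

(* Bernstein polynomials, by de Casteljau's recursion *)
Fixpoint bern n f u : R :=
  if n is m.+1 then u * bern m (fun k => f k.+1) u + (1 - u) * bern m f u else f 0%N.

Lemma le_bern n f g u : 0 <= u <= 1 -> (forall k, f k <= g k) -> bern n f u <= bern n g u.
Proof.
move=> /andP[u0 u1]; elim: n f g => [|n ih] f g fg /=; first exact: fg.
by rewrite lerD// ler_wpM2l ?subr_ge0// ih.
Qed.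

(** Mean [n u] and variance [n u (1 - u)] of the binomial law. The shift [b] serves the induction,
    since one branch of the recursion replaces [k] by [k.+1]. *)
Lemma bern_sqr n (a m b : R) u :
  bern n (fun k => a + m * (k%:R + b) ^+ 2) u =
  a + m * (n%:R * u * (1 - u) + (n%:R * u + b) ^+ 2).
Proof.
elim: n b => [|n ih] b /=; first by rewrite !mul0r !add0r.
have -> : (fun k => a + m * (k.+1%:R + b) ^+ 2) = (fun k => a + m * (k%:R + (1 + b)) ^+ 2).
  by apply/funext => k; rewrite -natr1 -addrA.
by rewrite !ih -natr1; ring.
Qed.

(** Monotonicity sandwiches [bern n f u] between the images of two quadratics, which [bern_sqr]
    computes; this plays the role of the Chebyshev inequality. *)
Lemma bern_dist n f (c e m : R) u : 0 <= u <= 1 ->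
  (forall k, `|f k - c| <= e + m * (k%:R - n%:R * u) ^+ 2) ->
  `|bern n f u - c| <= e + m * (n%:R * u * (1 - u)).
Proof.
move=> u01 fE; rewrite ler_norml; apply/andP; split.
- have : bern n (fun k => c - e + - m * (k%:R + - (n%:R * u)) ^+ 2) u <= bern n f u.
    by apply: le_bern => // k; have := fE k; rewrite ler_norml => /andP[+ _]; lra.
  by rewrite bern_sqr; lra.
- have : bern n f u <= bern n (fun k => c + e + m * (k%:R + - (n%:R * u)) ^+ 2) u.
    by apply: le_bern => // k; have := fE k; rewrite ler_norml => /andP[_]; lra.
  by rewrite bern_sqr; lra.
Qed.

Lemma norm_bern n f (K u : R) : 0 <= u <= 1 -> (forall k, `|f k| <= K) ->
  `|bern n f u| <= K.
Proof.
move=> u01 fK; have := @bern_dist n f 0 K 0 u u01.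
rewrite subr0 mul0r addr0; apply => k.
by rewrite subr0 mul0r addr0.
Qed.

Lemma measurable_bern n f : measurable_fun setT (bern n f).
Proof.
elim: n f => [|n ih] f /=; first exact: measurable_cst.
by apply: measurable_funD; apply: measurable_funM => //; exact: measurable_funB.
Qed.

Lemma bern_cvg (g : R -> R) (K u : R) : 0 <= u <= 1 -> (forall x, `|g x| <= K) ->
  {for u, continuous g} ->
  bern n.+1 (fun k => g (k%:R / n.+1%:R)) u @[n --> \oo] --> g u.
Proof.
move=> u01 gK cg; apply/cvgrPdist_le => e e0.
have e20 : 0 < e / 2 by rewrite divr_gt0.
have K0 : 0 <= K by exact: le_trans (gK 0).
have /cvgrPdist_le/(_ _ e20)/nbhs_ballP[del /= del0 hdel] := cg.
(* With this [C] the quadratic term is at least the trivial bound [2 * K] once [k / n.+1] is at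
   distance at least [del] from [u]. *)
pose C := 2 * K / del ^+ 2.
have C0 : 0 <= C by apply: divr_ge0; [rewrite mulr_ge0|rewrite exprn_ge0// ltW].
have key n : `|bern n.+1 (fun k => g (k%:R / n.+1%:R)) u - g u| <= e / 2 + C / n.+1%:R.
  have n0 : 0 < n.+1%:R :> R by [].
  have := @bern_dist n.+1 (fun k => g (k%:R / n.+1%:R)) (g u) (e / 2)
    (C / n.+1%:R ^+ 2) u u01.
  move=> h; apply: (le_trans (h _)).
  - move=> k.
    have -> : C / n.+1%:R ^+ 2 * (k%:R - n.+1%:R * u) ^+ 2 = C * (k%:R / n.+1%:R - u) ^+ 2.
      by field; rewrite gt_eqF.
    have [kd|kd] := ltP `|u - k%:R / n.+1%:R| del.
    + rewrite distrC; apply: (le_trans (hdel _ kd)).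
      by rewrite lerDl mulr_ge0// sqr_ge0.
    + have -> : (k%:R / n.+1%:R - u) ^+ 2 = `|u - k%:R / n.+1%:R| ^+ 2.
        by rewrite real_normK ?num_real// -sqrrN opprB.
      have : 2 * K <= C * `|u - k%:R / n.+1%:R| ^+ 2.
        rewrite /C mulrAC ler_pdivlMr ?exprn_gt0//.
        by rewrite ler_wpM2l ?mulr_ge0// lerXn2r ?nnegrE// ltW.
      have := ler_normB (g (k%:R / n.+1%:R)) (g u).
      have := gK (k%:R / n.+1%:R); have := gK u; lra.
  - rewrite lerD2l.
    have -> : C / n.+1%:R ^+ 2 * (n.+1%:R * u * (1 - u)) = C / n.+1%:R * (u * (1 - u)).
      by field; rewrite gt_eqF.
    by rewrite ler_piMr ?divr_ge0//; case/andP: u01 => ? ?; nra.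
near=> n.
rewrite distrC; apply: (le_trans (key n)).
rewrite [leRHS]splitr lerD2l ler_pdivrMr// mulrC -ler_pdivrMr//.
have : C / (e / 2) <= n%:R by near: n; exact: nbhs_infty_ger.
by move=> /le_trans; apply; rewrite ler_nat.
Unshelve. all: by end_near. Qed.

End bernstein.

(** * Laws compared through weighted moments *)

Section stieltjes_transfer.
Context {R : realType}.
Context d1 (T1 : measurableType d1) (P1 : probability T1 R).
Context d2 (T2 : measurableType d2) (P2 : probability T2 R).

Section moments.
Variables (w1 u1 : T1 -> R) (w2 u2 : T2 -> R) (C : R).
Hypotheses (mw1 : measurable_fun setT w1) (mu1 : measurable_fun setT u1).
Hypotheses (mw2 : measurable_fun setT w2) (mu2 : measurable_fun setT u2).
Hypotheses (w1C : forall x, `|w1 x| <= C) (u1I : forall x, 0 <= u1 x <= 1).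
Hypotheses (w2C : forall x, `|w2 x| <= C) (u2I : forall x, 0 <= u2 x <= 1).
Hypothesis moments : forall k : nat,
  \int[P1]_x (w1 x * u1 x ^+ k) = \int[P2]_x (w2 x * u2 x ^+ k).

Let intg d (T : measurableType d) (P : probability T R) (w u : T -> R) n f k :
  measurable_fun setT w -> measurable_fun setT u -> (forall x, `|w x| <= C) ->
  (forall x, 0 <= u x <= 1) ->
  P.-integrable setT (EFin \o (fun x => w x * u x ^+ k * bern n f (u x))).
Proof.
move=> mw mu wC uI.
have mb : measurable_fun setT (fun x => bern n f (u x)).
  exact: measurableT_comp (measurable_bern n f) mu.
have bF : exists K : R, forall x, `|bern n f (u x)| <= K.
  elim: n f {mb} => [|n ih] f; first by exists `|f 0%N|.
  have [K1 hK1] := ih (fun k => f k.+1).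
  have [K2 hK2] := ih f.
  exists (K1 + K2) => x /=; apply: le_trans (ler_normD _ _) _.
  have /andP[ux0 ux1] := uI x.
  rewrite !normrM (ger0_norm ux0) (ger0_norm (x := 1 - u x)) ?subr_ge0//.
  apply: lerD.
  - by apply: le_trans (hK1 x); rewrite ler_piMl.
  - by apply: le_trans (hK2 x); rewrite ler_piMl// gerBl.
have [K hK] := bF.
apply: (@bounded_integrable _ _ _ P _ (C * K)).
  by apply: measurable_funM => //; apply: measurable_funM => //; exact: measurable_funX.
move=> x; rewrite normrM; apply: ler_pM => //.
rewrite normrM -[leRHS]mulr1; apply: ler_pM => //.
by have /andP[ux0 ux1] := uI x; rewrite ger0_norm ?exprn_ge0// exprn_ile1.
Qed.

(** The extra power [k] lets the induction absorb the factors [u] and [1 - u] of the recursion,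
    which only lead to the powers [k] and [k.+1]. *)
Lemma bern_moments n f k :
  \int[P1]_x (w1 x * u1 x ^+ k * bern n f (u1 x)) =
  \int[P2]_x (w2 x * u2 x ^+ k * bern n f (u2 x)).
Proof.
elim: n f k => [|n ih] f k /=.
  have i1 : P1.-integrable setT (EFin \o (fun x => w1 x * u1 x ^+ k)).
    have := @intg _ _ P1 w1 u1 0 (fun=> 1) k mw1 mu1 w1C u1I.
    by apply: eq_integrable => // x _ /=; rewrite mulr1.
  have i2 : P2.-integrable setT (EFin \o (fun x => w2 x * u2 x ^+ k)).
    have := @intg _ _ P2 w2 u2 0 (fun=> 1) k mw2 mu2 w2C u2I.
    by apply: eq_integrable => // x _ /=; rewrite mulr1.
  by rewrite !RintegralZr// moments.
have step d (T : measurableType d) (P : probability T R) (w u : T -> R) :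
  measurable_fun setT w -> measurable_fun setT u -> (forall x, `|w x| <= C) ->
  (forall x, 0 <= u x <= 1) ->
  \int[P]_x (w x * u x ^+ k *
     (u x * bern n (fun j => f j.+1) (u x) + (1 - u x) * bern n f (u x))) =
  \int[P]_x (w x * u x ^+ k.+1 * bern n (fun j => f j.+1) (u x)) +
  \int[P]_x (w x * u x ^+ k * bern n f (u x)) -
  \int[P]_x (w x * u x ^+ k.+1 * bern n f (u x)).
  move=> mw mu wC uI; rewrite -RintegralD ?intg// -RintegralB ?intg//; last first.
    exact: (integrableD measurableT (intg P n (fun j => f j.+1) k.+1 mw mu wC uI) (intg P n f k mw mu wC uI)).
  by apply: eq_Rintegral => x _; rewrite exprS; ring.
by rewrite !step// !ih.
Qed.

(** Continuity is asked only at the values of [u1] and [u2], not on all of [[0, 1]]: in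
    [stieltjes_transfer] the point [u = 0] stands for [S = +oo], where [g] may have no limit. *)
Lemma moments_continuous (g : R -> R) (K : R) :
  (forall x, `|g x| <= K) -> (forall x, {for u1 x, continuous g}) ->
  (forall x, {for u2 x, continuous g}) ->
  measurable_fun setT (fun x => g (u1 x)) -> measurable_fun setT (fun x => g (u2 x)) ->
  \int[P1]_x (w1 x * g (u1 x)) = \int[P2]_x (w2 x * g (u2 x)).
Proof.
move=> gK cg1 cg2 mg1 mg2.
pose b n u := bern n.+1 (fun k => g (k%:R / n.+1%:R)) u.
have lim d (T : measurableType d) (P : probability T R) (w u : T -> R) :
  measurable_fun setT w -> measurable_fun setT u -> (forall x, `|w x| <= C) ->
  (forall x, 0 <= u x <= 1) -> (forall x, {for u x, continuous g}) ->
  measurable_fun setT (fun x => g (u x)) ->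
  \int[P]_x (w x * b n (u x)) @[n --> \oo] --> \int[P]_x (w x * g (u x)).
  move=> mw mu wC uI cg mg.
  apply: (@Rdominated_cvg _ _ _ P setT (fun n x => w x * b n (u x)) _ (fun=> C * K)) => //.
  - move=> n; apply: measurable_funM => //.
    exact: measurableT_comp (measurable_bern _ _) mu.
  - exact: measurable_funM.
  - apply: aeW => x _; apply: cvgM; first exact: cvg_cst.
    by apply: (@bern_cvg _ g K).
  - exact: (@bounded_integrable _ _ _ P _ `|C * K|).
  - by move=> n x _; rewrite normrM ler_pM// norm_bern.
have l1 := lim _ _ P1 w1 u1 mw1 mu1 w1C u1I cg1 mg1.
have l2 := lim _ _ P2 w2 u2 mw2 mu2 w2C u2I cg2 mg2.
have e12 : (fun n => \int[P1]_x (w1 x * b n (u1 x))) =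
           (fun n => \int[P2]_x (w2 x * b n (u2 x))).
  apply/funext => n; have := bern_moments n.+1 (fun k => g (k%:R / n.+1%:R)) 0.
  by under eq_Rintegral do rewrite expr0 mulr1;
     under [in X in _ = X -> _]eq_Rintegral do rewrite expr0 mulr1.
rewrite e12 in l1.
exact: (cvg_unique (@norm_hausdorff R R^o) l1 l2).
Qed.

End moments.

(* [1 / (1 + S1)] and [1 / (1 + S2)], weighted by the [k]-th power, have the same moments. *)
Lemma stieltjes_transfer (S1 : T1 -> R) (S2 : T2 -> R) (k : R) (h : R -> R) (K : R) :
  0 <= k -> measurable_fun setT S1 -> measurable_fun setT S2 ->
  (forall x, 0 <= S1 x) -> (forall x, 0 <= S2 x) ->
  (forall n : nat, \int[P1]_x rpow (k + n%:R) (1 + S1 x) =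
                   \int[P2]_x rpow (k + n%:R) (1 + S2 x)) ->
  continuous h -> (forall s, 0 <= s -> `|h s| <= K * rpow k (1 + s)) ->
  \int[P1]_x h (S1 x) = \int[P2]_x h (S2 x).
Proof.
move=> k0 mS1 mS2 S10 S20 mom ch hK.
pose phi (s : R) : R := h s / rpow k (1 + s).
(* The inverse of [s |-> 1 / (1 + s)], truncated at [0] so that [hK], which concerns [0 <= s],
   bounds [g] on the whole line. *)
pose m (u : R) : R := Num.max (u^-1 - 1) 0.
pose g (u : R) : R := phi (m u).
have gS s : 0 <= s -> g (1 + s)^-1 = phi s.
  by move=> s0; rewrite /g /m invrK addrAC subrr add0r max_l.
have gK u : `|g u| <= K.
  have s0 : 0 <= m u by rewrite le_max lexx orbT.
  rewrite /g /phi.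
  by rewrite normrM normfV (ger0_norm (ltW (rpow_gt0 _ _))) ler_pdivrMr ?rpow_gt0// hK.
have cphi s : 0 <= s -> {for s, continuous phi}.
  move=> s0; apply: cvgM; first exact: ch.
  apply: cvgV; first by rewrite gt_eqF// rpow_gt0.
  apply: (is_derive_continuous (is_derive_addc (is_derive_rpow k _))).
  by rewrite ltr_pwDl.
have cg u : 0 < u -> {for u, continuous g}.
  move=> u0; apply: (@continuous_comp _ _ _ m phi u).
    apply: continuous_max; last exact: cst_continuous.
    apply: continuousB; last exact: cst_continuous.
    by apply: inv_continuous; rewrite gt_eqF.
  by apply: cphi; rewrite le_max lexx orbT.
have u1_gt0 (s : R) : 0 <= s -> 0 < (1 + s)^-1 by move=> s0; rewrite invr_gt0 ltr_pwDl.
have u1_itv (s : R) : 0 <= s -> 0 <= (1 + s)^-1 <= 1.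
  by move=> s0; rewrite ltW ?u1_gt0//= invf_le1 ?ltr_pwDl// lerDl.
have mrp j d (T : measurableType d) (S : T -> R) : measurable_fun setT S ->
    measurable_fun setT (fun x => rpow j (1 + S x)).
  move=> mS; rewrite /rpow; apply: measurableT_comp => //.
  apply: measurable_funM => //; apply: measurableT_comp => //.
  exact: measurable_funD.
have mV d (T : measurableType d) (S : T -> R) : (forall x, 0 <= S x) ->
    measurable_fun setT S -> measurable_fun setT (fun x => (1 + S x)^-1).
  move=> S0 mS; have := mrp 1 _ _ _ mS.
  by apply: eq_measurable_fun => x _; rewrite rpow1// ltr_pwDl.
have mh : measurable_fun setT h by exact: continuous_measurable_fun.
have mg d (T : measurableType d) (S : T -> R) : (forall x, 0 <= S x) ->
    measurable_fun setT S -> measurable_fun setT (fun x => g (1 + S x)^-1).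
  move=> S0 mS.
  have : measurable_fun setT (fun x => h (S x) * rpow (- k) (1 + S x)).
    apply: measurable_funM; last exact: mrp.
    exact: measurableT_comp mh mS.
  apply: eq_measurable_fun => x _; rewrite gS// /phi; congr (_ * _).
  by rewrite /rpow opprK mulNr expRN invrK.
have := @moments_continuous (fun x => rpow k (1 + S1 x)) (fun x => (1 + S1 x)^-1)
  (fun x => rpow k (1 + S2 x)) (fun x => (1 + S2 x)^-1) 1
  (mrp _ _ _ _ mS1) (mV _ _ _ S10 mS1) (mrp _ _ _ _ mS2) (mV _ _ _ S20 mS2) _ _ _ _ _
  g K gK _ _ (mg _ _ _ S10 mS1) (mg _ _ _ S20 mS2).
have gE d (T : measurableType d) (P : probability T R) (S : T -> R) : (forall x, 0 <= S x) ->
    \int[P]_x (rpow k (1 + S x) * g (1 + S x)^-1) = \int[P]_x h (S x).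
  move=> S0; apply: eq_Rintegral => x _; rewrite gS// /phi mulrCA divff ?mulr1//.
  by rewrite gt_eqF// rpow_gt0.
rewrite !gE//; apply.
- by move=> x; rewrite ger0_norm ?(ltW (rpow_gt0 _ _))// rpow_le1// lerDl.
- by move=> x; exact: u1_itv.
- by move=> x; rewrite ger0_norm ?(ltW (rpow_gt0 _ _))// rpow_le1// lerDl.
- by move=> x; exact: u1_itv.
- have E d (T : measurableType d) (P : probability T R) (S : T -> R) n : (forall x, 0 <= S x) ->
    \int[P]_x (rpow k (1 + S x) * (1 + S x)^-1 ^+ n) = \int[P]_x rpow (k + n%:R) (1 + S x).
    move=> S0; apply: eq_Rintegral => x _; rewrite rpowD; congr (_ * _).
    rewrite /rpow mulNr expRN exprVn; congr (_^-1).
    by rewrite mulr_natl -lnXn ?ltr_pwDl// lnK// posrE exprn_gt0// ltr_pwDl.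
  by move=> n; rewrite !E.
- by move=> x; apply: cg; exact: u1_gt0.
- by move=> x; apply: cg; exact: u1_gt0.
Qed.

End stieltjes_transfer.

(** * Expectations depending on a parameter *)

Section expectations.
Context {R : realType}.

Lemma is_derive_expectation d (T : measurableType d) (P : probability T R)
    (S : T -> R) (f f' : R -> R) (z u v K : R) : u < z < v -> 0 <= K ->
  (forall x, u < x < v -> P.-integrable setT (fun w => (f (x + S w))%:E)) ->
  (forall x w, u < x < v -> is_derive (x + S w) 1 f (f' (x + S w))) ->
  (forall x w, u < x < v -> `|f' (x + S w)| <= K) ->
  is_derive z 1 (fun z => \int[P]_w f (z + S w)) (\int[P]_w f' (z + S w)).
Proof.
move=> zuv K0 intf df f'K.
pose F x w := f (x + S w).
have dF x w : u < x < v -> is_derive x 1 (F ^~ w) (f' (x + S w)).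
  by move=> xuv; exact: is_derive_addrc (df x w xuv).
have pF x w : u < x < v -> partial1of2 F x w = f' (x + S w).
  by move=> xuv; rewrite partial1of2E; have [_] := dF x w xuv.
have inE x : `]u, v[%classic x -> u < x < v by rewrite /= in_itv.
have Iz : `]u, v[%classic z by rewrite /= in_itv.
have iF x : `]u, v[%classic x -> P.-integrable setT (EFin \o F x).
  by move=> /inE xuv; exact: intf.
have derF x w : `]u, v[%classic x -> setT w -> derivable (F ^~ w) x 1.
  by move=> /inE xuv _; have [] := dF x w xuv.
have iK : P.-integrable setT (EFin \o (fun=> K)).
  by apply: (@bounded_integrable _ _ _ P _ K) => // x; rewrite ger0_norm.
have bF x w : `]u, v[%classic x -> setT w -> `|partial1of2 F x w| <= K.
  by move=> /inE xuv _; rewrite pF// f'K.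
apply: DeriveDef.
  exact: (@derivable_under_integral _ _ _ P F setT measurableT z u v Iz iF derF
    (fun=> K) (fun=> K0) iK bF).
rewrite -derive1E (@differentiation_under_integral _ _ _ P F setT measurableT z u v Iz
  iF derF (fun=> K) (fun=> K0) iK bF).
by apply: eq_Rintegral => w _; rewrite pF.
Qed.

Lemma Rfubini d1 (T1 : measurableType d1) (P1 : probability T1 R)
    d2 (T2 : measurableType d2) (P2 : probability T2 R) (F : T1 * T2 -> R) (K : R) :
  measurable_fun setT F -> (forall x, `|F x| <= K) ->
  \int[(P1 \x P2)%E]_x F x = \int[P1]_x \int[P2]_y F (x, y).
Proof.
move=> mF FK; rewrite /Rintegral -integral12_prod_meas1; last first.
  exact: (@bounded_integrable _ _ _ (P1 \x P2)%E _ K).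
congr fine; apply: eq_integral => x _; rewrite /fubini_F fineK//.
apply: integrable_fin_num => //.
apply: (@bounded_integrable _ _ _ P2 (fun y => F (x, y)) K) => //.
exact: measurableT_comp mF _.
Qed.

Lemma Rfubini_mul d1 (T1 : measurableType d1) (P1 : probability T1 R)
    d2 (T2 : measurableType d2) (P2 : probability T2 R)
    (f : T1 -> R) (g : T2 -> R) (K L : R) :
  measurable_fun setT f -> measurable_fun setT g ->
  (forall x, `|f x| <= K) -> (forall x, `|g x| <= L) ->
  \int[(P1 \x P2)%E]_x (f x.1 * g x.2) = \int[P1]_x f x * \int[P2]_y g y.
Proof.
move=> mf mg fK gL; rewrite (@Rfubini _ _ _ _ _ _ _ (K * L)); last 2 first.
- by apply: measurable_funM; apply: measurableT_comp.
- by move=> x; rewrite normrM ler_pM.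
have intg : P2.-integrable setT (EFin \o g) by exact: (@bounded_integrable _ _ _ P2 g L).
have intf : P1.-integrable setT (EFin \o f) by exact: (@bounded_integrable _ _ _ P1 f K).
rewrite -RintegralZr//; apply: eq_Rintegral => x _ /=.
by rewrite RintegralZl.
Qed.

Lemma integrable_rpow d (T : measurableType d) (P : probability T R) (S : T -> R) (k z : R) :
  0 <= k -> 0 < z -> measurable_fun setT S -> (forall w, 0 <= S w) ->
  P.-integrable setT (fun w => (rpow k (z + S w))%:E).
Proof.
move=> k0 z0 mS S0; apply: (@bounded_integrable _ _ _ P (fun w => rpow k (z + S w)) (rpow k z)).
  rewrite /rpow; apply: measurableT_comp => //.
  apply: measurable_funM => //; apply: measurableT_comp => //.
  exact: measurable_funD.
by move=> w; rewrite ger0_norm ?(ltW (rpow_gt0 _ _))// ler_rpow// lerDl.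
Qed.

Lemma is_derive_expectation_rpow d (T : measurableType d) (P : probability T R)
    (S : T -> R) (k z : R) :
  0 <= k -> 0 < z -> measurable_fun setT S -> (forall w, 0 <= S w) ->
  is_derive z 1 (fun z => \int[P]_w rpow k (z + S w))
    (- k * \int[P]_w rpow (k + 1) (z + S w)).
Proof.
move=> k0 z0 mS S0.
have k1 : 0 <= k + 1 by rewrite addr_ge0.
rewrite -RintegralZl//; last exact: integrable_rpow.
have z2 : 0 < z / 2 by rewrite divr_gt0.
apply: (@is_derive_expectation _ _ P S (rpow k) (fun c => - k * rpow (k + 1) c) z
  (z / 2) (z + 1) (k * rpow (k + 1) (z / 2))).
- by apply/andP; split; lra.
- by rewrite mulr_ge0// ltW// rpow_gt0.
- by move=> x /andP[xz _]; apply: integrable_rpow => //; exact: lt_trans xz.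
- move=> x w /andP[xz _]; apply: is_derive_rpow.
  by rewrite ltr_pwDl//; exact: lt_trans xz.
- move=> x w /andP[xz _]; rewrite normrM normrN (ger0_norm k0) ler_wpM2l//.
  rewrite ger0_norm ?(ltW (rpow_gt0 _ _))// ler_rpow//.
  by rewrite (le_trans (ltW xz))// lerDl.
Qed.

(** Differentiating in [z] raises the exponent by one. Hence an identity for one exponent and all
    [z > 0] yields the whole sequence of exponents that [stieltjes_transfer] asks for. *)
Lemma rpow_expectation_succ d1 (T1 : measurableType d1) (P1 : probability T1 R)
    d2 (T2 : measurableType d2) (P2 : probability T2 R)
    (S1 : T1 -> R) (S2 : T2 -> R) (k : R) : 0 < k ->
  measurable_fun setT S1 -> measurable_fun setT S2 ->
  (forall w, 0 <= S1 w) -> (forall w, 0 <= S2 w) ->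
  (forall z, 0 < z -> \int[P1]_w rpow k (z + S1 w) = \int[P2]_w rpow k (z + S2 w)) ->
  forall z, 0 < z ->
    \int[P1]_w rpow (k + 1) (z + S1 w) = \int[P2]_w rpow (k + 1) (z + S2 w).
Proof.
move=> k0 mS1 mS2 S10 S20 e12 z z0.
have [_ d1E] := is_derive_expectation_rpow P1 (ltW k0) z0 mS1 S10.
have [_ d2E] := is_derive_expectation_rpow P2 (ltW k0) z0 mS2 S20.
apply: (@mulfI _ (- k)); first by rewrite oppr_eq0 gt_eqF.
rewrite -d1E -d2E; apply: near_eq_derive.
near=> x; apply: e12; near: x; exact: lt_nbhsr.
Unshelve. all: by end_near. Qed.

Lemma rpow_expectation_add d1 (T1 : measurableType d1) (P1 : probability T1 R)
    d2 (T2 : measurableType d2) (P2 : probability T2 R)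
    (S1 : T1 -> R) (S2 : T2 -> R) (k : R) (n : nat) : 0 < k ->
  measurable_fun setT S1 -> measurable_fun setT S2 ->
  (forall w, 0 <= S1 w) -> (forall w, 0 <= S2 w) ->
  (forall z, 0 < z -> \int[P1]_w rpow k (z + S1 w) = \int[P2]_w rpow k (z + S2 w)) ->
  forall z, 0 < z ->
    \int[P1]_w rpow (k + n%:R) (z + S1 w) = \int[P2]_w rpow (k + n%:R) (z + S2 w).
Proof.
move=> k0 mS1 mS2 S10 S20 e12; elim: n => [|n ih]; first by rewrite addr0.
rewrite -natr1 addrA; apply: rpow_expectation_succ => //.
by rewrite ltr_wpDr.
Qed.

End expectations.

(** * The identity for complex arguments *)

Section continuation.
Context {R : realType}.
Context d (T : measurableType d) (P : probability T R) (A : T -> R).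
Context d' (T' : measurableType d') (P' : probability T' R) (D : T' -> R).
Hypotheses (mA : measurable_fun setT A) (A0 : forall w, 0 <= A w).
Hypotheses (mD : measurable_fun setT D) (D0 : forall w, 0 <= D w).
Hypothesis iA : P.-integrable setT (fun w => (ln (1 + A w))%:E).
Implicit Types z c s y : R.
Variable tau : R.
Hypothesis tau0 : 0 < tau.
Hypothesis DA : forall z, 0 < z ->
  \int[P']_w rpow tau (z + D w) = expR (- tau * \int[P]_w ln (z + A w)).

Lemma integrable_le (f g : T -> R) : measurable_fun setT f ->
  P.-integrable setT (fun w => (g w)%:E) -> (forall w, `|f w| <= g w) ->
  P.-integrable setT (fun w => (f w)%:E).
Proof.
move=> mf ig fg; apply: (le_integrable _ _ _ ig) => //; first exact/measurable_EFinP.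
by move=> w _; rewrite !abse_EFin lee_fin (le_trans (fg w))// ler_norm.
Qed.

Lemma ln1pA_ge0 w : 0 <= ln (1 + A w).
Proof. by rewrite ln_ge0// lerDl. Qed.

Lemma measurable_lnDA z : measurable_fun setT (fun w => ln (z + A w)).
Proof. by apply: measurableT_comp => //; exact: measurable_funD. Qed.

Lemma integrable_cDln1pA (c : R) : P.-integrable setT (fun w => (c + ln (1 + A w))%:E).
Proof.
under eq_fun do rewrite EFinD; apply: integrableD => //.
by apply: (@bounded_integrable _ _ _ P (fun=> c) `|c|).
Qed.

Lemma integrable_lnDA z : 0 < z -> P.-integrable setT (fun w => (ln (z + A w))%:E).
Proof.
move=> z0; apply: (integrable_le (g := fun w => `|ln z| + ln (1 + z) + ln (1 + A w))).
- exact: measurable_lnDA.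
- exact: integrable_cDln1pA.
- move=> w; rewrite ler_norml; apply/andP; split.
  + have h1 : ln z <= ln (z + A w) by rewrite ler_ln ?posrE ?lerDl// ltr_pwDl.
    have h2 : 0 <= ln (1 + z) by rewrite ln_ge0// lerDl ltW.
    have h3 := ln1pA_ge0 w; have h4 := ler_norm (- ln z); rewrite normrN in h4; lra.
  + have h1 : ln (z + A w) <= ln ((1 + z) * (1 + A w)).
      rewrite ler_ln ?posrE ?ltr_pwDl// ?mulr_gt0// ?ltr_pwDl// ?ltW//.
      have := mulr_ge0 (ltW z0) (A0 w); nra.
    have h2 : ln ((1 + z) * (1 + A w)) = ln (1 + z) + ln (1 + A w).
      by rewrite lnM ?posrE ?ltr_pwDl// ltW.
    by rewrite h2 in h1; have := normr_ge0 (ln z); lra.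
Qed.

Lemma is_derive_expectation_ln z : 0 < z ->
  is_derive z 1 (fun z => \int[P]_w ln (z + A w)) (\int[P]_w rpow 1 (z + A w)).
Proof.
move=> z0.
have z2 : 0 < z / 2 by rewrite divr_gt0.
apply: (@is_derive_expectation _ _ _ P A (@ln R) (rpow 1) z (z / 2) (z + 1)
  (rpow 1 (z / 2))).
- by apply/andP; split; lra.
- exact/ltW/rpow_gt0.
- by move=> x /andP[xz _]; apply: integrable_lnDA; exact: lt_trans xz.
- move=> x w /andP[xz _].
  have x0 : 0 < x + A w by rewrite ltr_pwDl//; exact: lt_trans xz.
  by rewrite rpow1//; exact: is_derive1_ln.
- move=> x w /andP[xz _].
  rewrite ger0_norm ?(ltW (rpow_gt0 _ _))// ler_rpow//.
  by rewrite (le_trans (ltW xz))// lerDl.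
Qed.

(* The exponential identity [DA] is not linear in the law of [A]; its derivative is, which
   is what makes [stieltjes_transfer] applicable. *)
Lemma rpow_expectation_bilinear z : 0 < z ->
  \int[P']_w rpow (tau + 1) (z + D w) =
  \int[P']_w rpow tau (z + D w) * \int[P]_w rpow 1 (z + A w).
Proof.
move=> z0.
have [_ dE] := is_derive_expectation_rpow P' (ltW tau0) z0 mD D0.
have h : is_derive z 1 (fun z => expR (- tau * \int[P]_w ln (z + A w)))
   (expR (- tau * \int[P]_w ln (z + A w)) * (- tau * \int[P]_w rpow 1 (z + A w))).
  apply: (@is_derive_chain _ expR (fun z => - tau * \int[P]_w ln (z + A w)) z
    (expR (- tau * \int[P]_w ln (z + A w))) (- tau * \int[P]_w rpow 1 (z + A w))) => //.
  exact: is_derive_mulc (is_derive_expectation_ln z0) erefl.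
have [_ dE2] := h.
apply: (@mulfI _ (- tau)); first by rewrite oppr_eq0 gt_eqF.
rewrite -dE DA// [RHS]mulrCA -dE2; apply: near_eq_derive.
near=> x; apply: DA; near: x; exact: lt_nbhsr.
Unshelve. all: by end_near. Qed.

(* keeps [mixDA] nonnegative for all values of its third coordinate *)
Definition clamp01 (v : R) : R := Num.max 0 (Num.min v 1).

Lemma clamp01_itv v : 0 <= clamp01 v <= 1.
Proof. by rewrite /clamp01 le_max lexx/= ge_max ler01 ge_min lexx orbT. Qed.

Lemma clamp01_id v : 0 <= v <= 1 -> clamp01 v = v.
Proof. by move=> /andP[v0 v1]; rewrite /clamp01 min_l// max_r. Qed.

Let U : probability (measurableTypeR R) R := uniform_prob (@ltr01 R).
Let Q := ((P' \x P) \x U)%E.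

Definition mixDA (x : T' * T * measurableTypeR R) : R :=
  A x.1.2 + mixw tau (clamp01 x.2) * (D x.1.1 - A x.1.2).

Lemma mixDA_ge0 x : 0 <= mixDA x.
Proof.
have /andP[b0 b1] := mixw_itv tau0 (clamp01_itv x.2).
rewrite /mixDA; set b := mixw _ _ in b0 b1 *.
have : 0 <= b * D x.1.1 + (1 - b) * A x.1.2 by rewrite addr_ge0// mulr_ge0// subr_ge0.
by move=> /le_trans; apply; lra.
Qed.

Lemma measurable_mixDA : measurable_fun setT mixDA.
Proof.
have m1 : measurable_fun setT (fun x : T' * T * measurableTypeR R => A x.1.2).
  apply: measurableT_comp => //; exact: measurableT_comp.
have m2 : measurable_fun setT (fun x : T' * T * measurableTypeR R => D x.1.1).
  apply: measurableT_comp => //; exact: measurableT_comp.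
apply: measurable_funD => //; apply: measurable_funM; last exact: measurable_funB.
apply: (@measurableT_comp _ _ _ _ _ _ (fun v => mixw tau (clamp01 v))) => //.
apply: measurableT_comp; first exact: measurable_powR.
apply: measurable_maxr => //; exact: measurable_minr.
Qed.

Lemma integral_mixDA (h : R -> R) (psi : T' -> T -> R) (K : R) :
  measurable_fun setT h -> (forall s, 0 <= s -> `|h s| <= K) ->
  (forall w' w, (\int[lebesgue_measure]_(v in `[0%R, 1%R])
     (h (A w + mixw tau v * (D w' - A w)))%:E = (psi w' w)%:E)%E) ->
  \int[Q]_x h (mixDA x) = \int[(P' \x P)%E]_x psi x.1 x.2.
Proof.
move=> mh hK hpsi.
have mhm : measurable_fun setT (fun x => h (mixDA x)).
  exact: measurableT_comp mh measurable_mixDA.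
rewrite (@Rfubini _ _ _ (P' \x P)%E _ _ U _ K)//; last first.
  by move=> x; apply: hK; exact: mixDA_ge0.
apply: eq_Rintegral => -[w' w] _ /=.
have mF : measurable_fun setT (fun v : measurableTypeR R => h (mixDA ((w', w), v))).
  exact: measurableT_comp mhm _.
pose K1 := `|K|.
have K10 : 0 <= K1 := normr_ge0 K.
have hK1 s : 0 <= s -> - K1 <= h s <= K1.
  by move=> s0; rewrite -ler_norml (le_trans (hK _ s0))// ler_norm.
have iF : U.-integrable setT (EFin \o (fun v => h (mixDA ((w', w), v)))).
  by apply: (@bounded_integrable _ _ _ U _ K) => // v; apply: hK; exact: mixDA_ge0.
have iK : U.-integrable setT (EFin \o (fun=> K1)).
  by apply: (@bounded_integrable _ _ _ U _ K1) => // v; rewrite ger0_norm.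
have Kpos v : 0 <= h (mixDA ((w', w), v)) + K1.
  by have /andP[+ _] := hK1 _ (mixDA_ge0 ((w', w), v)); lra.
have iL : lebesgue_measure.-integrable `[0%R, 1%R]
    (EFin \o (fun v => h (mixDA ((w', w), v)))).
  apply: measurable_bounded_integrable => //.
  - by rewrite /= lebesgue_measure_itv/= lte01 -EFinB ltry.
  - exact: measurable_funTS.
  - exists K1; split; first exact: num_real.
    move=> z K1z v _ /=; apply: le_trans (ltW K1z).
    by rewrite ler_norml; apply: hK1; exact: mixDA_ge0.
have EL : (\int[lebesgue_measure]_(v in `[0%R, 1%R]) (h (mixDA ((w', w), v)))%:E
    = (psi w' w)%:E)%E.
  rewrite -hpsi; apply: eq_integral => v; rewrite inE/= in_itv/= => v01.
  by rewrite /mixDA /= clamp01_id.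
(* the constant is added because [integral_uniform] needs a nonnegative integrand *)
apply: (@addIr _ K1).
have <- : \int[U]_v (h (mixDA ((w', w), v)) + K1) =
    \int[U]_v h (mixDA ((w', w), v)) + K1.
  rewrite RintegralD// Rintegral_cst//.
  by rewrite [X in fine X]probability_setT mulr1.
rewrite /Rintegral integral_uniform//; last first.
  by apply/measurable_EFinP; exact: measurable_funD.
rewrite subr0 invr1 mul1e.
under eq_integral do rewrite EFinD.
rewrite integralD//; last first.
  apply: measurable_bounded_integrable => //.
  - by rewrite /= lebesgue_measure_itv/= lte01 -EFinB ltry.
  - exists K1; split; first exact: num_real.
    by move=> z K1z v _ /=; rewrite ger0_norm// ltW.
by rewrite EL integral_cst//= lebesgue_measure_itv/= lte01 -EFinB subr0 mule1.
Qed.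

(** The mixture turns a product of two expectations into a single one, which brings the bilinear
    identity into the form compared by [stieltjes_transfer]. *)
Lemma rpow_expectation_mix z : 0 < z ->
  \int[P']_w rpow (tau + 1) (z + D w) = \int[Q]_x rpow (tau + 1) (z + mixDA x).
Proof.
move=> z0; rewrite rpow_expectation_bilinear//.
pose h s := rpow (tau + 1) (z + s).
have mh : measurable_fun setT h.
  rewrite /h /rpow; apply: measurableT_comp => //.
  apply: measurable_funM => //; apply: measurableT_comp => //.
  exact: measurable_funD.
have t10 : 0 <= tau + 1 by rewrite addr_ge0// ltW.
rewrite -/(h _) (@integral_mixDA h
  (fun w' w => rpow tau (z + D w') * rpow 1 (z + A w)) (rpow (tau + 1) z))//.
- rewrite (@Rfubini_mul _ _ _ P' _ _ P (fun w' => rpow tau (z + D w'))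
    (fun w => rpow 1 (z + A w)) (rpow tau z) (rpow 1 z))//.
  + exact/measurable_EFinP/(measurable_int _ (integrable_rpow P' (ltW tau0) z0 mD D0)).
  + exact/measurable_EFinP/(measurable_int _ (integrable_rpow P ler01 z0 mA A0)).
  + by move=> w; rewrite ger0_norm ?(ltW (rpow_gt0 _ _))// ler_rpow ?lerDl// ltW.
  + by move=> w; rewrite ger0_norm ?(ltW (rpow_gt0 _ _))// ler_rpow ?lerDl.
- by move=> s s0; rewrite ger0_norm ?(ltW (rpow_gt0 _ _))// ler_rpow ?lerDl.
- by move=> w' w; rewrite -integral_mixture_rpow.
Qed.

(** Cauchy-Schwarz applied to [1 + c = (s + c) * 1 + y * ((1 - s) / y)] gives [(1 + c)^2 <= ((s +
    c)^2 + y^2) (1 + (1 - s)^2 / y^2)]. This is the growth bound on test functions in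
    [stieltjes_transfer]. *)
Lemma cpow_kernel_le (k y s c : R) : 0 <= k -> 0 < y -> 0 <= c ->
  expR (- k * lmod y (s + c)) <=
  expR (k * (ln (1 + (1 - s) ^+ 2 / y ^+ 2) / 2)) * rpow k (1 + c).
Proof.
move=> k0 y0 c0; rewrite /rpow -expRD ler_expR -subr_ge0.
have -> : k * (ln (1 + (1 - s) ^+ 2 / y ^+ 2) / 2) + - k * ln (1 + c) - - k * lmod y (s + c) =
    k * (ln (1 + (1 - s) ^+ 2 / y ^+ 2) / 2 + lmod y (s + c) - ln (1 + c)) by ring.
rewrite mulr_ge0// /lmod.
have M0 : 0 < 1 + (1 - s) ^+ 2 / y ^+ 2.
  by rewrite ltr_pwDl// divr_ge0// sqr_ge0.
have X0 := sqrD_gt0 (s + c) y0.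
have c1 : 0 < 1 + c by rewrite ltr_pwDl.
have : ln ((1 + c) ^+ 2) <= ln ((1 + (1 - s) ^+ 2 / y ^+ 2) * ((s + c) ^+ 2 + y ^+ 2)).
  rewrite ler_ln ?posrE ?exprn_gt0// ?mulr_gt0// -subr_ge0.
  have -> : (1 + (1 - s) ^+ 2 / y ^+ 2) * ((s + c) ^+ 2 + y ^+ 2) - (1 + c) ^+ 2 =
      (y - (1 - s) / y * (s + c)) ^+ 2 by field; rewrite gt_eqF.
  exact: sqr_ge0.
have -> : ln ((1 + (1 - s) ^+ 2 / y ^+ 2) * ((s + c) ^+ 2 + y ^+ 2)) =
  ln (1 + (1 - s) ^+ 2 / y ^+ 2) + ln ((s + c) ^+ 2 + y ^+ 2) by rewrite lnM.
rewrite lnXn//; set a := ln _; set b := ln _; set e := ln _.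
by rewrite mulr2n; lra.
Qed.

Let mcomp (f : R -> R) d0 (T0 : measurableType d0) (S : T0 -> R) s :
  continuous f -> measurable_fun setT S -> measurable_fun setT (fun w => f (s + S w)).
Proof.
move=> cf mS; apply: (@measurableT_comp _ _ _ _ _ _ f).
  exact: continuous_measurable_fun.
exact: measurable_funD.
Qed.

(** The passage from real to complex arguments: the equality of laws coming from real [z] is tested
    on real and imaginary parts of [(c + iy) ^ -(tau + 1)], which the modulus dominates. *)
Let cpow_mix (h : R -> R) y s : 0 < y -> continuous h ->
  (forall c, `|h c| <= expR (- (tau + 1) * lmod y c)) ->
  \int[P']_w h (s + D w) = \int[Q]_x h (s + mixDA x).
Proof.
move=> y0 ch hb.
have t10 : 0 < tau + 1 by rewrite addr_gt0.
apply: (@stieltjes_transfer _ _ _ P' _ _ Q D mixDA (tau + 1) (fun c => h (s + c))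
  (expR ((tau + 1) * (ln (1 + (1 - s) ^+ 2 / y ^+ 2) / 2)))).
- exact: ltW.
- exact: mD.
- exact: measurable_mixDA.
- exact: D0.
- exact: mixDA_ge0.
- move=> n; apply: rpow_expectation_add => //.
  + exact: measurable_mixDA.
  + exact: mixDA_ge0.
  + exact: rpow_expectation_mix.
- move=> c; apply: (@continuous_comp _ _ _ (fun c => s + c) h); last exact: ch.
  by apply: cvgD; [exact: cvg_cst|exact: cvg_id].
- by move=> c c0; apply: le_trans (hb _) _; apply: cpow_kernel_le => //; exact: ltW.
Qed.

Lemma cpow_bound_re k y c : 0 <= k -> 0 < y -> `|cpow_re k y c| <= rpow k y.
Proof. by move=> k0 y0; rewrite (le_trans (norm_cpow_re_le _ _ _))// expMlmod_le. Qed.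

Lemma cpow_bound_im k y c : 0 <= k -> 0 < y -> `|cpow_im k y c| <= rpow k y.
Proof. by move=> k0 y0; rewrite (le_trans (norm_cpow_im_le _ _ _))// expMlmod_le. Qed.

Let cpow_prod (f g : R -> R) (K L : R) s : continuous f -> continuous g ->
  (forall c, `|f c| <= K) -> (forall c, `|g c| <= L) ->
  (P' \x P)%E.-integrable setT (fun x => (f (s + D x.1) * g (s + A x.2))%:E) /\
  \int[(P' \x P)%E]_x (f (s + D x.1) * g (s + A x.2)) =
  \int[P']_w f (s + D w) * \int[P]_w g (s + A w).
Proof.
move=> cf cg fK gL; have mf := mcomp s cf mD; have mg := mcomp s cg mA.
split; last exact: (@Rfubini_mul _ _ _ P' _ _ P (fun w => f (s + D w)) (fun w => g (s + A w)) K L).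
apply: (@bounded_integrable _ _ _ (P' \x P)%E
  (fun x => f (s + D x.1) * g (s + A x.2)) (K * L)); last first.
  by move=> x; rewrite normrM ler_pM.
by apply: measurable_funM; [apply: (measurableT_comp mf)|apply: (measurableT_comp mg)].
Qed.

Lemma cpow_re_bilinear y s : 0 < y ->
  \int[P']_w cpow_re (tau + 1) y (s + D w) =
  \int[P']_w cpow_re tau y (s + D w) * \int[P]_w cpow_re 1 y (s + A w) -
  \int[P']_w cpow_im tau y (s + D w) * \int[P]_w cpow_im 1 y (s + A w).
Proof.
move=> y0; have t10 : 0 <= tau + 1 by rewrite addr_ge0// ltW.
rewrite (@cpow_mix (cpow_re (tau + 1) y) y s y0 (@continuous_cpow_re _ _ _ y0)); last first.
  by move=> c; exact: norm_cpow_re_le.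
rewrite (@integral_mixDA (fun c => cpow_re (tau + 1) y (s + c)) (fun w' w =>
    cpow_re tau y (s + D w') * cpow_re 1 y (s + A w) -
    cpow_im tau y (s + D w') * cpow_im 1 y (s + A w)) (rpow (tau + 1) y)).
- have [i1 e1] := cpow_prod s (@continuous_cpow_re _ tau _ y0) (@continuous_cpow_re _ 1 _ y0)
    (fun c => cpow_bound_re c (ltW tau0) y0) (fun c => cpow_bound_re c ler01 y0).
  have [i2 e2] := cpow_prod s (@continuous_cpow_im _ tau _ y0) (@continuous_cpow_im _ 1 _ y0)
    (fun c => cpow_bound_im c (ltW tau0) y0) (fun c => cpow_bound_im c ler01 y0).
  by rewrite -e1 -e2 -RintegralB.
- exact: (@mcomp (cpow_re (tau + 1) y) _ _ (fun c => c) s (@continuous_cpow_re _ _ _ y0) (@measurable_id _ _ _)).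
- by move=> c _; exact: cpow_bound_re.
- by move=> w' w; exact: integral_mixture_cpow_re.
Qed.

Lemma cpow_im_bilinear y s : 0 < y ->
  \int[P']_w cpow_im (tau + 1) y (s + D w) =
  \int[P']_w cpow_im tau y (s + D w) * \int[P]_w cpow_re 1 y (s + A w) +
  \int[P']_w cpow_re tau y (s + D w) * \int[P]_w cpow_im 1 y (s + A w).
Proof.
move=> y0; have t10 : 0 <= tau + 1 by rewrite addr_ge0// ltW.
rewrite (@cpow_mix (cpow_im (tau + 1) y) y s y0 (@continuous_cpow_im _ _ _ y0)); last first.
  by move=> c; exact: norm_cpow_im_le.
rewrite (@integral_mixDA (fun c => cpow_im (tau + 1) y (s + c)) (fun w' w =>
    cpow_im tau y (s + D w') * cpow_re 1 y (s + A w) +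
    cpow_re tau y (s + D w') * cpow_im 1 y (s + A w)) (rpow (tau + 1) y)).
- have [i1 e1] := cpow_prod s (@continuous_cpow_im _ tau _ y0) (@continuous_cpow_re _ 1 _ y0)
    (fun c => cpow_bound_im c (ltW tau0) y0) (fun c => cpow_bound_re c ler01 y0).
  have [i2 e2] := cpow_prod s (@continuous_cpow_re _ tau _ y0) (@continuous_cpow_im _ 1 _ y0)
    (fun c => cpow_bound_re c (ltW tau0) y0) (fun c => cpow_bound_im c ler01 y0).
  by rewrite -e1 -e2 -RintegralD.
- exact: (@mcomp (cpow_im (tau + 1) y) _ _ (fun c => c) s (@continuous_cpow_im _ _ _ y0) (@measurable_id _ _ _)).
- by move=> c _; exact: cpow_bound_im.
- by move=> w' w; exact: integral_mixture_cpow_im.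
Qed.


Lemma lmod_ge_ln y c : 0 < y -> ln y <= lmod y c.
Proof.
move=> y0; rewrite /lmod ler_pdivlMr// mulr_natr -lnXn// ler_ln ?posrE ?sqrD_gt0 ?exprn_gt0//.
by rewrite lerDr sqr_ge0.
Qed.

Lemma lmod_le_ln y s c : 0 < y -> 0 <= c ->
  lmod y (s + c) <= ln (1 + `|s| + y) + ln (1 + c).
Proof.
move=> y0 c0; rewrite /lmod ler_pdivrMr// mulr_natr.
have p1 : 0 < 1 + `|s| + y by have := normr_ge0 s; lra.
have p2 : 0 < 1 + c by lra.
rewrite -lnM// -lnXn ?mulr_gt0// ler_ln ?posrE ?sqrD_gt0 ?exprn_gt0 ?mulr_gt0//.
have h : `|s + c| <= `|s| + c by rewrite (le_trans (ler_normD _ _))// (ger0_norm c0).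
have -> : (s + c) ^+ 2 = `|s + c| ^+ 2 by rewrite real_normK ?num_real.
have s0 := normr_ge0 s; have sc0 := normr_ge0 (s + c).
move: (`|s|) (`|s + c|) h s0 sc0 {p1} => a b ab a0 b0.
have h1 : b ^+ 2 <= (a + c) ^+ 2 by rewrite lerXn2r ?nnegrE// addr_ge0.
apply: (le_trans (y := (a + c + y) ^+ 2)); first by nra.
rewrite lerXn2r ?nnegrE ?addr_ge0 ?mulr_ge0 ?addr_ge0 ?(ltW y0)//.
by have := mulr_ge0 a0 c0; have := mulr_ge0 (ltW y0) c0; lra.
Qed.

Lemma integrable_lmod y s : 0 < y -> P.-integrable setT (fun w => (lmod y (s + A w))%:E).
Proof.
move=> y0; apply: (integrable_le (g := fun w =>
    `|ln y| + ln (1 + `|s| + y) + ln (1 + A w))).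
- exact: mcomp (@continuous_lmod _ _ y0) mA.
- exact: integrable_cDln1pA.
- move=> w; rewrite ler_norml; apply/andP; split.
  + have h1 := lmod_ge_ln (s + A w) y0.
    have h2 : 0 <= ln (1 + `|s| + y).
      by rewrite ln_ge0// -addrA lerDl addr_ge0// ltW.
    have h3 := ln1pA_ge0 w; have h4 := ler_norm (- ln y); rewrite normrN in h4; lra.
  + have h1 := lmod_le_ln s y0 (A0 w).
    have := normr_ge0 (ln y); lra.
Qed.

Lemma integrable_larg y s : 0 < y -> P.-integrable setT (fun w => (larg y (s + A w))%:E).
Proof.
move=> y0; apply: (@bounded_integrable _ _ _ P (fun w => larg y (s + A w)) pi).
  exact: mcomp (@continuous_larg _ _ y0) mA.
by move=> w; rewrite ger0_norm ?larg_ge0// larg_lepi.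
Qed.

(** [Lmod y s + i Larg y s] is [E log (s + iy + A)]. *)
Definition Lmod y s := \int[P]_w lmod y (s + A w).
Definition Larg y s := \int[P]_w larg y (s + A w).

Let bnd s : s - 1 < s < s + 1. Proof. by apply/andP; split; lra. Qed.

Lemma is_derive_Lmod y s : 0 < y ->
  is_derive s 1 (Lmod y) (\int[P]_w cpow_re 1 y (s + A w)).
Proof.
move=> y0; apply: (@is_derive_expectation _ _ _ P A (lmod y) (cpow_re 1 y) s
  (s - 1) (s + 1) (rpow 1 y)) => //.
- exact/ltW/rpow_gt0.
- by move=> x _; exact: integrable_lmod.
- by move=> x w _; rewrite cpow_re1//; exact: is_derive_lmod.
- by move=> x w _; exact: cpow_bound_re.
Qed.

Lemma is_derive_Larg y s : 0 < y ->
  is_derive s 1 (Larg y) (- (\int[P]_w cpow_im 1 y (s + A w))).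
Proof.
move=> y0.
have -> : - (\int[P]_w cpow_im 1 y (s + A w)) = \int[P]_w (- cpow_im 1 y (s + A w)).
  rewrite -mulN1r -RintegralZl//; last first.
    apply: (@bounded_integrable _ _ _ P (fun w => cpow_im 1 y (s + A w)) (rpow 1 y)).
      exact: mcomp (@continuous_cpow_im _ _ _ y0) mA.
    by move=> w; exact: cpow_bound_im.
  by apply: eq_Rintegral => w _; rewrite mulN1r.
apply: (@is_derive_expectation _ _ _ P A (larg y) (fun c => - cpow_im 1 y c) s
  (s - 1) (s + 1) (rpow 1 y)) => //.
- exact/ltW/rpow_gt0.
- by move=> x _; exact: integrable_larg.
- by move=> x w _; rewrite cpow_im1//; exact: is_derive_larg.
- by move=> x w _; rewrite normrN; exact: cpow_bound_im.
Qed.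

(* [E (s + iy + D) ^ -tau] is [Cre y s - i Cim y s]. *)
Definition Cre y s := \int[P']_w cpow_re tau y (s + D w).
Definition Cim y s := \int[P']_w cpow_im tau y (s + D w).

Let intD (f : R -> R) K s : continuous f -> (forall c, `|f c| <= K) ->
  P'.-integrable setT (fun w => (f (s + D w))%:E).
Proof.
move=> cf fK; apply: (@bounded_integrable _ _ _ P' (fun w => f (s + D w)) K) => //.
exact: mcomp cf mD.
Qed.

Lemma is_derive_Cre y s : 0 < y -> is_derive s 1 (Cre y)
  (- tau * (Cre y s * (\int[P]_w cpow_re 1 y (s + A w)) -
            Cim y s * \int[P]_w cpow_im 1 y (s + A w))).
Proof.
move=> y0; have t10 : 0 <= tau + 1 by rewrite addr_ge0// ltW.
rewrite -cpow_re_bilinear// -RintegralZl//; last first.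
  exact: (intD s (@continuous_cpow_re _ _ _ y0) (fun c => cpow_bound_re c t10 y0)).
apply: (@is_derive_expectation _ _ _ P' D (cpow_re tau y)
  (fun c => - tau * cpow_re (tau + 1) y c) s (s - 1) (s + 1) (tau * rpow (tau + 1) y)) => //.
- by rewrite mulr_ge0 ?(ltW tau0)// ltW// rpow_gt0.
- by move=> x _; exact: (intD x (@continuous_cpow_re _ _ _ y0)
    (fun c => cpow_bound_re c (ltW tau0) y0)).
- by move=> x w _; exact: is_derive_cpow_re.
- move=> x w _; rewrite normrM normrN (ger0_norm (ltW tau0)) ler_wpM2l ?(ltW tau0)//.
  exact: cpow_bound_re.
Qed.

Lemma is_derive_Cim y s : 0 < y -> is_derive s 1 (Cim y)
  (- tau * (Cim y s * (\int[P]_w cpow_re 1 y (s + A w)) +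
            Cre y s * \int[P]_w cpow_im 1 y (s + A w))).
Proof.
move=> y0; have t10 : 0 <= tau + 1 by rewrite addr_ge0// ltW.
rewrite -cpow_im_bilinear// -RintegralZl//; last first.
  exact: (intD s (@continuous_cpow_im _ _ _ y0) (fun c => cpow_bound_im c t10 y0)).
apply: (@is_derive_expectation _ _ _ P' D (cpow_im tau y)
  (fun c => - tau * cpow_im (tau + 1) y c) s (s - 1) (s + 1) (tau * rpow (tau + 1) y)) => //.
- by rewrite mulr_ge0 ?(ltW tau0)// ltW// rpow_gt0.
- by move=> x _; exact: (intD x (@continuous_cpow_im _ _ _ y0)
    (fun c => cpow_bound_im c (ltW tau0) y0)).
- by move=> x w _; exact: is_derive_cpow_im.
- move=> x w _; rewrite normrM normrN (ger0_norm (ltW tau0)) ler_wpM2l ?(ltW tau0)//.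
  exact: cpow_bound_im.
Qed.

(* the quotient of [E (z + D) ^ -tau] by [exp (- tau E log (z + A))], where [z = s + iy] *)
Definition Qre y s :=
  expR (tau * Lmod y s) * (Cre y s * cos (tau * Larg y s) + Cim y s * sin (tau * Larg y s)).
Definition Qim y s :=
  expR (tau * Lmod y s) * (Cre y s * sin (tau * Larg y s) - Cim y s * cos (tau * Larg y s)).

(** On a horizontal line both [E (z + D) ^ -tau] and [exp (- tau E log (z + A))] solve the linear
    equation [F' = - tau F E (z + A) ^ -1], so their quotient has derivative zero. *)
Lemma Q_cst y s s' : 0 < y -> Qre y s = Qre y s' /\ Qim y s = Qim y s'.
Proof.
move=> y0.
have dE (x : R) : is_derive x 1 (fun s => expR (tau * Lmod y s))
    (expR (tau * Lmod y x) * (tau * \int[P]_w cpow_re 1 y (x + A w))).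
  apply: (@is_derive_chain _ expR (fun s => tau * Lmod y s) x (expR (tau * Lmod y x))
    (tau * \int[P]_w cpow_re 1 y (x + A w))) => //.
  exact: is_derive_mulc (is_derive_Lmod x y0) erefl.
have dA (x : R) := is_derive_mulc (m := tau) (is_derive_Larg x y0) erefl.
have dcos (x : R) := @is_derive_chain _ (@cos R) (fun s => tau * Larg y s) x _ _ _
  (is_derive_cos _) (dA x) erefl.
have dsin (x : R) := @is_derive_chain _ (@sin R) (fun s => tau * Larg y s) x _ _ _
  (is_derive_sin _) (dA x) erefl.
split; apply: is_derive_0_is_cst => x.
- apply: (is_derive_mul (dE x) (is_deriveD (is_derive_mul (is_derive_Cre x y0) (dcos x) erefl)
    (is_derive_mul (is_derive_Cim x y0) (dsin x) erefl))).
  by rewrite !fctE; ring.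
- apply: (is_derive_mul (dE x) (is_deriveB (is_derive_mul (is_derive_Cre x y0) (dsin x) erefl)
    (is_derive_mul (is_derive_Cim x y0) (dcos x) erefl))).
  by rewrite !fctE; ring.
Qed.

(* [log |1 + (c + iy) u|], the real part of [log (s + c + iy) - log s] for [u = 1 / s] *)
Definition rmod (y c u : R) : R := ln ((1 + c * u) ^+ 2 + (y * u) ^+ 2) / 2.

Lemma rmod_arg_ge1 y c u : 0 <= c -> 0 <= u -> 1 <= (1 + c * u) ^+ 2 + (y * u) ^+ 2.
Proof.
move=> c0 u0; have cu := mulr_ge0 c0 u0; have := sqr_ge0 (y * u); nra.
Qed.

Lemma lmod_shift y s c : 0 < s -> 0 <= c -> lmod y (s + c) = ln s + rmod y c s^-1.
Proof.
move=> s0 c0; rewrite /lmod /rmod.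
have -> : (s + c) ^+ 2 + y ^+ 2 = s ^+ 2 * ((1 + c * s^-1) ^+ 2 + (y * s^-1) ^+ 2).
  by field; rewrite gt_eqF.
rewrite lnM ?posrE ?exprn_gt0//; last first.
  by rewrite (lt_le_trans ltr01)// rmod_arg_ge1// invr_ge0 ltW.
by rewrite lnXn// mulr2n; field.
Qed.

Lemma rmod_ge0 y c u : 0 <= c -> 0 <= u -> 0 <= rmod y c u.
Proof. by move=> c0 u0; rewrite /rmod divr_ge0// ln_ge0// rmod_arg_ge1. Qed.

Lemma rmod_le y c u : 0 < y -> 0 <= c -> 0 <= u <= 1 -> rmod y c u <= ln (1 + y) + ln (1 + c).
Proof.
move=> y0 c0 /andP[u0 u1]; rewrite /rmod ler_pdivrMr// mulr_natr.
have p1 : 0 < 1 + y by lra.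
have p2 : 0 < 1 + c by lra.
have := rmod_arg_ge1 y c0 u0.
rewrite -lnM// -lnXn ?mulr_gt0// ler_ln ?posrE ?exprn_gt0 ?mulr_gt0//; last first.
  by rewrite (lt_le_trans ltr01)// rmod_arg_ge1.
move=> _; have cu : c * u <= c by rewrite ler_piMr.
have yu : y * u <= y by rewrite ler_piMr// ltW.
have cu0 := mulr_ge0 c0 u0; have yu0 := mulr_ge0 (ltW y0) u0.
have h1 : (1 + c * u) ^+ 2 <= (1 + c) ^+ 2 by rewrite lerXn2r ?nnegrE//; lra.
have h2 : (y * u) ^+ 2 <= y ^+ 2 by rewrite lerXn2r ?nnegrE//; lra.
apply: (le_trans (lerD h1 h2)).
have c20 := sqr_ge0 c; have y20 := sqr_ge0 y; have yc := mulr_ge0 (ltW y0) c0.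
have yc2 := mulr_ge0 (ltW y0) c20; have y2c := mulr_ge0 y20 c0.
have y2c2 := mulr_ge0 y20 c20; nra.
Qed.

Lemma rmod_cvg y c : 0 < y -> 0 <= c -> rmod y c n.+1%:R^-1 @[n --> \oo] --> (0 : R).
Proof.
move=> y0 c0; rewrite /rmod -[X in _ --> X](mul0r 2^-1).
apply: cvgM; last exact: cvg_cst.
rewrite -[X in _ --> X](@ln1 R).
apply: (@cvg_comp _ _ _ (fun n : nat => (1 + c * n.+1%:R^-1) ^+ 2 + (y * n.+1%:R^-1) ^+ 2)
  (@ln R)); last exact: (continuous_ln ltr01).
have h (b : R) : (fun n : nat => b * n.+1%:R^-1) n @[n --> \oo] --> b * 0.
  by apply: cvgM; [exact: cvg_cst|exact: cvg_harmonic].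
have h1 : (fun n : nat => 1 + c * n.+1%:R^-1) n @[n --> \oo] --> 1 + c * 0.
  by apply: cvgD; [exact: cvg_cst|exact: h].
have h2 := cvgD (cvgM h1 h1) (cvgM (h y) (h y)).
have E : (1 + c * 0) * (1 + c * 0) + y * 0 * (y * 0) = 1 by ring.
by rewrite E in h2; exact: h2.
Qed.

Lemma larg_cvg y c : 0 < y -> larg y (n.+1%:R + c) @[n --> \oo] --> (0 : R).
Proof.
move=> y0; rewrite /larg -[X in _ --> X](subrr (pi / 2)).
apply: cvgB; first exact: cvg_cst.
apply: (@cvg_comp _ _ _ (fun n : nat => (n.+1%:R + c) / y) (@atan R)); last exact: cvgy_atan.
apply/cvgryPge => B; near=> n.
rewrite ler_pdivlMr// -lerBlDr.
have : B * y - c <= n%:R by near: n; exact: nbhs_infty_ger.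
by move=> /le_trans; apply; rewrite ler_nat.
Unshelve. all: by end_near. Qed.

Let hn (n : nat) : 0 < n.+1%:R :> R. Proof. by []. Qed.

Let un (n : nat) : 0 <= (n.+1%:R^-1 : R) <= 1.
Proof. by rewrite invr_ge0 ltW//= invf_le1// ler1n. Qed.

Let un0 (n : nat) : 0 <= n.+1%:R^-1 :> R. Proof. by case/andP: (un n). Qed.

Let lrmod y n := \int[P]_w rmod y (A w) n.+1%:R^-1.

Let rmodE y s c : 0 < s -> 0 <= c -> rmod y c s^-1 = lmod y (s + c) - ln s.
Proof. by move=> s0 c0; rewrite lmod_shift// addrAC subrr add0r. Qed.

Let mrmod d0 (T0 : measurableType d0) (S : T0 -> R) y (n : nat) : 0 < y ->
  (forall w, 0 <= S w) -> measurable_fun setT S ->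
  measurable_fun setT (fun w => rmod y (S w) n.+1%:R^-1).
Proof.
move=> y0 S0 mS; have : measurable_fun setT (fun w => lmod y (n.+1%:R + S w) - ln n.+1%:R).
  by apply: measurable_funB => //; exact: mcomp (@continuous_lmod _ _ y0) mS.
by apply: eq_measurable_fun => w _; rewrite rmodE.
Qed.

Let irmod y n : 0 < y -> P.-integrable setT (fun w => (rmod y (A w) n.+1%:R^-1)%:E).
Proof.
move=> y0; apply: (integrable_le (g := fun w => ln (1 + y) + ln (1 + A w))).
- exact: mrmod.
- exact: integrable_cDln1pA.
- by move=> w; rewrite ger0_norm ?rmod_ge0// rmod_le.
Qed.

Let LmodE y n : 0 < y -> Lmod y n.+1%:R = ln n.+1%:R + lrmod y n.
Proof.
move=> y0; rewrite /Lmod /lrmod.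
have -> : ln n.+1%:R = \int[P]_w ln n.+1%:R :> R.
  by rewrite Rintegral_cst// [X in fine X]probability_setT mulr1.
rewrite -RintegralD//; last 2 first.
- by apply: (@bounded_integrable _ _ _ P (fun=> ln n.+1%:R) `|ln n.+1%:R|).
- exact: irmod.
by apply: eq_Rintegral => w _; rewrite lmod_shift.
Qed.

Let lrmod_cvg y : 0 < y -> lrmod y n @[n --> \oo] --> (0 : R).
Proof.
move=> y0; rewrite -[X in _ --> X](mul0r (fine (P setT))) -Rintegral_cst//.
apply: (@Rdominated_cvg _ _ _ P setT (fun n w => rmod y (A w) n.+1%:R^-1) (fun=> 0)
  (fun w => ln (1 + y) + ln (1 + A w))) => //.
- by move=> n; exact: mrmod.
- by apply: aeW => w _; exact: rmod_cvg.
- exact: integrable_cDln1pA.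
- by move=> n w _; rewrite ger0_norm ?rmod_ge0// rmod_le.
Qed.

Let Larg_cvg y : 0 < y -> Larg y n.+1%:R @[n --> \oo] --> (0 : R).
Proof.
move=> y0; rewrite -[X in _ --> X](mul0r (fine (P setT))) -Rintegral_cst//.
apply: (@Rdominated_cvg _ _ _ P setT (fun n w => larg y (n.+1%:R + A w)) (fun=> 0)
  (fun=> pi)) => //.
- by move=> n; exact: mcomp (@continuous_larg _ _ y0) mA.
- by apply: aeW => w _; exact: larg_cvg.
- by apply: (@bounded_integrable _ _ _ P (fun=> pi) `|pi|).
- by move=> n w _; rewrite ger0_norm ?larg_ge0// larg_lepi.
Qed.

Let are y n := \int[P']_w (expR (- tau * rmod y (D w) n.+1%:R^-1) *
  cos (tau * larg y (n.+1%:R + D w))).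
Let aim y n := \int[P']_w (expR (- tau * rmod y (D w) n.+1%:R^-1) *
  sin (tau * larg y (n.+1%:R + D w))).

Let ecvg y (f : R -> R) : 0 < y -> continuous f -> (forall c, `|f c| <= 1) ->
  \int[P']_w (expR (- tau * rmod y (D w) n.+1%:R^-1) * f (tau * larg y (n.+1%:R + D w)))
    @[n --> \oo] --> f 0.
Proof.
move=> y0 cf f1; rewrite -[X in _ --> X]mulr1 -[X in _ * X]/(fine 1%:E) -(probability_setT P')
  -Rintegral_cst//.
apply: (@Rdominated_cvg _ _ _ P' setT (fun n w => expR (- tau * rmod y (D w) n.+1%:R^-1) *
   f (tau * larg y (n.+1%:R + D w))) (fun=> f 0) (fun=> 1)) => //.
- move=> n; apply: measurable_funM.
    apply: measurableT_comp => //; apply: measurable_funM => //; exact: mrmod.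
  apply: (@measurableT_comp _ _ _ _ _ _ f); first exact: continuous_measurable_fun.
  apply: measurable_funM => //; exact: mcomp (@continuous_larg _ _ y0) mD.
- apply: aeW => w _; rewrite -[X in _ --> X]mul1r; apply: cvgM.
    rewrite -[X in _ --> X](@expR0 R) -[X in expR X](mulr0 (- tau)).
    apply: (@cvg_comp _ _ _ _ expR); last exact: continuous_expR.
    by apply: cvgM; [exact: cvg_cst|exact: rmod_cvg].
  rewrite -[X in f X](mulr0 tau).
  apply: (@cvg_comp _ _ _ _ f); last exact: cf.
  by apply: cvgM; [exact: cvg_cst|exact: larg_cvg].
- by apply: (@bounded_integrable _ _ _ P' (fun=> 1) `|1|).
- move=> n w _; rewrite normrM ger0_norm ?expR_ge0// -[leRHS]mulr1 ler_pM ?expR_ge0//.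
  by rewrite -[leRHS]expR0 ler_expR mulNr oppr_le0 mulr_ge0 ?rmod_ge0// ltW.
Qed.

Let CE (f : R -> R) y n : 0 < y -> continuous f -> (forall c, `|f c| <= 1) ->
  \int[P']_w (expR (- tau * lmod y (n.+1%:R + D w)) * f (tau * larg y (n.+1%:R + D w))) =
  expR (- tau * ln n.+1%:R) *
  \int[P']_w (expR (- tau * rmod y (D w) n.+1%:R^-1) * f (tau * larg y (n.+1%:R + D w))).
Proof.
move=> y0 cf f1; rewrite -RintegralZl//; last first.
  apply: (@bounded_integrable _ _ _ P' (fun w => expR (- tau * rmod y (D w) n.+1%:R^-1) *
   f (tau * larg y (n.+1%:R + D w))) 1) => //.
  - apply: measurable_funM.
      apply: measurableT_comp => //; apply: measurable_funM => //; exact: mrmod.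
    apply: (@measurableT_comp _ _ _ _ _ _ f); first exact: continuous_measurable_fun.
    apply: measurable_funM => //; exact: mcomp (@continuous_larg _ _ y0) mD.
  - move=> w; rewrite normrM ger0_norm ?expR_ge0// -[leRHS]mulr1 ler_pM ?expR_ge0//.
    by rewrite -[leRHS]expR0 ler_expR mulNr oppr_le0 mulr_ge0 ?rmod_ge0// ltW.
apply: eq_Rintegral => w _; rewrite mulrA -expRD -mulrDr; congr (expR (_ * _) * _).
by rewrite lmod_shift.
Qed.

(** As [s] grows, [Lmod y s] diverges like [ln s] and [E (z + D) ^ -tau] vanishes like [s ^ -tau].
    Both rates are factored out and cancel in the quotient; what remains converges by domination.
    Taking [s = n.+1] keeps [1 / s] in [[0, 1]], as the dominating bound [rmod_le] requires. *)
Lemma Q_cvg y : 0 < y ->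
  Qre y n.+1%:R @[n --> \oo] --> (1 : R) /\ Qim y n.+1%:R @[n --> \oo] --> (0 : R).
Proof.
move=> y0.
have tl : tau * Larg y n.+1%:R @[n --> \oo] --> tau * 0.
  by apply: cvgM; [exact: cvg_cst|exact: Larg_cvg].
rewrite mulr0 in tl.
have ccos := cvg_comp _ _ tl (@continuous_cos R 0).
have csin := cvg_comp _ _ tl (@continuous_sin R 0).
rewrite cos0 in ccos; rewrite sin0 in csin.
have cE : expR (tau * lrmod y n) @[n --> \oo] --> (1 : R).
  rewrite -[X in _ --> X](@expR0 R) -[X in expR X](mulr0 tau).
  apply: (@cvg_comp _ _ _ _ expR); last exact: continuous_expR.
  by apply: cvgM; [exact: cvg_cst|exact: lrmod_cvg].
have c1 : are y n @[n --> \oo] --> (1 : R).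
  by rewrite -[X in _ --> X]cos0; apply: ecvg => //; [exact: continuous_cos|exact: norm_cos_le1].
have c2 : aim y n @[n --> \oo] --> (0 : R).
  by rewrite -[X in _ --> X]sin0; apply: ecvg => //; [exact: continuous_sin|exact: norm_sin_le1].
have e1 n : Cre y n.+1%:R = expR (- tau * ln n.+1%:R) * are y n.
  by apply: CE => //; [exact: continuous_cos|exact: norm_cos_le1].
have e2 n : Cim y n.+1%:R = expR (- tau * ln n.+1%:R) * aim y n.
  by apply: CE => //; [exact: continuous_sin|exact: norm_sin_le1].
have eE n : expR (tau * Lmod y n.+1%:R) * expR (- tau * ln n.+1%:R) = expR (tau * lrmod y n).
  by rewrite -expRD LmodE//; congr expR; ring.
split.
- have -> : (fun n : nat => Qre y n.+1%:R) = (fun n => expR (tau * lrmod y n) *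
     (are y n * cos (tau * Larg y n.+1%:R) + aim y n * sin (tau * Larg y n.+1%:R))).
    by apply/funext => n; rewrite /Qre e1 e2 -eE; ring.
  have h := cvgM cE (cvgD (cvgM c1 ccos) (cvgM c2 csin)).
  have E : 1 * (1 * 1 + 0 * 0) = 1 :> R by ring.
  by rewrite E in h; exact: h.
- have -> : (fun n : nat => Qim y n.+1%:R) = (fun n => expR (tau * lrmod y n) *
     (are y n * sin (tau * Larg y n.+1%:R) - aim y n * cos (tau * Larg y n.+1%:R))).
    by apply/funext => n; rewrite /Qim e1 e2 -eE; ring.
  have h := cvgM cE (cvgB (cvgM c1 csin) (cvgM c2 ccos)).
  have E : 1 * (1 * 0 - 0 * 1) = 0 :> R by ring.
  by rewrite E in h; exact: h.
Qed.

Theorem cpow_expectation y s : 0 < y ->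
  Cre y s = expR (- tau * Lmod y s) * cos (tau * Larg y s) /\
  Cim y s = expR (- tau * Lmod y s) * sin (tau * Larg y s).
Proof.
move=> y0; have [q1 q2] := Q_cvg y0.
have Q1 : Qre y s = 1.
  have h : (fun n : nat => Qre y n.+1%:R) = (fun=> Qre y s).
    by apply/funext => n; have [->] := Q_cst n.+1%:R s y0.
  rewrite h in q1; exact: (cvg_unique (@norm_hausdorff R R^o) (cvg_cst _) q1).
have Q2 : Qim y s = 0.
  have h : (fun n : nat => Qim y n.+1%:R) = (fun=> Qim y s).
    by apply/funext => n; have [_ ->] := Q_cst n.+1%:R s y0.
  rewrite h in q2; exact: (cvg_unique (@norm_hausdorff R R^o) (cvg_cst _) q2).
have E0 := expR_gt0 (tau * Lmod y s).
have cs := cos2Dsin2 (tau * Larg y s).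
have -> : expR (- tau * Lmod y s) = (expR (tau * Lmod y s))^-1 by rewrite mulNr expRN.
move: Q1 Q2; rewrite /Qre /Qim.
move: (expR _) (cos _) (sin _) (Cre y s) (Cim y s) E0 cs => e c si a b e0 cs Q1 Q2.
have Q2' : a * si - b * c = 0.
  by move/eqP: Q2; rewrite mulf_eq0 (gt_eqF e0) => /eqP.
(* [Qre = 1] and [Qim = 0] say that a rotation of [(Cre, Cim)] is known; it is inverted by means of
   [cos^2 + sin^2 = 1]. *)
split.
- rewrite -[LHS]mulr1 -cs.
  have -> : a * (c ^+ 2 + si ^+ 2) = c * (a * c + b * si) + si * (a * si - b * c) by ring.
  by rewrite Q2' mulr0 addr0 -[e^-1]mulr1 -Q1; field; rewrite gt_eqF.
- rewrite -[LHS]mulr1 -cs.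
  have -> : b * (c ^+ 2 + si ^+ 2) = si * (a * c + b * si) - c * (a * si - b * c) by ring.
  by rewrite Q2' mulr0 subr0 -[e^-1]mulr1 -Q1; field; rewrite gt_eqF.
Qed.

End continuation.

(** * Boundary values on the negative half-line *)

Section boundary_kernels.
Context {R : realType}.
Notation mu := (@lebesgue_measure R).
Implicit Types (t y r b N : R).

Definition eps_ (n : nat) : R := n.+1%:R^-1.

Lemma eps_gt0 n : 0 < eps_ n. Proof. by rewrite /eps_ invr_gt0. Qed.

Lemma eps_le1 n : eps_ n <= 1.
Proof. by rewrite /eps_ invf_le1// ler1n. Qed.

Lemma eps_cvg0 : eps_ n @[n --> \oo] --> (0 : R).
Proof. exact: cvg_harmonic. Qed.

Lemma ler_eps n m : (n <= m)%N -> eps_ m <= eps_ n.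
Proof. by move=> nm; rewrite /eps_ lef_pV2 ?posrE// ler_nat. Qed.

Lemma lmodN y r : lmod y (- r) = lmod y r.
Proof. by rewrite /lmod sqrrN. Qed.

Lemma ler_lmod y y' r : 0 < y -> y <= y' -> lmod y r <= lmod y' r.
Proof.
move=> y0 yy'; have y'0 := lt_le_trans y0 yy'.
rewrite /lmod ler_pM2r ?invr_gt0// ler_ln ?posrE ?sqrD_gt0//.
by rewrite lerD2l lerXn2r// nnegrE ltW.
Qed.

Lemma ln_norm_sqr r : r != 0 -> ln (r ^+ 2) = ln `|r| *+ 2.
Proof. by move=> r0; rewrite -lnXn ?normr_gt0// real_normK ?num_real. Qed.

Lemma lmod_ge_ln_norm y r : 0 < y -> r != 0 -> ln `|r| <= lmod y r.
Proof.
move=> y0 r0; rewrite /lmod ler_pdivlMr// mulr_natr -ln_norm_sqr//.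
have r20 : 0 < r ^+ 2 by rewrite lt0r sqrf_eq0 r0 sqr_ge0.
by rewrite ler_ln ?posrE ?sqrD_gt0// lerDl sqr_ge0.
Qed.

Lemma lmod_eps_cvg r : r != 0 -> lmod (eps_ n) r @[n --> \oo] --> ln `|r|.
Proof.
move=> r0; rewrite /lmod.
have -> : ln `|r| = ln (r ^+ 2) / 2 by rewrite ln_norm_sqr// mulr2n; field.
apply: cvgM; last exact: cvg_cst.
have r20 : 0 < r ^+ 2 by rewrite lt0r sqrf_eq0 r0 sqr_ge0.
apply: (@cvg_comp _ _ _ (fun n : nat => r ^+ 2 + eps_ n ^+ 2) (@ln R)).
  have h := cvgD (@cvg_cst _ (r ^+ 2) _ \oo _) (cvgM eps_cvg0 eps_cvg0).
  by rewrite mulr0 addr0 in h; exact: h.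
exact: continuous_ln.
Qed.

Lemma larg_eps_cvg_gt0 r : 0 < r -> larg (eps_ n) r @[n --> \oo] --> (0 : R).
Proof.
move=> r0; rewrite /larg -[X in _ --> X](subrr (pi / 2)).
apply: cvgB; first exact: cvg_cst.
apply: (@cvg_comp _ _ _ (fun n : nat => r / eps_ n) (@atan R)); last exact: cvgy_atan.
apply/cvgryPge => B; near=> n.
rewrite /eps_ invrK mulrC -ler_pdivrMr//.
have : B / r <= n%:R by near: n; exact: nbhs_infty_ger.
by move=> /le_trans; apply; rewrite ler_nat.
Unshelve. all: by end_near. Qed.

Lemma largN y r : larg y (- r) = pi - larg y r.
Proof. by rewrite /larg mulNr atanN; set a := atan _; field. Qed.

Lemma larg_eps_cvg_lt0 r : r < 0 -> larg (eps_ n) r @[n --> \oo] --> (pi : R).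
Proof.
move=> r0; rewrite -[r]opprK -[X in _ --> X]subr0; under eq_fun do rewrite largN.
by apply: cvgB; [exact: cvg_cst|apply: larg_eps_cvg_gt0; rewrite oppr_gt0].
Qed.

Lemma expMlmod_le_rpow t y r : 0 <= t -> 0 < y -> r != 0 ->
  expR (- t * lmod y r) <= rpow t `|r|.
Proof.
move=> t0 y0 r0; rewrite /rpow ler_expR !mulNr lerN2 ler_wpM2l//.
exact: lmod_ge_ln_norm.
Qed.

Lemma expMlmod_le1 t y r : 0 <= t -> 0 < y -> 1 <= `|r| -> expR (- t * lmod y r) <= 1.
Proof.
move=> t0 y0 r1; apply: le_trans (rpow_le1 t0 r1).
by apply: expMlmod_le_rpow => //; rewrite -normr_gt0 (lt_le_trans ltr01).
Qed.

(* Its derivative dominates [1 - t] times the kernel, uniformly in [y]. *)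
Let Phi t y r := r * expR (- t * lmod y r).

Let is_derive_Phi t y r : 0 < y ->
  is_derive r 1 (Phi t y) (expR (- t * lmod y r) * (1 - t * (r ^+ 2 / (r ^+ 2 + y ^+ 2)))).
Proof.
move=> y0; apply: (is_derive_mul (is_derive_id r 1) (is_derive_expMlmod t r y0)).
by rewrite expr2; ring.
Qed.

Let norm_Phi_le t y r : 0 <= t <= 1 -> 0 < y -> `|Phi t y r| <= 1 + `|r|.
Proof.
move=> /andP[t0 t1] y0; rewrite /Phi normrM (ger0_norm (expR_ge0 _)).
have [->|r0] := eqVneq r 0; first by rewrite normr0 mul0r addr0 ler01.
have p0 : 0 < `|r| by rewrite normr_gt0.
have [r1|r1] := leP 1 `|r|.
  rewrite (le_trans (y := `|r|))//; last by rewrite lerDr.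
  by rewrite ler_piMr// expMlmod_le1.
rewrite (le_trans (y := 1))//; last by rewrite lerDl.
apply: (le_trans (ler_wpM2l (normr_ge0 r) (expMlmod_le_rpow t0 y0 r0))).
rewrite /rpow -{1}(lnK p0) -expRD -[leRHS]expR0 ler_expR.
have : ln `|r| <= 0 by rewrite ln_le0// ltW.
by move: (ln _) => l l0; nra.
Qed.

(** The bound depends neither on [y] nor on [b]. It therefore survives integration over the law of
    [B] and the limit [y -> 0], which is all that is known to be uniform near the singularity
    [|b - x| ^ -t]. *)
Lemma integral_expMlmod_le t y b N : 0 <= t < 1 -> 0 < y -> 0 < N ->
  (\int[mu]_(x in `[(- N)%R, N]) (expR (- t * lmod y (b - x)))%:E <=
   (2 * N + (4 * N + 4) / (1 - t))%:E)%E.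
Proof.
move=> /andP[t0 t1] y0 N0.
have NN : - N < N by lra.
have cint (f : R -> R) : continuous f -> {within `[(- N), N], continuous f}.
  by move=> cf; apply: continuous_subspaceT.
have ck : continuous (fun x => expR (- t * lmod y (b - x))).
  move=> x; apply: (@continuous_comp _ _ _ (fun x => - t * lmod y (b - x)) expR);
    last exact: continuous_expR.
  apply: cvgM; first exact: cvg_cst.
  apply: (@continuous_comp _ _ _ (fun x => b - x) (lmod y)); last exact: continuous_lmod.
  by apply: cvgB; [exact: cvg_cst|exact: cvg_id].
have p1 : 0 <= (4 * N + 4) / (1 - t) by rewrite divr_ge0//; lra.
have mk : measurable_fun (`[(- N)%R, N] : set R) (fun x => (expR (- t * lmod y (b - x)))%:E).
  by apply/measurable_EFinP/measurable_funTS; exact: continuous_measurable_fun.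
(* For such [b] the distance [|b - x|] is at least [1] and the kernel at most [1]. Otherwise
   [|b| < N + 1], and each of the two boundary values of [Phi] is at most [2 N + 2] in absolute
   value. *)
have [bN|bN] := leP (N + 1) `|b|.
  apply: (le_trans (y := \int[mu]_(x in `[(- N)%R, N]) 1%:E)%E).
    apply: ge0_le_integral => //=.
      move=> x; rewrite in_itv/= -ler_norml => xN; rewrite lee_fin expMlmod_le1//.
      have := lerB_dist b x; lra.
  rewrite integral_cst//= lebesgue_measure_itv/= lte_fin NN -EFinB mul1e lee_fin.
  lra.
pose F x := - Phi t y (b - x) / (1 - t).
pose f x := expR (- t * lmod y (b - x)) * (1 - t * ((b - x) ^+ 2 / ((b - x) ^+ 2 + y ^+ 2)))
  / (1 - t).
have dF (x : R) : is_derive x 1 F (f x).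
  have h1 : is_derive x 1 (fun x => b - x) (-1).
    by have := is_deriveB (is_derive_cst b x 1) (is_derive_id x 1); rewrite sub0r.
  have h2 := @is_derive_chain _ (Phi t y) (fun x => b - x) x _ _ _ (is_derive_Phi t (b - x) y0) h1 erefl.
  have h3 := is_derive_mulc (m := - (1 - t)^-1) h2 erefl.
  rewrite (_ : F = fun z => - (1 - t)^-1 * Phi t y (b - z)); last first.
    by apply/funext => z; rewrite /F; ring.
  by apply: (is_derive_eq h3); rewrite /f; ring.
have cf : continuous f.
  move=> x; apply: cvgM; last exact: cvg_cst.
  apply: cvgM; first exact: ck.
  apply: cvgB; first exact: cvg_cst.
  apply: cvgM; first exact: cvg_cst.
  have c2 : (fun x => (b - x) ^+ 2) z @[z --> x] --> (b - x) ^+ 2.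
    have c1 : (fun x => b - x) z @[z --> x] --> b - x.
      by apply: cvgB; [exact: cvg_cst|exact: cvg_id].
    exact: (cvgM c1 c1).
  apply: cvgM => //; apply: cvgV; first by rewrite gt_eqF// sqrD_gt0.
  by apply: cvgD => //; exact: cvg_cst.
apply: (le_trans (y := \int[mu]_(x in `[(- N)%R, N]) (f x)%:E)%E).
  apply: ge0_le_integral => //=.
  - by apply/measurable_EFinP/measurable_funTS; exact: continuous_measurable_fun.
  - move=> x _; rewrite lee_fin /f -mulrA ler_peMr ?expR_ge0//.
    rewrite ler_pdivlMr ?subr_gt0// mul1r lerD2l lerN2 ler_piMr//.
    by rewrite ler_pdivrMr ?sqrD_gt0// mul1r lerDl sqr_ge0.
rewrite (@continuous_FTC2 _ f F)//; last 3 first.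
- exact: cint.
- split.
  + by move=> x _; have [] := dF x.
  + by apply: cvg_at_right_filter; exact: is_derive_continuous (dF _).
  + by apply: cvg_at_left_filter; exact: is_derive_continuous (dF _).
- by move=> x _; rewrite derive1E; have [] := dF x.
rewrite -EFinB lee_fin /F -mulrBl.
apply: (le_trans (y := (4 * N + 4) / (1 - t))); last lra.
rewrite ler_pM2r ?invr_gt0 ?subr_gt0//.
have t01 : 0 <= t <= 1 by rewrite t0 ltW.
have h1 := norm_Phi_le (b - N) t01 y0.
have h2 := norm_Phi_le (b - - N) t01 y0.
have := ler_norm (- Phi t y (b - N)); have := ler_norm (Phi t y (b - - N)).
have := ler_normB b N; have := ler_normB b (- N); rewrite normrN normrN (gtr0_norm N0).
lra.
Qed.

End boundary_kernels.

Section tonelli_set.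
Context d1 (T1 : measurableType d1) d2 (T2 : measurableType d2) (R : realType).
Variables (m1 : {sigma_finite_measure set T1 -> \bar R}).
Variables (m2 : {sigma_finite_measure set T2 -> \bar R}) (D : set T1) (f : T1 * T2 -> \bar R).
Hypotheses (mD : measurable D) (mf : measurable_fun setT f) (f0 : forall z, (0 <= f z)%E).

Let g := f \_ (D `*` setT).

Let gE x w : g (x, w) = ((fun x => f (x, w)) \_ D) x.
Proof.
rewrite /g !patchE; congr (if _ then _ else _).
by apply/idP/idP; rewrite !inE/= => // -[].
Qed.

Let mg : measurable_fun setT g.
Proof.
apply/(measurable_restrictT _ _).1; first exact: measurableX.
exact: measurable_funTS.
Qed.

Let g0 z : (0 <= g z)%E.
Proof. by case: z => x w; rewrite gE patchE; case: ifP. Qed.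

Lemma measurable_tonelli_set : measurable_fun setT (fun w => \int[m1]_(x in D) f (x, w))%E.
Proof.
have := measurable_fun_fubini_tonelli_G (m1 := m1) g mg g0.
apply: eq_measurable_fun => w _; rewrite /fubini_G [RHS]integral_mkcond.
by apply: eq_integral => x _; exact: gE.
Qed.

Lemma tonelli_set :
  (\int[m1]_(x in D) \int[m2]_w f (x, w) = \int[m2]_w \int[m1]_(x in D) f (x, w))%E.
Proof.
rewrite integral_mkcond.
transitivity (\int[m1]_x \int[m2]_w g (x, w))%E.
  apply: eq_integral => x _; rewrite patchE; case: ifPn => xD.
    by apply: eq_integral => w _; rewrite gE patchE xD.
  by under eq_integral do rewrite gE patchE (negbTE xD); rewrite integral0.
rewrite (fubini_tonelli g mg g0).
by apply: eq_integral => w _; rewrite [RHS]integral_mkcond; apply: eq_integral => x _; exact: gE.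
Qed.

End tonelli_set.

Section almost_everywhere.
Context {R : realType}.
Notation mu := (@lebesgue_measure R).

Lemma ae_imply (p q : R -> Prop) : (forall x, p x -> q x) ->
  {ae mu, forall x, p x} -> {ae mu, forall x, q x}.
Proof.
move=> pq hp; apply: (@filterS _ _ (ae_filter_ringOfSetsType mu) _ _ _ hp).
exact: pq.
Qed.

Lemma ae_imply2 (p q r : R -> Prop) : (forall x, p x -> q x -> r x) ->
  {ae mu, forall x, p x} -> {ae mu, forall x, q x} -> {ae mu, forall x, r x}.
Proof.
move=> pqr hp hq; apply: (@filterS2 _ _ (ae_filter_ringOfSetsType mu) _ _ _ _ hp hq).
exact: pqr.
Qed.

End almost_everywhere.

Lemma abse_fine_le {R : realType} (x : \bar R) : (`|(fine x)%:E| <= `|x|)%E.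
Proof. by case: x => [r| |] /=; rewrite ?normr0 ?leey. Qed.

(** * Points where boundary values exist *)

Section regular_points.
Context {R : realType} d (T : measurableType d) (P : probability T R) (B : T -> R).
Hypothesis mB : measurable_fun setT B.
Notation mu := (@lebesgue_measure R).
Variable t : R.
Hypothesis t01 : 0 < t < 1.

(** The absence of an atom is a separate condition because [ln 0 = 0] makes [rpow t 0] equal to [1]:
    integrability alone would not detect the event [B = x]. *)
Definition regular_pt (x : R) : Prop :=
  P [set w | B w = x] = 0%E /\ P.-integrable setT (fun w => (rpow t `|B w - x|)%:E).

Let k n (z : R * T) : \bar R := (expR (- t * lmod (eps_ n) (B z.2 - z.1)))%:E.

Let mk n : measurable_fun setT (k n).
Proof.
apply/measurable_EFinP; apply: measurableT_comp => //.
apply: measurable_funM => //; apply: (@measurableT_comp _ _ _ _ _ _ (lmod (eps_ n))).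
  by apply: continuous_measurable_fun; apply: continuous_lmod; exact: eps_gt0.
apply: measurable_funB => //.
exact: (measurableT_comp mB).
Qed.

Let k0 n z : (0 <= k n z)%E. Proof. by rewrite lee_fin expR_ge0. Qed.

Let knd z n m : (n <= m)%N -> (k n z <= k m z)%E.
Proof.
move=> nm; rewrite lee_fin ler_expR !mulNr lerN2.
case/andP: t01 => t0 _; rewrite ler_wpM2l ?(ltW t0)//.
by apply: ler_lmod; [exact: eps_gt0|exact: ler_eps].
Qed.

Let U n x := (\int[P]_w k n (x, w))%E.

Let mkx n x : measurable_fun setT (fun w => k n (x, w)).
Proof. exact: measurableT_comp (mk n) _. Qed.

Let mU n : measurable_fun setT (U n).
Proof. exact: (measurable_fun_fubini_tonelli_F (m2 := P) (k n)). Qed.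

Let U0 n x : (0 <= U n x)%E. Proof. exact: integral_ge0. Qed.

Let Und x n m : (n <= m)%N -> (U n x <= U m x)%E.
Proof. by move=> nm; apply: ge0_le_integral => // w _; exact: knd. Qed.

Let intU N n : 0 < N ->
  (\int[mu]_(x in `[(- N)%R, N]) U n x <= (2 * N + (4 * N + 4) / (1 - t))%:E)%E.
Proof.
move=> N0; rewrite (@tonelli_set _ _ _ _ _ mu P _ (k n) _ (mk n) (k0 n))//.
have -> : ((2 * N + (4 * N + 4) / (1 - t))%:E =
    \int[P]_w (2 * N + (4 * N + 4) / (1 - t))%:E)%E.
  by rewrite integral_cst// [X in (_ * X)%E]probability_setT mule1.
apply: ge0_le_integral => //.
- by move=> w _; apply: integral_ge0.
- exact: (measurable_tonelli_set mu _ (mk n) (k0 n)).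
- move=> w _; have t01' : 0 <= t < 1 by case/andP: t01 => t0 ->; rewrite ltW.
  exact: (@integral_expMlmod_le _ t (eps_ n) (B w) N t01' (eps_gt0 n) N0).
Qed.

Let integrable_limU N : 0 < N -> mu.-integrable `[(- N)%R, N] (fun x => limn (U ^~ x)).
Proof.
move=> N0.
have mlim : measurable_fun setT (fun x => limn (U ^~ x)).
  apply: (emeasurable_fun_cvg U) => //= x _.
  by apply: ereal_nondecreasing_is_cvgn => n m; exact: Und.
have lim0 x : (0 <= limn (U ^~ x))%E.
  apply: lime_ge; last exact: nearW.
  by apply: ereal_nondecreasing_is_cvgn => n m; exact: Und.
apply/integrableP; split; first exact: measurable_funTS.
  have mUN n : measurable_fun (`[(- N)%R, N] : set R) (U n).
    apply: measurable_funTS; exact: mU.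
  under eq_integral do rewrite gee0_abs//.
  rewrite monotone_convergence//.
  - apply: (@le_lt_trans _ _ (2 * N + (4 * N + 4) / (1 - t))%:E); last exact: ltry.
    apply: lime_le; last by apply: nearW => n; exact: intU.
    apply: ereal_nondecreasing_is_cvgn => n m nm.
    by apply: (ge0_le_integral mu _ _ (mUN n) (mUN m)) => [//|//|x _]; exact: Und.
  - by move=> x _ n m; exact: Und.
Qed.

Let ae_itv N : 0 < N ->
  {ae mu, forall x, `[(- N)%R, N]%classic x -> (limn (U ^~ x) < +oo)%E}.
Proof.
move=> N0; have i := integrable_limU N0.
apply: filterS (integrable_ae _ i) => //= x fx xN.
by rewrite ltey_eq fx.
Qed.

Let limU x : limn (U ^~ x) = (\int[P]_w limn (fun n => k n (x, w)))%E.
Proof. by rewrite -monotone_convergence// => w _ n m; exact: knd. Qed.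

Let lim_k0 x w : B w = x -> limn (fun n => k n (x, w)) = +oo%E.
Proof.
move=> Bx; apply/cvg_lim => //; apply/cvgeryP.
case/andP: t01 => t0 t1.
apply/cvgryPge => C; near=> n.
rewrite /= Bx subrr /lmod expr0n/= add0r lnXn ?eps_gt0//.
have -> : - t * (ln (eps_ n) *+ 2 / 2) = t * ln (n.+1%:R : R).
  by rewrite /eps_ lnV ?posrE// mulr2n; field.
apply: (le_trans _ (expR_ge1Dx _)).
have h : expR (C / t) <= n%:R by near: n; exact: nbhs_infty_ger.
have h1 : C / t <= ln (n.+1%:R : R).
  rewrite -[leLHS]expRK ler_ln ?posrE ?expR_gt0//.
  by rewrite (le_trans h)// ler_nat.
rewrite ler_pdivrMr// mulrC in h1.
by rewrite (le_trans h1)// lerDr.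
Unshelve. all: by end_near. Qed.

Let lim_k x w : B w != x -> limn (fun n => k n (x, w)) = (rpow t `|B w - x|)%:E.
Proof.
move=> Bx; apply/cvg_lim => //; apply: cvg_EFin; first exact: nearW.
apply: (@cvg_comp _ _ _ (fun n => - t * lmod (eps_ n) (B w - x)) expR);
  last exact: continuous_expR.
by apply: cvgM; [exact: cvg_cst|apply: lmod_eps_cvg; rewrite subr_eq0].
Qed.

Let regular_lim x : (limn (U ^~ x) < +oo)%E -> regular_pt x.
Proof.
rewrite limU => fin.
have mlim : measurable_fun setT (fun w => limn (fun n => k n (x, w))).
  apply: (emeasurable_fun_cvg (fun n w => k n (x, w))) => //= w _.
  by apply: ereal_nondecreasing_is_cvgn => n m; exact: knd.
have lim0 w : (0 <= limn (fun n => k n (x, w)))%E.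
  have [/eqP Bx|Bx] := boolP (B w == x); first by rewrite lim_k0.
  by rewrite lim_k// lee_fin ltW// rpow_gt0.
have i : P.-integrable setT (fun w => limn (fun n => k n (x, w))).
  by apply/integrableP; split => //; under eq_integral do rewrite gee0_abs//.
have mrp : measurable_fun setT (fun w => rpow t `|B w - x|).
  rewrite /rpow; apply: measurableT_comp => //; apply: measurable_funM => //.
  apply: measurableT_comp => //; apply: measurableT_comp => //; exact: measurable_funB.
split.
(* An integrable function is finite almost surely, whereas the limit kernel is [+oo] on the event
   [B = x]. *)
- apply/eqP; rewrite -measure_le0.
  have [N [mN N0 hN]] := integrable_ae measurableT i.
  rewrite -N0; apply: le_measure; rewrite ?inE//.
    by have := mB measurableT (measurable_set1 x); rewrite setTI.
  by move=> w /= Bx; apply: hN => /(_ I); rewrite lim_k0.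
- apply: (le_integrable _ _ _ i) => //; first exact/measurable_EFinP.
  move=> w _; rewrite [leRHS]gee0_abs//.
  have [/eqP Bx|Bx] := boolP (B w == x); first by rewrite lim_k0// leey.
  by rewrite lim_k// gee0_abs// lee_fin ltW// rpow_gt0.
Qed.

(** The kernels [|B - x + i eps_ n| ^ -t] increase with [n]. By Tonelli and monotone convergence
    their limit has a finite expectation for almost every [x] of each bounded interval. Since that
    limit is [+oo] where [B = x], finiteness gives both conditions at once. *)
Lemma ae_regular_pt : {ae mu, forall x, regular_pt x}.
Proof.
have h : {ae mu, forall x, forall n : nat,
    `[(- n.+1%:R)%R, n.+1%:R]%classic x -> (limn (U ^~ x) < +oo)%E}.
  by apply: ae_foralln => n; exact: ae_itv.
apply: ae_imply h => x hx; apply: regular_lim.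
apply: (hx (Num.truncn `|x|)).
by rewrite /= in_itv/= -ler_norml ltW// truncnS_gt.
Qed.

(** The monotone limit of the expectations is itself the dominating function. It supplies the
    domination in the Stieltjes inversion for [D_1]. *)
Lemma expMlmod_dominated N : 0 < N -> exists H : R -> R,
  mu.-integrable `[(- N)%R, N] (EFin \o H) /\
  {ae mu, forall x, `[(- N)%R, N]%classic x ->
    forall n, \int[P]_w expR (- t * lmod (eps_ n) (B w - x)) <= H x}.
Proof.
move=> N0; exists (fun x => fine (limn (U ^~ x))); have i := integrable_limU N0.
have cvU x : cvgn (U ^~ x).
  by apply: ereal_nondecreasing_is_cvgn => n m; exact: Und.
have lim0 x : (0 <= limn (U ^~ x))%E by apply: lime_ge => //; exact: nearW.
split.
- apply: (@le_integrable _ _ _ mu _ (measurable_itv _) _ _ _ _ i) => [|x _].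
    apply/measurable_EFinP; apply: measurableT_comp => //.
    apply/measurable_funTS; apply: (emeasurable_fun_cvg U) => //= x _; exact: cvU.
  exact: abse_fine_le.
- apply: ae_imply (ae_itv N0) => x hx xN n.
  have lx := hx xN.
  have fx : limn (U ^~ x) \is a fin_num by rewrite ge0_fin_numE.
  have h : (U n x <= limn (U ^~ x))%E.
    by apply: lime_ge; [exact: cvU|exists n => // m /= nm; exact: Und].
  have fn : U n x \is a fin_num by rewrite ge0_fin_numE// (le_lt_trans h).
  exact: (fine_le fn fx h).
Qed.

End regular_points.

Section boundary_limits.
Context {R : realType} d (T : measurableType d) (P : probability T R).

Lemma ae_neq (A : T -> R) (x : R) : measurable_fun setT A -> P [set w | A w = x] = 0%E ->
  {ae P, forall w, A w != x}.
Proof.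
move=> mA Ax0; exists [set w | A w = x]; split => //.
  by have := mA measurableT _ (measurable_set1 x); rewrite setTI.
by move=> w /= /negP; rewrite negbK => /eqP.
Qed.

Variables (A : T -> R) (t : R).
Hypotheses (mA : measurable_fun setT A) (A0 : forall w, 0 <= A w).
Hypothesis t01 : 0 < t < 1.

Let t0 : 0 < t. Proof. by case/andP: t01. Qed.

Let mcompA (f : R -> R) x : continuous f -> measurable_fun setT (fun w => f (- x + A w)).
Proof.
move=> cf; apply: (@measurableT_comp _ _ _ _ _ _ f).
  exact: continuous_measurable_fun.
exact: measurable_funD.
Qed.

Lemma measurable_ln_dist x : measurable_fun setT (fun w => ln `|A w - x|).
Proof.
by apply: measurableT_comp => //; apply: measurableT_comp => //; exact: measurable_funB.
Qed.

(** From [1 + u <= exp u] with [u = - t ln |r|]. The logarithmic singularity is thereby controlled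
    by the power that [regular_pt] makes integrable. *)
Lemma ln_norm_ge (r : R) : r != 0 -> - (t^-1 * rpow t `|r|) <= ln `|r|.
Proof.
move=> r0; have p0 : 0 < `|r| by rewrite normr_gt0.
rewrite lerNl ler_pdivlMl// mulrN -mulNr /rpow.
by apply: (le_trans _ (expR_ge1Dx _)); rewrite lerDr.
Qed.

Hypothesis iA : P.-integrable setT (fun w => (ln (1 + A w))%:E).

Let bound x w := (ln (1 + `|- x| + 1) + ln (1 + A w)) + t^-1 * rpow t `|A w - x|.

Let ibound x : regular_pt P A t x -> P.-integrable setT (EFin \o bound x).
Proof.
move=> [_ ir]; rewrite /bound.
have i1 := integrable_cDln1pA iA (ln (1 + `|- x| + 1)).
have i2 := integrableZl measurableT t^-1 ir.
exact: (integrableD measurableT i1 i2).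
Qed.

Let bound_ok x y w : 0 < y <= 1 -> A w != x -> `|lmod y (- x + A w)| <= bound x w.
Proof.
move=> /andP[y0 y1] Ax; have rx : A w - x != 0 by rewrite subr_eq0.
have h1 := ln1pA_ge0 A0 w.
have h2 : 0 <= ln (1 + `|- x| + 1) by rewrite ln_ge0// -addrA lerDl addr_ge0.
have h3 : 0 <= t^-1 * rpow t `|A w - x|.
  by rewrite mulr_ge0 ?invr_ge0 ?(ltW t0)// ltW// rpow_gt0.
rewrite ler_norml /bound; apply/andP; split.
- rewrite (addrC (- x) (A w)); have := lmod_ge_ln_norm y0 rx; have := ln_norm_ge rx; lra.
- have := lmod_le_ln (- x) y0 (A0 w).
  have : ln (1 + `|- x| + y) <= ln (1 + `|- x| + 1).
    have n0 := normr_ge0 (- x).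
    by rewrite ler_ln ?posrE; lra.
  lra.
Qed.

Lemma integrable_ln_dist x : regular_pt P A t x ->
  P.-integrable setT (fun w => (ln `|A w - x|)%:E).
Proof.
move=> rx; have [Ax0 ir] := rx.
apply: (integrable_le (g := fun w => bound x w)).
- exact: measurable_ln_dist.
- exact: ibound.
move=> w; have [/eqP Ax|Ax] := boolP (A w == x).
  (* Here [ln 0 = 0], so nonnegativity of the bound suffices. *)
  rewrite Ax subrr normr0 ln0// normr0.
  have h1 := ln1pA_ge0 A0 w.
  have h2 : 0 <= ln (1 + `|- x| + 1) by rewrite ln_ge0// -addrA lerDl addr_ge0.
  have h3 : 0 <= t^-1 * rpow t `|A w - x|.
    by rewrite mulr_ge0 ?invr_ge0 ?(ltW t0)// ltW// rpow_gt0.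
  by rewrite /bound !addr_ge0.
have rx0 : A w - x != 0 by rewrite subr_eq0.
have h : lmod (eps_ n) (- x + A w) @[n --> \oo] --> ln `|A w - x|.
  by rewrite (addrC (- x)); exact: lmod_eps_cvg.
have h' : `|lmod (eps_ n) (- x + A w)| @[n --> \oo] --> `|ln `|A w - x| |.
  by apply: cvg_norm.
rewrite -(cvg_lim (@Rhausdorff R) h'); apply: limr_le.
  by apply/cvg_ex; eexists; exact: h'.
apply: nearW => n; apply: bound_ok => //.
by rewrite eps_gt0 eps_le1.
Qed.

Lemma Lmod_eps_cvg x : regular_pt P A t x ->
  Lmod P A (eps_ n) (- x) @[n --> \oo] --> \int[P]_w ln `|A w - x|.
Proof.
move=> rx; have [Ax0 _] := rx.
have aex := ae_neq mA Ax0.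
apply: (@ae_Rdominated_cvg _ _ _ P setT (fun n w => lmod (eps_ n) (- x + A w))
  (fun w => ln `|A w - x|) (bound x)) => //.
- by move=> n; apply: mcompA; apply: continuous_lmod; exact: eps_gt0.
- exact: measurable_ln_dist.
- apply: filterS aex => w Ax _.
  by rewrite (addrC (- x)); apply: lmod_eps_cvg; rewrite subr_eq0.
- exact: ibound.
- apply: filterS aex => w Ax n _; apply: bound_ok => //.
  by rewrite eps_gt0 eps_le1.
Qed.

Lemma Larg_eps_cvg x : P [set w | A w = x] = 0%E ->
  Larg P A (eps_ n) (- x) @[n --> \oo] --> pi * fine (P [set w | A w < x]).
Proof.
move=> Ax0; have aex := ae_neq mA Ax0.
have mAx : measurable [set w | A w < x].
  have -> : [set w | A w < x] = A @^-1` `]-oo, x[.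
    by apply/seteqP; split => w /=; rewrite in_itv.
  by have := mA measurableT (measurable_itv `]-oo, x[); rewrite setTI.
have -> : pi * fine (P [set w | A w < x]) = \int[P]_w (pi * \1_[set w | A w < x] w).
  rewrite RintegralZl//; last first.
    apply: (@bounded_integrable _ _ _ P (\1_[set w | A w < x]) 1) => //.
    by move=> w; rewrite indicE ger0_norm// lern1 leq_b1.
  by rewrite /Rintegral integral_indic// setIT.
apply: (@ae_Rdominated_cvg _ _ _ P setT (fun n w => larg (eps_ n) (- x + A w))
  (fun w => pi * \1_[set w | A w < x] w) (fun=> pi)) => //.
- by move=> n; apply: mcompA; apply: continuous_larg; exact: eps_gt0.
- exact: measurable_funM.
- apply: filterS aex => w Ax _; rewrite indicE (addrC (- x)).
  have [Axl|Axl] := ltP (A w) x.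
    rewrite mem_set// mulr1; apply: larg_eps_cvg_lt0.
    by rewrite subr_lt0.
  rewrite memNset; last by move=> /=; rewrite ltNge Axl.
  by rewrite mulr0; apply: larg_eps_cvg_gt0; rewrite subr_gt0 lt_neqAle eq_sym Ax.
- by apply: (@bounded_integrable _ _ _ P (fun=> pi) `|pi|).
- by apply: aeW => w n _; rewrite ger0_norm ?larg_ge0// larg_lepi.
Qed.

End boundary_limits.

Section boundary_power.
Context {R : realType} d (T : measurableType d) (P : probability T R).
Variables (D : T -> R) (t : R).
Hypotheses (mD : measurable_fun setT D) (t01 : 0 < t < 1).

Let t0 : 0 < t. Proof. by case/andP: t01. Qed.

Lemma pos_powRE (r : R) : pos_powR r (- t) = if 0 < r then rpow t r else 0.
Proof. by rewrite /pos_powR /rpow /powR; case: ltP => // r0; rewrite gt_eqF. Qed.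

Lemma pos_powR_ge0 (r : R) : 0 <= pos_powR r (- t).
Proof. by rewrite pos_powRE; case: ifP => // _; rewrite ltW// rpow_gt0. Qed.

Lemma measurable_pos_powR : measurable_fun setT (fun r : R => pos_powR r (- t)).
Proof.
rewrite /pos_powR; apply: measurable_fun_if => //; first exact: measurable_fun_ltr.
by apply: measurable_funTS; exact: measurable_powR.
Qed.

Let mpos1 x : measurable_fun setT (fun w => pos_powR (D w - x) (- t)).
Proof.
by apply: (measurableT_comp measurable_pos_powR); exact: measurable_funB.
Qed.

Let mpos2 x : measurable_fun setT (fun w => pos_powR (x - D w) (- t)).
Proof.
by apply: (measurableT_comp measurable_pos_powR); exact: measurable_funB.
Qed.

Lemma pos_powR_le (r : R) : pos_powR r (- t) <= rpow t `|r|.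
Proof.
rewrite pos_powRE; case: ltP => r0; first by rewrite gtr0_norm.
by rewrite ltW// rpow_gt0.
Qed.

Lemma integrable_pos_powRl x : regular_pt P D t x ->
  P.-integrable setT (fun w => (pos_powR (D w - x) (- t))%:E).
Proof.
move=> [_ ir]; apply: (integrable_le _ ir) => // w.
by rewrite ger0_norm ?pos_powR_ge0// pos_powR_le.
Qed.

Lemma integrable_pos_powRr x : regular_pt P D t x ->
  P.-integrable setT (fun w => (pos_powR (x - D w) (- t))%:E).
Proof.
move=> [_ ir]; apply: (integrable_le _ ir) => // w.
by rewrite ger0_norm ?pos_powR_ge0// -normrN opprB pos_powR_le.
Qed.

(** The limit of [(D - x + iy) ^ -t] as [y -> 0] is [(D - x) ^ -t] where [D > x] and
    [exp (- i pi t) (x - D) ^ -t] where [D < x]. The function [f] stands for cosine or sine. *)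
Let power_cvg (f : R -> R) x : continuous f -> (forall c, `|f c| <= 1) -> regular_pt P D t x ->
  \int[P]_w (expR (- t * lmod (eps_ n) (- x + D w)) * f (t * larg (eps_ n) (- x + D w)))
    @[n --> \oo] -->
  f 0 * \int[P]_w pos_powR (D w - x) (- t) + f (t * pi) * \int[P]_w pos_powR (x - D w) (- t).
Proof.
move=> cf f1 rx; have [Dx0 ir] := rx.
have aex := ae_neq mD Dx0.
have i1 := integrable_pos_powRl rx; have i2 := integrable_pos_powRr rx.
have j1 : P.-integrable setT (EFin \o (fun w => f 0 * pos_powR (D w - x) (- t))).
  exact: (integrableZl measurableT (f 0) i1).
have j2 : P.-integrable setT (EFin \o (fun w => f (t * pi) * pos_powR (x - D w) (- t))).
  exact: (integrableZl measurableT (f (t * pi)) i2).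
rewrite -RintegralZl// -[X in _ + X]RintegralZl// -RintegralD//.
have mk (g : R -> R) : continuous g -> measurable_fun setT (fun w => g (- x + D w)).
  move=> cg; apply: (@measurableT_comp _ _ _ _ _ _ g).
    exact: continuous_measurable_fun.
  exact: measurable_funD.
apply: (@ae_Rdominated_cvg _ _ _ P setT (fun n w => expR (- t * lmod (eps_ n) (- x + D w)) *
    f (t * larg (eps_ n) (- x + D w))) _ (fun w => rpow t `|D w - x|)) => //.
- move=> n; apply: measurable_funM.
    apply: measurableT_comp => //; apply: measurable_funM => //.
    by apply: mk; apply: continuous_lmod; exact: eps_gt0.
  apply: (@measurableT_comp _ _ _ _ _ _ f); first exact: continuous_measurable_fun.
  by apply: measurable_funM => //; apply: mk; apply: continuous_larg; exact: eps_gt0.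
- by apply: measurable_funD; apply: measurable_funM.
- apply: filterS aex => w Dx _; rewrite (addrC (- x)) !pos_powRE.
  have r0 : D w - x != 0 by rewrite subr_eq0.
  have ce : expR (- t * lmod (eps_ n) (D w - x)) @[n --> \oo] --> rpow t `|D w - x|.
    apply: (@cvg_comp _ _ _ (fun n => - t * lmod (eps_ n) (D w - x)) expR);
      last exact: continuous_expR.
    by apply: cvgM; [exact: cvg_cst|exact: lmod_eps_cvg].
  have [Dlt|Dgt] := ltP (D w) x.
    have n0 : D w - x < 0 by rewrite subr_lt0.
    rewrite ltNge (ltW n0)/= mulr0 add0r subr_gt0 Dlt -[x - D w]gtr0_norm ?subr_gt0// distrC.
    rewrite mulrC; apply: cvgM => //.
    apply: (@cvg_comp _ _ _ (fun n => t * larg (eps_ n) (D w - x)) f); last exact: cf.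
    by apply: cvgM; [exact: cvg_cst|exact: larg_eps_cvg_lt0].
  have p0 : 0 < D w - x by rewrite subr_gt0 lt_neqAle eq_sym Dx.
  rewrite p0 subr_gt0 ltNge Dgt/= mulr0 addr0; rewrite (gtr0_norm p0) in ce.
  rewrite mulrC; apply: cvgM => //.
  rewrite -[X in f X](mulr0 t).
  apply: (@cvg_comp _ _ _ (fun n => t * larg (eps_ n) (D w - x)) f); last exact: cf.
  by apply: cvgM; [exact: cvg_cst|exact: larg_eps_cvg_gt0].
- apply: filterS aex => w Dx n _.
  rewrite normrM ger0_norm ?expR_ge0// -[leRHS]mulr1 ler_pM ?expR_ge0//.
  rewrite (addrC (- x)); apply: expMlmod_le_rpow; rewrite ?eps_gt0 ?ltW//.
  by rewrite subr_eq0.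
Qed.

Lemma Cre_eps_cvg x : regular_pt P D t x ->
  Cre P D t (eps_ n) (- x) @[n --> \oo] -->
  \int[P]_w pos_powR (D w - x) (- t) + cos (t * pi) * \int[P]_w pos_powR (x - D w) (- t).
Proof.
move=> rx; have := power_cvg (@continuous_cos R) (@norm_cos_le1 R) rx.
by rewrite cos0 mul1r.
Qed.

Lemma Cim_eps_cvg x : regular_pt P D t x ->
  Cim P D t (eps_ n) (- x) @[n --> \oo] --> sin (t * pi) * \int[P]_w pos_powR (x - D w) (- t).
Proof.
move=> rx; have := power_cvg (@continuous_sin R) (@norm_sin_le1 R) rx.
by rewrite sin0 mul0r add0r.
Qed.

End boundary_power.

(** * Stieltjes inversion *)

Section poisson_kernel.
Context {R : realType} d (T : measurableType d) (P : probability T R) (D : T -> R).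
Hypothesis mD : measurable_fun setT D.
Notation mu := (@lebesgue_measure R).

(** [pi] times the Poisson kernel of height [eps_ n], evaluated at [D - x]. *)
Let Pk (n : nat) (z : R * T) : R := cpow_im 1 (eps_ n) (- z.1 + D z.2).

Let Pk_ge0 n z : 0 <= Pk n z.
Proof.
rewrite /Pk cpow_im1 ?eps_gt0// divr_ge0 ?(ltW (eps_gt0 _))//.
by rewrite ltW// sqrD_gt0// eps_gt0.
Qed.

Let mPk n : measurable_fun setT (Pk n).
Proof.
apply: (@measurableT_comp _ _ _ _ _ _ (cpow_im 1 (eps_ n))).
  by apply: continuous_measurable_fun; apply: continuous_cpow_im; exact: eps_gt0.
apply: measurable_funD; first exact: measurableT_comp.
exact: (measurableT_comp mD).
Qed.

Let ipk n x : (\int[P]_w (Pk n (x, w))%:E = (Cim P D 1 (eps_ n) (- x))%:E)%E.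
Proof.
rewrite /Cim /Rintegral fineK//; apply: integrable_fin_num => //.
apply: (@bounded_integrable _ _ _ P (fun w => Pk n (x, w)) (rpow 1 (eps_ n))).
  exact: (measurableT_comp (mPk n)).
by move=> w; apply: cpow_bound_im => //; exact: eps_gt0.
Qed.

Let ixpk n (a b c : R) : a < b ->
  (\int[mu]_(x in `[a, b]) (cpow_im 1 (eps_ n) (- x + c))%:E =
   (larg (eps_ n) (c - b) - larg (eps_ n) (c - a))%:E)%E.
Proof.
move=> ab; have e0 := eps_gt0 (R := R) n.
pose F x := larg (eps_ n) (c - x).
have dF (x : R) : is_derive x 1 F (cpow_im 1 (eps_ n) (- x + c)).
  have h1 : is_derive x 1 (fun x => c - x) (-1).
    by have := is_deriveB (is_derive_cst c x 1) (is_derive_id x 1); rewrite sub0r.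
  apply: (@is_derive_chain _ (larg (eps_ n)) (fun x => c - x) x _ _ _
    (is_derive_larg _ e0) h1).
  by rewrite cpow_im1// mulrN1 opprK (addrC (- x)).
rewrite (@continuous_FTC2 _ (fun x => cpow_im 1 (eps_ n) (- x + c)) F)//.
- apply: continuous_subspaceT => x.
  apply: (@continuous_comp _ _ _ (fun x => - x + c) (cpow_im 1 (eps_ n))).
    by apply: cvgD; [exact: (cvgN cvg_id)|exact: cvg_cst].
  exact: continuous_cpow_im.
- split.
  + by move=> x _; have [] := dF x.
  + by apply: cvg_at_right_filter; exact: is_derive_continuous (dF _).
  + by apply: cvg_at_left_filter; exact: is_derive_continuous (dF _).
- by move=> x _; rewrite derive1E; have [] := dF x.
Qed.

(* the indicator of [a, b] with value 1/2 at the end points *)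
Definition jump (a b c : R) : R := (Num.sg (b - c) - Num.sg (a - c)) / 2.

Lemma larg_eps_cvg_sg (r : R) :
  larg (eps_ n) r @[n --> \oo] --> pi / 2 * (1 - Num.sg r).
Proof.
have [r0|r0|->] := ltgtP r 0.
- rewrite ltr0_sg// opprK.
  have -> : pi / 2 * (1 + 1) = pi :> R by field.
  exact: larg_eps_cvg_lt0.
- by rewrite gtr0_sg// subrr mulr0; exact: larg_eps_cvg_gt0.
- rewrite sgr0 subr0 mulr1; under eq_fun do rewrite /larg mul0r atan0 subr0.
  exact: cvg_cst.
Qed.

Lemma measurable_jump a b : measurable_fun setT (fun w => jump a b (D w)).
Proof.
apply: measurable_funM => //.
have mlim c : measurable_fun setT (fun w => Num.sg (c - D w)).
  have m1 (n : nat) : measurable_fun setT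
      (fun w => 1 - 2 / pi * larg (eps_ n) (c - D w)).
    apply: measurable_funB => //; apply: measurable_funM => //.
    apply: (@measurableT_comp _ _ _ _ _ _ (larg (eps_ n))); last exact: measurable_funB.
    by apply: continuous_measurable_fun; apply: continuous_larg; exact: eps_gt0.
  apply: (measurable_fun_cvg m1) => w _.
  have h := cvgB (@cvg_cst _ (1:R) _ \oo _)
    (cvgM (@cvg_cst _ (2 / pi : R) _ \oo _) (@larg_eps_cvg_sg (c - D w))).
  have pi0 := pi_gt0 R.
  have E : 1 - 2 / pi * (pi / 2 * (1 - Num.sg (c - D w))) = Num.sg (c - D w).
    by move: (Num.sg _) (@pi R) pi0 => u p p0; field; rewrite gt_eqF.
  by rewrite E in h; exact: h.
exact: measurable_funB.
Qed.

Lemma norm_jump_le1 a b x : `|jump a b x| <= 1.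
Proof.
rewrite /jump normrM [`|2^-1|]ger0_norm// ler_pdivrMr// mul1r.
apply: (le_trans (ler_normB _ _)).
by rewrite !normr_sg; case: (_ != 0); case: (_ != 0); rewrite ?mulr1n ?mulr0n; lra.
Qed.

(** Valid at the end points as well, so it can be used to exclude atoms before [jump] is known to
    agree almost surely with an indicator. *)
Lemma jump_ge a b x : a < b -> (\1_(`]a, b[%classic) x : R) <= jump a b x.
Proof.
move=> ab; rewrite indicE /jump.
have [xab|xab] := boolP (x \in `]a, b[%classic).
  move: xab; rewrite inE/= in_itv/= => /andP[ax xb].
  by rewrite gtr0_sg ?subr_gt0// ltr0_sg ?subr_lt0// opprK; lra.
rewrite divr_ge0// subr_ge0.
have [bx|bx|bx] := ltgtP b x.
- by rewrite !ltr0_sg ?subr_lt0// (lt_trans ab).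
- by rewrite [leRHS]gtr0_sg ?subr_gt0//; case: sgrP => // _; rewrite lerN10.
- by rewrite -bx subrr sgr0 ltr0_sg ?subr_lt0// lerN10.
Qed.

Lemma measurable_Cim_eps n : measurable_fun setT (fun x : R => Cim P D 1 (eps_ n) (- x)).
Proof.
apply/measurable_EFinP; rewrite (_ : _ \o _ = fun x => (\int[P]_w (Pk n (x, w))%:E)%E).
  apply: (measurable_fun_fubini_tonelli_F (m2 := P) (EFin \o Pk n)).
    exact/measurable_EFinP.
  by move=> z; rewrite lee_fin.
by apply/funext => x /=; rewrite ipk.
Qed.

Lemma jump_in a b x : a < b -> x != a -> x != b -> jump a b x = \1_(`]a, b[%classic) x.
Proof.
move=> ab xa xb; rewrite indicE /jump.
have [xab|xab] := boolP (x \in `]a, b[%classic).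
  move: xab; rewrite inE/= in_itv/= => /andP[ax xb'].
  by rewrite gtr0_sg ?subr_gt0// ltr0_sg ?subr_lt0// opprK; field.
have [xla|xga] := ltP x a.
  by rewrite !gtr0_sg ?subr_gt0 ?subrr ?mul0r// (lt_trans xla).
have xga' : a < x by rewrite lt_neqAle eq_sym xa.
have xgb : b < x.
  rewrite lt_neqAle eq_sym xb/= leNgt; apply/negP => xltb.
  by move: xab; rewrite notin_setE/= in_itv/= xga' xltb.
by rewrite !ltr0_sg ?subr_lt0// subrr mul0r.
Qed.

(** The integral over [[a, b]] of the Poisson integrals is computed in two ways. Tonelli turns it
    into an expectation of differences of arguments, which tends to [pi] times that of [jump a b];
    dominated convergence gives [pi] times the integral of [f]. The bound [H] is what excludes a
    singular part. *)
Lemma poisson_inversion (f H : R -> R) a b : a < b -> measurable_fun setT f ->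
  mu.-integrable `[a, b] (EFin \o H) ->
  {ae mu, forall x, a <= x <= b ->
     Cim P D 1 (eps_ n) (- x) @[n --> \oo] --> pi * f x} ->
  {ae mu, forall x, a <= x <= b -> forall n, Cim P D 1 (eps_ n) (- x) <= H x} ->
  mu.-integrable `[a, b] (EFin \o f) /\
  \int[P]_w jump a b (D w) = \int[mu]_(x in `[a, b]) f x.
Proof.
move=> ab mf iH cf fH.
have pi0 := pi_gt0 R.
have mC := measurable_Cim_eps.
have C0 n x : 0 <= Cim P D 1 (eps_ n) (- x).
  by rewrite -lee_fin -ipk; apply: integral_ge0 => w _; rewrite lee_fin.
have inI x : `[a, b]%classic x -> a <= x <= b by rewrite /= in_itv.
have mab := @measurable_itv R `[a, b].
have cf' : {ae mu, forall x, `[a, b]%classic x ->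
    Cim P D 1 (eps_ n) (- x) @[n --> \oo] --> pi * f x}.
  by apply: ae_imply cf => x h /inI.
have fH' : {ae mu, forall x, forall n, `[a, b]%classic x ->
    `|Cim P D 1 (eps_ n) (- x)| <= H x}.
  by apply: ae_imply fH => x h n /inI xab; rewrite ger0_norm// h.
have mpf : measurable_fun setT (fun x => pi * f x) by exact: measurable_funM.
have ipf : mu.-integrable `[a, b] (EFin \o (fun x => pi * f x)).
  have [] // := @dominated_convergence _ _ _ mu _ mab
     (fun n x => (Cim P D 1 (eps_ n) (- x))%:E) (EFin \o (fun x => pi * f x)) (EFin \o H).
  - by move=> n; apply/measurable_EFinP; apply: measurable_funTS; exact: mC.
  - by apply/measurable_EFinP; exact: measurable_funTS.
  - by apply: ae_imply cf' => x h xab; apply: cvg_EFin; [exact: nearW|exact: h].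
have if_ : mu.-integrable `[a, b] (EFin \o f).
  have ipf' := @integrableZl _ _ _ mu _ mab (@pi R)^-1 _ ipf.
  apply: (@eq_integrable _ _ _ mu _ mab _ _ _ ipf') => x _ /=.
  by rewrite -EFinM mulKf// gt_eqF.
split => //.
have c1 : \int[mu]_(x in `[a, b]) Cim P D 1 (eps_ n) (- x) @[n --> \oo] -->
    \int[mu]_(x in `[a, b]) (pi * f x).
  apply: (@ae_Rdominated_cvg _ _ _ mu `[a, b] (fun n x => Cim P D 1 (eps_ n) (- x))
    (fun x => pi * f x) H) => //.
  - by move=> n; apply: measurable_funTS; exact: mC.
  - exact: measurable_funTS.
have c2 : \int[P]_w (larg (eps_ n) (D w - b) - larg (eps_ n) (D w - a)) @[n --> \oo] -->
    \int[P]_w (pi * jump a b (D w)).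
  apply: (@Rdominated_cvg _ _ _ P setT (fun n w =>
    larg (eps_ n) (D w - b) - larg (eps_ n) (D w - a)) (fun w => pi * jump a b (D w))
    (fun=> 2 * pi)) => //.
  - have m1 c n : measurable_fun setT (fun w => larg (eps_ n) (D w - c)).
      apply: (@measurableT_comp _ _ _ _ _ _ (larg (eps_ n))); last exact: measurable_funB.
      by apply: continuous_measurable_fun; apply: continuous_larg; exact: eps_gt0.
    by move=> n; apply: measurable_funB.
  - by apply: measurable_funM => //; exact: measurable_jump.
  - apply: aeW => w _.
    have h := cvgB (@larg_eps_cvg_sg (D w - b)) (@larg_eps_cvg_sg (D w - a)).
    have E : pi / 2 * (1 - Num.sg (D w - b)) - pi / 2 * (1 - Num.sg (D w - a)) =
        pi * jump a b (D w).
      by rewrite /jump -(opprB b) -(opprB a) !sgrN; field.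
    by rewrite E in h; exact: h.
  - by apply: (@bounded_integrable _ _ _ P (fun=> 2 * pi) `|2 * pi|).
  - move=> n w _; apply: (le_trans (ler_normB _ _)).
    rewrite !ger0_norm ?larg_ge0//.
    by have := larg_lepi (eps_ n) (D w - b); have := larg_lepi (eps_ n) (D w - a); lra.
have e12 n : \int[mu]_(x in `[a, b]) Cim P D 1 (eps_ n) (- x) =
    \int[P]_w (larg (eps_ n) (D w - b) - larg (eps_ n) (D w - a)).
  rewrite /Rintegral; congr fine.
  under eq_integral do rewrite -ipk.
  have mPkE : measurable_fun setT (fun z => (Pk n z)%:E) by exact/measurable_EFinP.
  have PkE_ge0 z : (0 <= (Pk n z)%:E)%E by rewrite lee_fin.
  rewrite (@tonelli_set _ _ _ _ _ mu P _ _ mab mPkE PkE_ge0).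
  apply: eq_integral => w _; rewrite -(ixpk n (D w) ab).
  by apply: eq_integral => x _.
rewrite (funext e12) in c1.
have e3 : \int[P]_w (pi * jump a b (D w)) = \int[mu]_(x in `[a, b]) (pi * f x).
  exact: (cvg_unique (@norm_hausdorff R R^o) c2 c1).
have ij : P.-integrable setT (EFin \o (fun w => jump a b (D w))).
  apply: (@bounded_integrable _ _ _ P (fun w => jump a b (D w)) 1).
    exact: measurable_jump.
  by move=> w; exact: norm_jump_le1.
rewrite RintegralZl// (@RintegralZl _ _ _ mu _ _ _ mab if_) in e3.
by apply: (@mulfI _ (@pi R)) => //; rewrite gt_eqF.
Qed.

End poisson_kernel.

(** * From intervals to a density *)

Section density.
Context {R : realType}.
Notation mu := (@lebesgue_measure R).

(** Half-open intervals generate the Borel sets and are stable under intersection. Intervals are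
    split at [0], since boundary values give information only for [0 < a]. *)
Lemma density_unique (m : {finite_measure set (measurableTypeR R) -> \bar R}) (f : R -> R) :
  measurable_fun setT f -> (forall x, 0 <= f x) -> (forall x, x <= 0 -> f x = 0) ->
  m `]-oo, 0%R]%classic = 0%E ->
  (forall a b, 0 < a -> a < b -> m `]a, b]%classic = (\int[mu]_(x in `]a, b]) (f x)%:E)%E) ->
  forall A, measurable A -> m A = (\int[mu]_(x in A) (f x)%:E)%E.
Proof.
move=> mf f0 fneg m0 mab.
have mfE : measurable_fun setT (fun x => (f x)%:E) by exact/measurable_EFinP.
have fE0 x : (0 <= (f x)%:E)%E by rewrite lee_fin.
pose nu (A : set (measurableTypeR R)) := (\int[mu]_(x in A) (f x)%:E)%E.
have nu0 : nu set0 = 0%E by rewrite /nu integral_set0.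
have nu_ge0 A : (0 <= nu A)%E by apply: integral_ge0.
have nuS : semi_sigma_additive nu by exact: semi_sigma_additive_nng_induced.
pose nuM : {measure set (measurableTypeR R) -> \bar R} :=
  HB.pack nu (isMeasure.Build _ _ _ nu nu0 nu_ge0 nuS).
have nuE A : nuM A = (\int[mu]_(x in A) (f x)%:E)%E by [].
have nu_neg : nuM `]-oo, 0%R]%classic = 0%E.
  rewrite nuE (eq_integral (cst 0%E)) ?integral0// => x.
  by rewrite inE/= in_itv/= => x0; rewrite fneg.
have mneg (n : {measure set (measurableTypeR R) -> \bar R}) a b : b <= 0 ->
    n `]-oo, 0%R]%classic = 0%E -> n `]a, b]%classic = 0%E.
  move=> b0 n0; apply/eqP; rewrite -measure_le0 -n0.
  apply: le_measure; rewrite ?inE// => x /=; rewrite !in_itv/= => /andP[_ xb].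
  exact: le_trans xb b0.
(* The left end point [0] is reached through the increasing union of the intervals []eps_ n, b]]. *)
have zero b : 0 < b -> m `]0%R, b]%classic = nuM `]0%R, b]%classic.
  move=> b0.
  pose F (n : nat) : set (measurableTypeR R) := `]eps_ n, b]%classic.
  have mF n : measurable (F n) by exact: measurable_itv.
  have UF : \bigcup_n F n = `]0%R, b]%classic.
    apply/seteqP; split => [x [n _]|x]; rewrite /F /= !in_itv/=.
      by move=> /andP[xn ->]; rewrite (lt_trans (eps_gt0 n)).
    move=> /andP[x0 xb].
    have [n hn] : exists n, eps_ n < x.
      have /cvgrPdist_lt/(_ _ x0)[N _ hN] := @eps_cvg0 R.
      by exists N; have := hN N (leqnn N); rewrite sub0r normrN gtr0_norm ?eps_gt0.
    by exists n => //=; rewrite in_itv/= hn.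
  have ndF : nondecreasing_seq F.
    move=> n k nk; apply/subsetPset => x; rewrite /F /= !in_itv/= => /andP[xn ->].
    by rewrite (le_lt_trans (ler_eps nk)).
  have mU : measurable (\bigcup_n F n) by exact: bigcup_measurable.
  have c1 := @nondecreasing_cvg_mu _ _ _ m F mF mU ndF.
  have c2 := @nondecreasing_cvg_mu _ _ _ nuM F mF mU ndF.
  have e n : m (F n) = nuM (F n).
    rewrite /F; have [nb|nb] := ltP (eps_ n) b; first by rewrite mab ?eps_gt0.
    by rewrite set_itv_ge ?measure0// bnd_simp -leNgt.
  rewrite UF in c1 c2.
  have : m \o F = nuM \o F by apply/funext.
  by move=> E; rewrite E in c1; exact: (cvg_unique _ c1 c2).
pose G : set (set (measurableTypeR R)) := @ocitv R.
pose g (n : nat) : set (measurableTypeR R) := `]- n%:R, n%:R]%classic.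
have e a b : m `]a, b]%classic = nuM `]a, b]%classic.
  have [ab|ba] := ltP a b; last by rewrite set_itv_ge ?measure0// bnd_simp -leNgt.
  have [a0|a0] := ltP 0 a; first by rewrite mab.
  have [b0|b0] := leP b 0; first by rewrite !mneg.
  have -> : `]a, b]%classic = `]a, 0%R]%classic `|` `]0%R, b]%classic :> set R.
    by rewrite -itv_bndbnd_setU// bnd_simp// ltW.
  have dis : `]a, 0%R]%classic `&` `]0%R, b]%classic = set0 :> set R.
    apply/seteqP; split => x //=; rewrite !in_itv/= => -[/andP[_ x0] /andP[x0' _]].
    by move: x0'; rewrite ltNge x0.
  rewrite !measureU//.
  congr (_ + _)%E; last exact: zero.
  exact: etrans (mneg m a 0 (lexx _) m0) (esym (mneg nuM a 0 (lexx _) nu_neg)).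
move=> A mA; rewrite -nuE; apply: (measure_unique G g) => //.
- exact: ocitvI.
- by move=> n; exists (- n%:R, n%:R).
- apply/seteqP; split => x // _; exists (Num.truncn `|x|).+1 => //=.
  have := truncnS_gt `|x : R|; rewrite ltr_norml => /andP[h1 /ltW h2].
  by rewrite /g /= in_itv/= h1.
- by move=> X [[a b] /= _ <-]; exact: e.
- by move=> k; rewrite ltey_eq fin_num_measure//; exact: measurable_itv.
Qed.

End density.

Section law_of_jump.
Context {R : realType} d (T : measurableType d) (P : probability T R) (D : T -> R).
Notation mu := (@lebesgue_measure R).
Hypothesis mD : measurable_fun setT D.
Variable f : R -> R.
Hypotheses (mf : measurable_fun setT f) (f0 : forall x, 0 <= f x).
Hypothesis fJ : forall a b : R, 0 < a -> a < b ->
  mu.-integrable `[a, b] (EFin \o f) /\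
  \int[P]_w jump a b (D w) = \int[mu]_(x in `[a, b]) f x.

Let mpre (S : set R) : measurable S -> measurable (D @^-1` S).
Proof. by move=> mS; have := mD measurableT mS; rewrite setTI. Qed.

Let ijump a b : P.-integrable setT (EFin \o (fun w => jump a b (D w))).
Proof.
apply: (@bounded_integrable _ _ _ P (fun w => jump a b (D w)) 1).
  exact: measurable_jump.
by move=> w; exact: norm_jump_le1.
Qed.

Let iindic (S : set R) : measurable S ->
  P.-integrable setT (EFin \o (fun w => \1_(D @^-1` S) w : R)) /\
  \int[P]_w (\1_(D @^-1` S) w : R) = fine (P (D @^-1` S)).
Proof.
move=> mS; split; last by rewrite /Rintegral integral_indic ?setIT//; exact: mpre.
apply: (@bounded_integrable _ _ _ P (fun w => \1_(D @^-1` S) w : R) 1).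
  by apply: measurable_indic; exact: mpre.
by move=> w; rewrite indicE ger0_norm// lern1 leq_b1.
Qed.

Let prob_open_le a b : 0 < a -> a < b ->
  fine (P (D @^-1` `]a, b[%classic)) <= \int[mu]_(x in `[a, b]) f x.
Proof.
move=> a0 ab; have [_ <-] := fJ a0 ab.
have [i <-] := iindic (measurable_itv `]a, b[).
apply: le_Rintegral => // w _; exact: (jump_ge _ ab).
Qed.

(** The mass at [c] is at most the integral of [f] over any short interval around [c], which is
    small by absolute continuity of the integral. *)
Lemma law_no_atom c : 0 < c -> P (D @^-1` [set c]) = 0%E.
Proof.
move=> c0; have mc := mpre (measurable_set1 c).
have c20 : 0 < c / 2 by rewrite divr_gt0.
have c2c : c / 2 < 2 * c by lra.
have [ic _] := fJ c20 c2c.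
pose f' := f \_ `[c / 2, 2 * c].
have i' : mu.-integrable setT (EFin \o f').
  by rewrite /f' -restrict_EFin; apply/integrable_restrict => //=; rewrite setTI.
suff h e : 0 < e -> fine (P (D @^-1` [set c])) <= e.
  have fP : P (D @^-1` [set c]) \is a fin_num by exact: fin_num_measure.
  rewrite -[LHS]fineK//; congr EFin; apply/eqP; rewrite eq_le fine_ge0// andbT.
  by apply/ler_addgt0Pr => e e0; rewrite add0r; exact: h.
move=> e0; have [del [del0 hdel]] := integral_normr_continuous i' e0.
(* The first bound keeps [[c - eta, c + eta]] inside [[c / 2, 2 * c]], the second makes its length
   smaller than [del]. *)
pose eta := Num.min (c / 4) (del / 4).
have eta0 : 0 < eta by rewrite lt_min !divr_gt0.
have etac : eta <= c / 4 by rewrite ge_min lexx.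
have etad : eta <= del / 4 by rewrite ge_min lexx orbT.
have a0 : 0 < c - eta by lra.
have ab : c - eta < c + eta by lra.
have : fine (P (D @^-1` [set c])) <= fine (P (D @^-1` `]c - eta, c + eta[%classic)).
  apply: fine_le; rewrite ?fin_num_measure//; last 2 first.
  - by apply: mpre; exact: measurable_itv.
  - apply: le_measure; rewrite ?inE//; first by apply: mpre; exact: measurable_itv.
    by move=> w /= ->; rewrite in_itv/=; apply/andP; split; lra.
move=> /le_trans; apply; apply: (le_trans (prob_open_le a0 ab)).
have mI := @measurable_itv R `[c - eta, c + eta].
have muI : (mu (`[(c - eta)%R, (c + eta)%R]%classic : set R) < del%:E)%E.
  rewrite /= lebesgue_measure_itv/= lte_fin ab -EFinB lte_fin; lra.
apply/ltW; apply: le_lt_trans (hdel _ mI muI).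
rewrite le_eqVlt; apply/orP; left; apply/eqP; apply: eq_Rintegral => x.
rewrite inE/= in_itv/= => /andP[x1 x2].
rewrite /f' patchE mem_set ?ger0_norm//= in_itv/=; apply/andP; split; lra.
Qed.

Lemma law_itv a b : 0 < a -> a < b ->
  P (D @^-1` `]a, b]%classic) = (\int[mu]_(x in `]a, b]) (f x)%:E)%E.
Proof.
move=> a0 ab; have [iab eJ] := fJ a0 ab.
have b0 := lt_trans a0 ab.
have -> : D @^-1` `]a, b]%classic = D @^-1` `]a, b[%classic `|` D @^-1` [set b].
  apply/seteqP; split => w /=; rewrite !in_itv/=.
    by move=> /andP[-> ]; rewrite le_eqVlt => /predU1P[->|->]; [right|left].
  by move=> [/andP[-> /ltW->//]|->]; rewrite ab lexx.
have m1 := mpre (@measurable_itv R `]a, b[).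
have m2 := mpre (measurable_set1 b).
have dis : D @^-1` `]a, b[%classic `&` D @^-1` [set b] = set0.
  by apply/seteqP; split => w //=; rewrite in_itv/= => -[/andP[_ +] e]; rewrite e ltxx.
rewrite (measureU _ m1 m2 dis).
transitivity (P (D @^-1` `]a, b[%classic) + 0)%E.
  by congr (_ + _)%E; exact: law_no_atom.
rewrite adde0.
have mo := @measurable_itv R `]a, b[.
rewrite integral_itv_obnd_cbnd; last by apply/measurable_EFinP; exact: measurable_funTS.
have -> : (\int[mu]_(x in `[a, b]) (f x)%:E = (\int[mu]_(x in `[a, b]) f x)%:E)%E.
  by rewrite /Rintegral fineK//; apply: integrable_fin_num => //; exact: measurable_itv.
rewrite -eJ -[LHS]fineK; last by rewrite fin_num_measure//; exact: mpre.
have [i1 <-] := iindic mo.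
congr EFin; rewrite /Rintegral; congr fine.
apply: ae_eq_integral => //.
- by have /measurable_int := i1.
- by have /measurable_int := ijump a b.
- have aea : {ae P, forall w, D w != a} by exact: (ae_neq mD (law_no_atom a0)).
  have aeb : {ae P, forall w, D w != b} by exact: (ae_neq mD (law_no_atom b0)).
  apply: filterS2 aea aeb => w wa wb _ /=.
  by rewrite jump_in// /= indicE preimage_setE.
Qed.

End law_of_jump.

(** * Multiplication by an independent Bernoulli variable *)

Section bernoulli_product.
Context {R : realType} d (T : measurableType d) (P : probability T R).
Variables (E : set T) (B : T -> R) (t : R).
Hypotheses (mE : measurable E) (mB : measurable_fun setT B).
Hypotheses (t01 : 0 < t < 1) (PE : P E = t%:E).
Hypothesis indep : forall S, measurable S -> P (E `&` B @^-1` S) = (t%:E * P (B @^-1` S))%E.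

Let t0 : 0 < t. Proof. by case/andP: t01. Qed.
Let t1 : t < 1. Proof. by case/andP: t01. Qed.

(** With [E] the event [Y = 1], this is almost surely [Y / G] for [B = 1 / G] and [G Y] for [B = G],
    that is, the reciprocal of the argument of [D_1]. *)
Definition bern_mul (w : T) : R := \1_E w * B w.

Lemma measurable_bern_mul : measurable_fun setT bern_mul.
Proof. exact: measurable_funM. Qed.

Let expect_rv (X : T -> R) : measurable_fun setT X -> (forall w, 0 <= X w) ->
  (\int[P]_w (X w)%:E =
   \int[lebesgue_measure]_(r in `[0%R, +oo[) P (X @^-1` `]r, +oo[%classic))%E.
Proof.
move=> mX X0.
pose XR : {RV P >-> R} := HB.pack X (isMeasurableFun.Build _ _ _ _ X mX).
have := @ge0_expectation_ccdf _ _ _ P XR X0.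
by rewrite expectation_def.
Qed.

(** Independence is given for events only; the layer-cake formula reduces the expectation to the
    events [h B > r] with [0 <= r]. *)
Let indep_ge0 (h : R -> R) : measurable_fun setT h -> (forall x, 0 <= h x) ->
  (\int[P]_w (\1_E w * h (B w))%:E = t%:E * \int[P]_w (h (B w))%:E)%E.
Proof.
move=> mh h0.
have mhB : measurable_fun setT (fun w => h (B w)) by exact: measurableT_comp mh mB.
rewrite !expect_rv//; last 2 first.
- exact: measurable_funM.
- by move=> w; rewrite mulr_ge0// indicE.
rewrite -ge0_integralZl//; last 2 first.
- apply: measurable_funTS.
  pose XR : {RV P >-> R} := HB.pack (fun w => h (B w)) (isMeasurableFun.Build _ _ _ _ _ mhB).
  exact: (@ccdf_measurable _ _ _ P XR).
- by rewrite lee_fin ltW.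
apply: eq_integral => r; rewrite inE/= in_itv/= andbT => r0.
have mS : measurable (h @^-1` `]r, +oo[%classic).
  by have := mh measurableT _ (measurable_itv `]r, +oo[); rewrite setTI.
rewrite -(indep mS); congr (P _); apply/seteqP; split => w /=; rewrite !in_itv/= !andbT indicE.
- have [wE|wE] := boolP (w \in E); first by rewrite mul1r => ?; split => //; exact/set_mem.
  by rewrite mul0r ltNge r0.
- by move=> [wE rh]; rewrite mem_set// mul1r.
Qed.

(** Splitting [h] into positive and negative parts reduces the claim to [indep_ge0]. Signed [h] are
    needed because logarithms are the main application. *)
Lemma integral_bern_mul (h : R -> R) : measurable_fun setT h ->
  P.-integrable setT (fun w => (h (B w))%:E) ->
  P.-integrable setT (fun w => (h (bern_mul w))%:E) /\
  \int[P]_w h (bern_mul w) = t * \int[P]_w h (B w) + (1 - t) * h 0.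
Proof.
move=> mh ih.
have mhB : measurable_fun setT (fun w => h (B w)) by exact: measurableT_comp mh mB.
have mind : measurable_fun setT (\1_E : T -> R) by exact: measurable_indic.
pose hp x := Num.max (h x) 0; pose hm x := Num.max (- h x) 0.
have mhp : measurable_fun setT hp by exact: measurable_maxr.
have mhm : measurable_fun setT hm.
  by apply: measurable_maxr => //; exact: measurableT_comp.
have hp0 x : 0 <= hp x by rewrite le_max lexx orbT.
have hm0 x : 0 <= hm x by rewrite le_max lexx orbT.
have hE x : h x = hp x - hm x.
  rewrite /hp /hm; have [hx|hx] := leP 0 (h x).
    by rewrite max_r ?oppr_le0// subr0.
  by rewrite max_l ?oppr_ge0 ?ltW// sub0r opprK.
have hple x : `|hp x| <= `|h x|.
  by rewrite ger0_norm// /hp ge_max ler_norm/=.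
have hmle x : `|hm x| <= `|h x|.
  by rewrite ger0_norm// /hm ge_max -normrN ler_norm/=.
have iabs : P.-integrable setT (fun w => `|h (B w)|%:E) by exact: (integrable_abse ih).
have ib (g : R -> R) : measurable_fun setT g -> (forall x, `|g x| <= `|h x|) ->
    P.-integrable setT (EFin \o (fun w => g (B w))) /\
    P.-integrable setT (EFin \o (fun w => \1_E w * g (B w))).
  move=> mg gh.
  have mgB : measurable_fun setT (fun w => g (B w)) by exact: measurableT_comp mg mB.
  split; apply: (integrable_le _ iabs) => // w.
  - exact: measurable_funM.
  - rewrite indicE; case: (_ \in _); rewrite ?mul1r ?mul0r ?normr0//.
have key (g : R -> R) : measurable_fun setT g -> (forall x, `|g x| <= `|h x|) ->
    (forall x, 0 <= g x) -> \int[P]_w (\1_E w * g (B w)) = t * \int[P]_w g (B w).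
  move=> mg gh g0; rewrite /Rintegral indep_ge0// fineM//.
  by apply: integrable_fin_num => //; have [] := ib g mg gh.
have [ihp ihp'] := ib hp mhp hple.
have [ihm ihm'] := ib hm mhm hmle.
have [_ ih'] := ib h mh (fun=> lexx _).
have keyh : \int[P]_w (\1_E w * h (B w)) = t * \int[P]_w h (B w).
  have -> : \int[P]_w (\1_E w * h (B w)) =
      \int[P]_w (\1_E w * hp (B w) - \1_E w * hm (B w)).
    by apply: eq_Rintegral => w _; rewrite hE mulrBr.
  rewrite RintegralB// key// key// -mulrBr -RintegralB//; congr (_ * _).
  by apply: eq_Rintegral => w _; rewrite -hE.
have hA w : h (bern_mul w) = \1_E w * h (B w) + (1 - \1_E w) * h 0.
  rewrite /bern_mul indicE; case: (_ \in _); rewrite ?mul1r ?mul0r ?subrr ?subr0 ?mul0r ?mul1r.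
    by rewrite addr0.
  by rewrite add0r.
have i2 : P.-integrable setT (EFin \o (fun w => (1 - \1_E w) * h 0)).
  apply: (@bounded_integrable _ _ _ P (fun w => (1 - \1_E w) * h 0) `|h 0|).
    by apply: measurable_funM => //; exact: measurable_funB.
  move=> w; rewrite indicE; case: (_ \in _); rewrite ?subrr ?subr0 ?mul0r ?mul1r ?normr0//.
split.
- apply: (@eq_integrable _ _ _ P _ measurableT _ _ _ (integrableD measurableT ih' i2)).
  by move=> w _ /=; rewrite hA EFinD.
- transitivity (\int[P]_w (\1_E w * h (B w) + (1 - \1_E w) * h 0)).
    by apply: eq_Rintegral => w _; exact: hA.
  rewrite RintegralD// keyh; congr (_ + _).
  have i3 : P.-integrable setT (EFin \o (fun w => 1 - \1_E w : R)).
    apply: (@bounded_integrable _ _ _ P (fun w => 1 - \1_E w : R) 1).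
      exact: measurable_funB.
    by move=> w; rewrite indicE; case: (_ \in _); rewrite ?subrr ?subr0 ?normr0 ?normr1.
  rewrite RintegralZr//; congr (_ * _).
  have i4 : P.-integrable setT (EFin \o (\1_E : T -> R)).
    apply: (@bounded_integrable _ _ _ P (\1_E : T -> R) 1) => //.
    by move=> w; rewrite indicE ger0_norm// lern1 leq_b1.
  have i5 : P.-integrable setT (EFin \o (fun=> 1 : R)).
    by apply: (@bounded_integrable _ _ _ P (fun=> 1) 1) => // w; rewrite normr1.
  rewrite RintegralB//; congr (_ - _).
    by rewrite Rintegral_cst// [X in fine X]probability_setT mulr1.
  by rewrite /Rintegral integral_indic// setIT [X in fine X]PE.
Qed.

End bernoulli_product.

(** * The density of [D_1] *)

Section stieltjes_density.
Context {R : realType}.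
Context d (T : measurableType d) (P : probability T R) (E : set T) (B : T -> R) (t : R).
Context d' (T' : measurableType d') (P' : probability T' R) (D : T' -> R).
Notation mu := (@lebesgue_measure R).
Hypotheses (mE : measurable E) (mB : measurable_fun setT B) (B0 : forall w, 0 < B w).
Hypotheses (t01 : 0 < t < 1) (PE : P E = t%:E).
Hypothesis indep : forall S, measurable S -> P (E `&` B @^-1` S) = (t%:E * P (B @^-1` S))%E.
Hypothesis iB : P.-integrable setT (fun w => (ln (B w))%:E).
Hypotheses (mD : measurable_fun setT D) (D0 : forall w, 0 <= D w).
Hypothesis DA : forall z, 0 < z ->
  \int[P']_w rpow 1 (z + D w) = expR (- 1 * \int[P]_w ln (z + bern_mul E B w)).

Let t0 : 0 < t. Proof. by case/andP: t01. Qed.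
Let t1 : t < 1. Proof. by case/andP: t01. Qed.
Let A := bern_mul E B.
Let mA : measurable_fun setT A. Proof. exact: measurable_bern_mul. Qed.
Let Bge0 w : 0 <= B w. Proof. exact: ltW. Qed.
Let A0 w : 0 <= A w.
Proof. by rewrite /A /bern_mul mulr_ge0// indicE. Qed.

Let mln z : measurable_fun setT (fun x : R => ln (z + x)).
Proof. by apply: measurableT_comp => //; exact: measurable_funD. Qed.

Lemma integrable_ln1p : P.-integrable setT (fun w => (ln (1 + B w))%:E).
Proof.
have iabs : P.-integrable setT (fun w => `|ln (B w)|%:E) by exact: (integrable_abse iB).
have ic : P.-integrable setT (EFin \o (fun=> ln 2)).
  by apply: (@bounded_integrable _ _ _ P (fun=> ln 2) `|ln 2|).
apply: (integrable_le (g := fun w => ln 2 + `|ln (B w)|)).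
- exact: (measurableT_comp (mln 1) mB).
- exact: (integrableD measurableT ic iabs).
- move=> w; rewrite ger0_norm; last by rewrite ln_ge0// lerDl.
  have [b1|b1] := leP 1 (B w).
    apply: (le_trans (y := ln (2 * B w))).
      by rewrite ler_ln ?posrE ?mulr_gt0// ?ltr_pwDl//; lra.
    by rewrite lnM ?posrE// lerD2l ler_norm.
  apply: (le_trans (y := ln 2)); last by rewrite lerDl.
  by rewrite ler_ln ?posrE ?ltr_pwDl//; lra.
Qed.

Let mixA (h : R -> R) : measurable_fun setT h ->
  P.-integrable setT (fun w => (h (B w))%:E) ->
  P.-integrable setT (fun w => (h (A w))%:E) /\
  \int[P]_w h (A w) = t * \int[P]_w h (B w) + (1 - t) * h 0.
Proof. exact: integral_bern_mul. Qed.

Let iA : P.-integrable setT (fun w => (ln (1 + A w))%:E).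
Proof. by have [] := mixA (mln 1) integrable_ln1p. Qed.

Let LmodA y s : 0 < y -> Lmod P A y s = t * Lmod P B y s + (1 - t) * lmod y s.
Proof.
move=> y0; have m : measurable_fun setT (fun c => lmod y (s + c)).
  apply: (@measurableT_comp _ _ _ _ _ _ (lmod y)); last exact: measurable_funD.
  by apply: continuous_measurable_fun; exact: continuous_lmod.
have i : P.-integrable setT (fun w => (lmod y (s + B w))%:E).
  exact: (integrable_lmod mB Bge0 integrable_ln1p s y0).
by have [_] := mixA m i; rewrite addr0.
Qed.

Let lnA x : regular_pt P B t x ->
  \int[P]_w ln `|A w - x| = t * \int[P]_w ln `|B w - x| + (1 - t) * ln `|x|.
Proof.
move=> rx.
have m : measurable_fun setT (fun c : R => ln `|c - x|).
  by apply: measurableT_comp => //; apply: measurableT_comp => //; exact: measurable_funB.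
have i := integrable_ln_dist mB Bge0 t01 integrable_ln1p rx.
by have [_] := mixA m i; rewrite sub0r normrN.
Qed.

Let mlt (X : T -> R) x : measurable_fun setT X -> measurable [set w | X w < x].
Proof.
move=> mX; have -> : [set w | X w < x] = X @^-1` `]-oo, x[.
  by apply/seteqP; split => w /=; rewrite in_itv.
by have := mX measurableT _ (measurable_itv `]-oo, x[); rewrite setTI.
Qed.

Let probA x : 0 < x ->
  fine (P [set w | A w < x]) = t * fine (P [set w | B w < x]) + (1 - t).
Proof.
move=> x0; pose h : R -> R := \1_(`]-oo, x[%classic).
have mh : measurable_fun setT h by exact: measurable_indic.
have hX (X : T -> R) w : h (X w) = \1_[set w | X w < x] w.
  by rewrite /h !indicE; congr (_%:R); apply/idP/idP; rewrite !inE/= in_itv.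
have ih : P.-integrable setT (fun w => (h (B w))%:E).
  apply: (@bounded_integrable _ _ _ P (fun w => h (B w)) 1).
    exact: measurableT_comp mh mB.
  by move=> w; rewrite /h indicE ger0_norm// lern1 leq_b1.
have [_] := mixA mh ih.
have e (X : T -> R) : measurable_fun setT X ->
    \int[P]_w h (X w) = fine (P [set w | X w < x]).
  move=> mX; rewrite /Rintegral; congr fine.
  under eq_integral do rewrite hX.
  by rewrite integral_indic ?setIT//; exact: mlt.
rewrite !e// => ->; congr (_ + _).
by rewrite /h indicE mem_set ?mulr1//= in_itv.
Qed.

(** Inversion only sees [x > 0], so an atom at [0] is excluded separately. A mass [p] there gives [p
    / z <= E (z + D) ^ -1 = exp (- E ln (z + A))]. As [A] vanishes with probability only [1 - t],
    the right-hand side is at most a constant times [z ^ (t - 1)], hence [p] is at most a constant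
    times [z ^ t]. *)
Lemma stieltjes_no_zero : P' (D @^-1` [set 0]) = 0%E.
Proof.
have mD0 : measurable (D @^-1` [set 0]).
  by have := mD measurableT (measurable_set1 0); rewrite setTI.
set p := fine (P' (D @^-1` [set 0])).
have fp : P' (D @^-1` [set 0]) = p%:E by rewrite /p fineK// fin_num_measure.
rewrite fp; congr EFin; apply/eqP; rewrite eq_le.
have p0 : 0 <= p by rewrite /p fine_ge0.
rewrite p0 andbT leNgt; apply/negP => pgt0.
pose K := \int[P]_w ln (B w).
have bound z : 0 < z -> ln p <= t * ln z - t * K.
  move=> z0.
  have h1 : z^-1 * p <= \int[P']_w rpow 1 (z + D w).
    have i1 : P'.-integrable setT (EFin \o (\1_(D @^-1` [set 0]) : T' -> R)).
      apply: (@bounded_integrable _ _ _ P' (\1_(D @^-1` [set 0]) : T' -> R) 1).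
        exact: measurable_indic.
      by move=> w; rewrite indicE ger0_norm// lern1 leq_b1.
    have -> : z^-1 * p = \int[P']_w (z^-1 * \1_(D @^-1` [set 0]) w).
      by rewrite RintegralZl// /Rintegral integral_indic// setIT.
    apply: le_Rintegral => //.
    - exact: (integrableZl measurableT z^-1 i1).
    - exact: integrable_rpow.
    - move=> w _; rewrite indicE; have [|_] := boolP (w \in _).
        by rewrite inE/= => ->; rewrite mulr1 addr0 rpow1.
      by rewrite mulr0 ltW// rpow_gt0.
  rewrite DA// mulN1r in h1.
  have iz : P.-integrable setT (fun w => (ln (z + B w))%:E).
    exact: (integrable_lnDA mB Bge0 integrable_ln1p z0).
  have [_ e] := mixA (mln z) iz.
  have h2 : K <= \int[P]_w ln (z + B w).
    apply: le_Rintegral => // w _.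
    by rewrite ler_ln ?posrE ?addr_gt0// lerDr ltW.
  rewrite -/A e addr0 in h1.
  have h3 : ln (z^-1 * p) <= - (t * \int[P]_w ln (z + B w) + (1 - t) * ln z).
    by rewrite -[leRHS]expRK ler_ln ?posrE ?expR_gt0// mulr_gt0// invr_gt0.
  rewrite lnM ?posrE ?invr_gt0// lnV ?posrE// in h3.
  have h4 : t * K <= t * \int[P]_w ln (z + B w) by rewrite ler_wpM2l// ltW.
  move: h3 h4; lra.
(* For this [z] the right-hand side of [bound] is [ln p - 1]. *)
have := bound (expR ((ln p - 1) / t + K)) (expR_gt0 _).
rewrite expRK mulrDr mulrCA divff ?gt_eqF// mulr1; lra.
Qed.

(** The limiting argument is [pi P(A < x)] with [P(A < x) = 1 - t P(x <= B)], so its sine is that of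
    [pi t P(x <= B)]. The power of [x] is the contribution of the event [A = 0] to
    [exp (- E ln |A - x|)]. *)
Definition stieltjes_pdf (x : R) : R :=
  sin (pi * t * fine (P [set w | x <= B w])) / pi * x `^ (t - 1) *
  expR (- t * \int[P]_w ln `|B w - x|).

Let V n x := Cim P' D 1 (eps_ n) (- x).

Let VE n x : V n x = expR (- Lmod P A (eps_ n) (- x)) * sin (Larg P A (eps_ n) (- x)).
Proof.
have [_] := cpow_expectation mA A0 mD D0 iA ltr01 DA (- x) (eps_gt0 n).
by rewrite mulN1r mul1r.
Qed.

Let V0 n x : 0 <= V n x.
Proof.
apply: Rintegral_ge0 => w _; rewrite cpow_im1 ?eps_gt0// divr_ge0 ?(ltW (eps_gt0 _))//.
by rewrite ltW// sqrD_gt0// eps_gt0.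
Qed.

Let V_cvg x : 0 < x -> regular_pt P B t x -> regular_pt P A t x ->
  V n x @[n --> \oo] --> pi * stieltjes_pdf x.
Proof.
move=> x0 rB rA.
have c1 := Lmod_eps_cvg mA A0 t01 iA rA.
have c2 := Larg_eps_cvg mA rA.1.
have -> : pi * stieltjes_pdf x = expR (- \int[P]_w ln `|A w - x|) *
    sin (pi * fine (P [set w | A w < x])).
  rewrite lnA// probA// /stieltjes_pdf.
  have -> : fine (P [set w | x <= B w]) = 1 - fine (P [set w | B w < x]).
    have -> : [set w | x <= B w] = ~` [set w | B w < x].
      by apply/seteqP; split => w /=; rewrite leNgt => /negP.
    rewrite probability_setC ?fineB ?fin_num_measure//; exact: mlt.
  set q := fine _; set I := Rintegral _ _ _.
  have -> : pi * (t * q + (1 - t)) = pi - pi * t * (1 - q) by ring.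
  have -> : sin (pi - pi * t * (1 - q)) = sin (pi * t * (1 - q)).
    by rewrite sinB sinpi cospi; ring.
  have -> : - (t * I + (1 - t) * ln `|x|) = - t * I + (t - 1) * ln x.
    by rewrite gtr0_norm//; ring.
  rewrite expRD /powR gt_eqF//.
  by rewrite -!mulrA [LHS]mulrCA mulVKf ?gt_eqF ?pi_gt0//; ring.
rewrite (_ : V ^~ x = fun n => expR (- Lmod P A (eps_ n) (- x)) *
    sin (Larg P A (eps_ n) (- x))); last by apply/funext => n; exact: VE.
apply: cvgM.
  by apply: (@cvg_comp _ _ _ _ expR); [exact: (cvgN c1)|exact: continuous_expR].
by apply: (@cvg_comp _ _ _ _ sin); [exact: c2|exact: continuous_sin].
Qed.

(** The exponential lies above its tangent at the mean; integrating the tangent gives the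
    inequality. *)
Let jensen (X : T -> R) : P.-integrable setT (EFin \o X) ->
  P.-integrable setT (EFin \o (fun w => expR (X w))) ->
  expR (\int[P]_w X w) <= \int[P]_w expR (X w).
Proof.
move=> iX ieX; set m := \int[P]_w X w.
have i1 : P.-integrable setT (EFin \o (fun=> 1 - m)).
  by apply: (@bounded_integrable _ _ _ P (fun=> 1 - m) `|1 - m|).
have i2 : P.-integrable setT (EFin \o (fun w => (1 - m) + X w)).
  exact: (integrableD measurableT i1 iX).
have -> : expR m = \int[P]_w (expR m * ((1 - m) + X w)).
  rewrite RintegralZl// RintegralD// Rintegral_cst// [X in fine X]probability_setT -/m.
  by rewrite mulr1 subrK mulr1.
apply: le_Rintegral => //; first exact: (integrableZl measurableT (expR m) i2).
move=> w _; have -> : expR (X w) = expR m * expR (X w - m) by rewrite -expRD addrC subrK.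
rewrite ler_pM2l ?expR_gt0//; apply: le_trans (expR_ge1Dx _); lra.
Qed.

(** The modulus of the boundary value splits into the part of [A = 0], at most
    [x ^ (t - 1) <= a ^ (t - 1)], and the part of [B], to which Jensen applies. The right-hand side
    is dominated by [expMlmod_dominated]. *)
Let V_le a x n : 0 < a -> a <= x ->
  V n x <= rpow (1 - t) a * \int[P]_w expR (- t * lmod (eps_ n) (B w - x)).
Proof.
move=> a0 ax; have x0 := lt_le_trans a0 ax; have e0 := eps_gt0 (R := R) n.
rewrite VE; apply: (le_trans (y := expR (- Lmod P A (eps_ n) (- x)))).
  by rewrite ler_piMr ?expR_ge0// sin_le1.
rewrite LmodA//.
have -> : - (t * Lmod P B (eps_ n) (- x) + (1 - t) * lmod (eps_ n) (- x)) =
    - (1 - t) * lmod (eps_ n) (- x) + - t * Lmod P B (eps_ n) (- x) by ring.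
rewrite expRD; apply: ler_pM; rewrite ?expR_ge0//.
  rewrite lmodN; apply: (le_trans (expMlmod_le_rpow _ e0 _)).
  - by rewrite subr_ge0 ltW.
  - by rewrite gt_eqF.
  - by rewrite gtr0_norm// ler_rpow// subr_ge0 ltW.
have iL : P.-integrable setT (EFin \o (fun w => lmod (eps_ n) (- x + B w))).
  exact: (integrable_lmod mB Bge0 integrable_ln1p (- x) e0).
have e w : B w - x = - x + B w by rewrite addrC.
under eq_Rintegral do rewrite e.
rewrite /Lmod -RintegralZl//; apply: jensen; first exact: (integrableZl measurableT (- t) iL).
apply: (@bounded_integrable _ _ _ P _ (rpow t (eps_ n))).
  apply: measurableT_comp => //; apply: measurable_funM => //.
  exact/measurable_EFinP/(measurable_int _ iL).
by move=> w; rewrite ger0_norm ?expR_ge0// expMlmod_le// ltW.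
Qed.


Theorem stieltjes_density : exists f : R -> R,
  [/\ measurable_fun setT f, (forall x, 0 <= f x),
      (forall S, measurable S -> P' (D @^-1` S) = (\int[mu]_(x in S) (f x)%:E)%E) &
      {ae mu, forall x, 0 < x -> f x = stieltjes_pdf x}].
Proof.
have pi0 := pi_gt0 R.
(* A limit superior is measurable by construction and equals [stieltjes_pdf x] at regular points;
   the absolute value makes [f] nonnegative at all the others. *)
pose f x : R := if 0 < x then `|fine (limn_esup (fun n => (V n x / pi)%:E))| else 0.
have mV n : measurable_fun setT (V n) by exact: measurable_Cim_eps.
have mf : measurable_fun setT f.
  apply: measurable_fun_if => //; first exact: measurable_fun_ltr.
  apply: measurable_funTS; apply: measurableT_comp => //; apply: measurableT_comp => //.
  apply: measurable_fun_limn_esup => n; apply/measurable_EFinP.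
  exact: measurable_funM.
have f0 x : 0 <= f x by rewrite /f; case: ifP.
have fE x : 0 < x -> regular_pt P B t x -> regular_pt P A t x -> f x = stieltjes_pdf x.
  move=> x0 rB rA; rewrite /f x0.
  have c : V n x / pi @[n --> \oo] --> stieltjes_pdf x.
    have -> : stieltjes_pdf x = pi * stieltjes_pdf x / pi.
      by rewrite mulrAC divff ?gt_eqF// mul1r.
    by apply: cvgM; [exact: V_cvg|exact: cvg_cst].
  have h : (V n x / pi)%:E @[n --> \oo] --> (stieltjes_pdf x)%:E.
    by apply: cvg_EFin; [exact: nearW|exact: c].
  rewrite (cvg_limn_einf_sup h).2 /= ger0_norm//.
  rewrite -(cvg_lim (@norm_hausdorff R R^o) c); apply: limr_ge.
    by apply/cvg_ex; exists (stieltjes_pdf x); exact: c.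
  by apply: nearW => n; rewrite divr_ge0// ltW.
have aeR : {ae mu, forall x, regular_pt P B t x /\ regular_pt P A t x}.
  by apply: ae_imply2 (ae_regular_pt P mB t01) (ae_regular_pt P mA t01) => x.
have fJ a b : 0 < a -> a < b -> mu.-integrable `[a, b] (EFin \o f) /\
    \int[P']_w jump a b (D w) = \int[mu]_(x in `[a, b]) f x.
  move=> a0 ab; have b0 := lt_trans a0 ab.
  have [H [iH HV]] := expMlmod_dominated P mB t01 b0.
  have mab := @measurable_itv R `[a, b].
  have sub : `[a, b] `<=` `[- b, b]%classic.
    move=> x /=; rewrite !in_itv/= => /andP[ax ->]; rewrite andbT.
    by apply: le_trans ax; rewrite ltW// (lt_trans _ a0)// oppr_lt0.
  have iH' : mu.-integrable `[a, b] (EFin \o H).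
    exact: (@integrableS _ _ _ mu _ _ _ (@measurable_itv R `[- b, b]) mab sub iH).
  have iH2 := @integrableZl _ _ _ mu _ mab (rpow (1 - t) a) _ iH'.
  apply: (@poisson_inversion _ _ _ P' D mD f (fun x => rpow (1 - t) a * H x) a b ab mf iH2).
    apply: ae_imply aeR => x [rB rA] /andP[ax _].
    have x0 := lt_le_trans a0 ax.
    by rewrite fE//; exact: V_cvg.
  apply: ae_imply HV => x h /andP[ax xb] n.
  apply: (le_trans (V_le n a0 ax)); rewrite ler_wpM2l ?(ltW (rpow_gt0 _ _))//.
  by apply: h; apply: sub; rewrite /= in_itv/= ax.
exists f; split => //; last first.
  by apply: ae_imply aeR => x [rB rA] x0; exact: fE.
pose XR : {mfun T' >-> measurableTypeR R} := HB.pack D (isMeasurableFun.Build _ _ T' (measurableTypeR R) D mD).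
move=> S mS.
have lawE : distribution P' XR S = (\int[mu]_(x in S) (f x)%:E)%E; last exact: lawE.
apply: (@density_unique R (distribution P' XR) f mf f0) => //.
- by move=> x x0; rewrite /f ltNge x0.
- rewrite /= /pushforward/= -stieltjes_no_zero; congr (P' _).
  apply/seteqP; split => w /=; rewrite in_itv/=.
    by move=> Dw; apply/eqP; rewrite eq_le Dw D0.
  by move=> ->.
- by move=> a b a0 ab; exact: (law_itv mD mf f0 fJ a0 ab).
Qed.

End stieltjes_density.

(** * From the law of a gamma product to the Stieltjes-type identity *)

Section lebesgue_extra.
Context {R : realType}.
Notation mu := (@lebesgue_measure R).

(** Writing [h x] as the Lebesgue measure of [[0, h x[] and exchanging integrals reduces the change
    of density to the sections [{x | y < h x}], where it is the hypothesis [mE]. *)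
Lemma ge0_integral_density d (T : measurableType d)
    (m0 m : {sigma_finite_measure set T -> \bar R}) (f h : T -> R) :
  measurable_fun setT f -> (forall x, 0 <= f x) ->
  (forall A, measurable A -> m A = (\int[m0]_(x in A) (f x)%:E)%E) ->
  measurable_fun setT h -> (forall x, 0 <= h x) ->
  (\int[m]_x (h x)%:E = \int[m0]_x (h x * f x)%:E)%E.
Proof.
move=> mf f0 mE mh h0.
pose S : set (T * R) := [set z | 0 <= z.2 < h z.1].
have mS : measurable S.
  pose b (z : T * R) : bool := (0 <= z.2) && (z.2 < h z.1).
  have mb : measurable_fun setT b.
    apply: measurable_and.
      apply: measurable_fun_ler => //.
    apply: measurable_fun_ltr => //.
    exact: (measurableT_comp mh).
  have -> : S = setT `&` b @^-1` [set true] by rewrite setTI.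
  exact: mb.
pose k z : \bar R := (\1_S z)%:E.
have mk : measurable_fun setT k by apply/measurable_EFinP; exact: measurable_indic.
have k0 z : (0 <= k z)%E by rewrite lee_fin.
have inner x : (\int[mu]_y k (x, y) = (h x)%:E)%E.
  transitivity (\int[mu]_y ((\1_(`[0%R, h x[%classic) y : R)%:E))%E.
    apply: eq_integral => y _; rewrite /k !indicE; congr (_%:R%:E).
  rewrite (@integral_indic _ _ _ mu setT measurableT) ?setIT; last exact: measurable_itv.
  have -> : (h x)%:E = lebesgue_measure (`[0%R, h x[%classic : set R); last by [].
  rewrite lebesgue_measure_itv/= lte_fin sube0; case: ltP => // hx.
  by congr EFin; apply/eqP; rewrite eq_le h0 hx.
under eq_integral do rewrite -inner.
have mSy y : measurable (ysection S y) by exact: measurable_ysection.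
rewrite (@fubini_tonelli _ _ _ _ _ m mu _ mk k0).
have e1 y : (\int[m]_x k (x, y) = \int[m0]_x (k (x, y) * (f x)%:E))%E.
  transitivity (\int[m]_x ((\1_(ysection S y) x : R)%:E))%E.
    by apply: eq_integral => x _; rewrite /k !indicE mem_ysection.
  rewrite (@integral_indic _ _ _ m setT measurableT) ?setIT//.
  apply: (etrans (mE _ (mSy y))); rewrite integral_mkcond; apply: eq_integral => x _.
  rewrite patchE /k indicE mem_ysection; case: ifPn => _; last by rewrite mul0e.
  by rewrite mul1e.
under eq_integral do rewrite e1.
have mkf : measurable_fun setT (fun z : T * R => (k z * (f z.1)%:E)%E).
  apply: emeasurable_funM => //; apply/measurable_EFinP; exact: (measurableT_comp mf).
have kf0 (z : T * R) : (0 <= k z * (f z.1)%:E)%E.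
  by rewrite mule_ge0// lee_fin.
rewrite -(@fubini_tonelli _ _ _ _ _ m0 mu _ mkf kf0).
apply: eq_integral => x _ /=; rewrite EFinM -inner -ge0_integralZr//; last first.
- by rewrite lee_fin.
- exact: (measurableT_comp mk).
Qed.

(** Lebesgue measure equals [c] times its image under [x |-> c x], because the two agree on
    half-open intervals. *)
Lemma lebesgue_scale (c : R) (f : R -> \bar R) : 0 < c ->
  measurable_fun setT f -> (forall x, 0 <= f x)%E ->
  (\int[mu]_x f (c * x)%R = (c^-1)%:E * \int[mu]_x f x)%E.
Proof.
move=> c0 mf f0; pose phi : measurableTypeR R -> measurableTypeR R := fun x => c * x.
have mphi : measurable_fun setT phi by exact: (@measurable_funM _ _ R setT (cst c) id).
have c0' : 0 <= c by exact: ltW.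
pose nu0 : {measure set (measurableTypeR R) -> \bar R} :=
  mscale (NngNum c0') (pushforward mu phi).
pose nu := nu0 mphi.
have e A : measurable A -> mu A = nu A.
  apply: lebesgue_measure_unique => X [[a b] /= _ <-].
  rewrite /nu /nu0 /mscale /= /pushforward/=.
  have -> : phi @^-1` `]a, b] = `](a / c), (b / c)]%classic.
    by apply/seteqP; split => x /=; rewrite !in_itv/= /phi ltr_pdivrMr// ler_pdivlMr// mulrC.
  rewrite !lebesgue_measure_itv/= !lte_fin ltr_pM2r ?invr_gt0//.
  case: ifPn => _; last by rewrite mule0.
  by rewrite -!EFinB -EFinM -mulrBl mulrCA divff ?mulr1// gt_eqF.
have -> : (\int[mu]_x f x = \int[nu]_x f x)%E.
  by apply: eq_measure_integral => A mA _; exact: e.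
rewrite ge0_integral_mscale// ge0_integral_pushforward//.
by rewrite muleA -EFinM mulVf ?gt_eqF// mul1e.
Qed.

End lebesgue_extra.

(** * Laplace transform of the gamma law *)

Section gamma_laplace.
Context {R : realType} (tau : R).
Notation mu := (@lebesgue_measure R).

Let mpdf : measurable_fun setT (gamma_pdf tau). Proof. exact: measurable_gamma_pdf. Qed.
Let pdf0 x : 0 <= gamma_pdf tau x. Proof. exact: gamma_pdf_ge0. Qed.
Let mpdfE : measurable_fun setT (EFin \o gamma_pdf tau). Proof. exact/measurable_EFinP. Qed.

(** If the integral defining [Gamma tau] diverges, its [fine] value is [0], and division by [0]
    makes the density vanish. Finiteness makes the Fubini arguments for [gamma_law] available. *)
Lemma gamma_law_setT_lty : (gamma_law tau setT < +oo)%E.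
Proof.
rewrite /gamma_law.
have [g0|g0] := eqVneq (Gamma tau) 0.
  rewrite (eq_integral (cst 0%E)) ?integral0// => x _.
  by rewrite /gamma_pdf g0 invr0 mulr0; case: ifP.
pose g (x : R) : R := x `^ (tau - 1) * expR (- x).
have mg : measurable_fun (`]0%R, +oo[ : set R) (EFin \o g).
  apply/measurable_EFinP; apply: measurable_funTS; apply: measurable_funM => //.
  by apply: measurableT_comp => //; exact: measurable_expR.
have g_ge0 (x : R) : (0 <= (g x)%:E)%E by rewrite lee_fin mulr_ge0 ?powR_ge0 ?expR_ge0.
have fing : (\int[mu]_(x in `]0%R, +oo[) (g x)%:E < +oo)%E.
  rewrite ltey; apply: contra_neq g0 => e.
  by rewrite /Gamma /Rintegral e.
have G0 : 0 <= (Gamma tau)^-1 :> R.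
  by rewrite invr_ge0; apply: Rintegral_ge0 => x _; rewrite mulr_ge0 ?powR_ge0 ?expR_ge0.
have -> : (\int[mu]_(x in setT) (gamma_pdf tau x)%:E =
    (Gamma tau)^-1%:E * \int[mu]_(x in `]0%R, +oo[) (g x)%:E)%E.
  rewrite -ge0_integralZl//.
  rewrite [RHS]integral_mkcond; apply: eq_integral => x _.
  rewrite patchE; case: ifPn; rewrite ?inE/= ?notin_setE/= in_itv/= andbT => x0.
    by rewrite /gamma_pdf x0 -EFinM mulrC.
  by rewrite /gamma_pdf; case: ifP => // /x0.
by rewrite lte_mul_pinfty// lee_fin.
Qed.


Lemma gamma_law_fin_num : fin_num_fun (gamma_law tau).
Proof.
move=> A mA; rewrite ge0_fin_numE ?measure_ge0//.
by apply: le_lt_trans gamma_law_setT_lty; apply: le_measure; rewrite ?inE.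
Qed.

HB.instance Definition _ := Measure_isFinite.Build _ _ _ (gamma_law tau) gamma_law_fin_num.

(** With [c = 1 + s], the density at [u] times [exp (- s u)] is [c ^ (1 - tau)] times the density at
    [c u]; the substitution [c u] contributes the last factor [1 / c]. *)
Lemma gamma_laplace s : gamma_law tau setT = 1%E -> 0 <= s ->
  (\int[gamma_law tau]_u (expR (- s * u))%:E = (rpow tau (1 + s))%:E)%E.
Proof.
move=> g1 s0; have c0 : 0 < 1 + s by rewrite ltr_wpDr.
set c := 1 + s.
have mh : measurable_fun setT (fun u : R => expR (- s * u)).
  by apply: measurableT_comp => //; exact: measurable_funM.
have -> : (\int[gamma_law tau]_u (expR (- s * u))%:E =
    \int[mu]_u (expR (- s * u) * gamma_pdf tau u)%:E)%E.
  by apply: (@ge0_integral_density _ _ _ mu (gamma_law tau)) => //= x; rewrite expR_ge0.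
have -> : (\int[mu]_u (expR (- s * u) * gamma_pdf tau u)%:E =
    \int[mu]_u ((rpow (tau - 1) c)%:E * (gamma_pdf tau (c * u))%:E))%E.
  apply: eq_integral => u _; rewrite -EFinM /gamma_pdf pmulr_rgt0//.
  case: ifPn => u0; last by rewrite !mulr0.
  rewrite powRM ?(ltW c0) ?(ltW u0)// [c `^ _]/powR gt_eqF//.
  have -> : expR (- (c * u)) = expR (- s * u) * expR (- u).
    by rewrite -expRD; congr expR; rewrite /c; ring.
  rewrite !mulrA -expRD.
  have -> : - (tau - 1) * ln c + (tau - 1) * ln c = 0 by ring.
  by rewrite expR0 mul1r; congr (_%:E); ring.
have mg : measurable_fun setT (fun u => (gamma_pdf tau (c * u))%:E).
  apply/measurable_EFinP; apply: (measurableT_comp mpdf); exact: measurable_funM.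
rewrite ge0_integralZl//; [|by move=> x _; rewrite lee_fin|by rewrite lee_fin ltW// rpow_gt0].
rewrite (@lebesgue_scale R c (EFin \o gamma_pdf tau) c0 mpdfE); last first.
  by move=> x; rewrite lee_fin.
have -> : (\int[mu]_x (EFin \o gamma_pdf tau) x = 1)%E by exact: g1.
by rewrite mule1 -EFinM -(rpow1 c0) -rpowD// subrK.
Qed.

End gamma_laplace.

Section is_D_transform.
(* [A] and [A1] differ on the null set where the Bernoulli variable is neither 0 nor 1. *)
Context {R : realType} d (T : measurableType d) (P : probability T R) (A A1 : T -> R).
Context (tau : R) (H : T -> \bar R).
Context d' (T' : measurableType d') (P' : probability T' R) (D : {RV P' >-> R}).
Hypotheses (mA : measurable_fun setT A) (A0 : forall w, 0 <= A w).
Hypothesis iA : P.-integrable setT (fun w => (ln (1 + A w))%:E).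
Hypotheses (mA1 : measurable_fun setT A1) (AA1 : {ae P, forall w, A1 w = A w}).
Hypothesis HA1 : forall w, H w = ((A1 w)%:E^-1)%E.
Hypotheses (tau0 : 0 <= tau) (DH : is_D P tau H D).

Let integrable_ln1pM lambda : 0 <= lambda ->
  P.-integrable setT (fun w => (ln (1 + lambda * A w))%:E).
Proof.
rewrite le_eqVlt => /predU1P[<-|l0].
  apply: (@eq_integrable _ _ _ P _ measurableT (cst 0%E)) => //; last exact: integrable0.
  by move=> w _; rewrite mul0r addr0 ln1.
have z0 : 0 < lambda^-1 by rewrite invr_gt0.
have i1 : P.-integrable setT (EFin \o (fun=> ln lambda)).
  by apply: (@bounded_integrable _ _ _ P (fun=> ln lambda) `|ln lambda|).
have i2 := integrableD measurableT i1 (integrable_lnDA mA A0 iA z0).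
apply: (@eq_integrable _ _ _ P _ measurableT _ _ _ i2) => w _ /=.
rewrite -EFinD -lnM ?posrE ?ltr_pwDl// mulrDr divff ?gt_eqF//.
Qed.

Let integral_lne lambda : 0 <= lambda ->
  (\int[P]_w lne (1 + lambda%:E / H w) = (\int[P]_w ln (1 + lambda * A w))%:E)%E.
Proof.
move=> l0; have lA0 w : 0 <= lambda * A w by rewrite mulr_ge0.
rewrite /Rintegral fineK; last first.
  by apply: integrable_fin_num => //; exact: integrable_ln1pM.
have e w : lne (1 + lambda%:E / H w)%E =
    if 1 + lambda * A1 w <= 0 then -oo%E else (ln (1 + lambda * A1 w))%:E.
  by rewrite HA1 inveK -EFinM -EFinD.
have m (X : T -> R) : measurable_fun setT X -> measurable_fun setT (fun w => 1 + lambda * X w).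
  by move=> mX; apply: measurable_funD => //; exact: measurable_funM.
apply: ae_eq_integral => //.
- rewrite (funext e); apply: measurable_fun_ifT => //.
    by apply: measurable_fun_ler => //; exact: m.
  by apply/measurable_EFinP; apply: measurableT_comp => //; exact: m.
- by apply/measurable_EFinP; apply: measurableT_comp => //; exact: m.
- apply: filterS AA1 => w AA _.
  by rewrite e AA leNgt ltr_wpDr.
Qed.

Let phi (z : measurableTypeR R * R) : measurableTypeR R := z.1 * z.2.

Lemma is_D_ae_ge0 : {ae P', forall w, 0 <= D w}.
Proof.
exists (D @^-1` `]-oo, 0[); split.
- by rewrite -[X in measurable X]setTI; apply: measurable_funPT.
- exact: DH.1.
- by move=> w /=; rewrite in_itv/= => /negP; rewrite -ltNge.
Qed.

(** Integrating out the gamma factor first turns the Laplace transform of the product into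
    [E (1 + lambda D) ^ -tau]. The maximum with [0] replaces [D], which is nonnegative only almost
    surely. *)
Lemma is_D_laplace lambda : 0 <= lambda ->
  \int[P']_w rpow tau (1 + lambda * Num.max (D w) 0) =
  expR (- tau * \int[P]_w ln (1 + lambda * A w)).
Proof.
have mphi : measurable_fun setT phi.
  exact: (@measurable_funM _ _ R setT fst snd).
pose k l (z : measurableTypeR R * R) : \bar R := (expR (- l * phi z))%:E.
have mexp l : measurable_fun setT (fun x : R => (expR (- l * x))%:E).
  by apply/measurable_EFinP; apply: measurableT_comp => //; exact: measurable_funM.
have mk l : measurable_fun setT (k l) by exact: (measurableT_comp (mexp l) mphi).
have k0 l z : (0 <= k l z)%E by rewrite lee_fin expR_ge0.
have key l : 0 <= l ->
    (\int[P']_w (\int[gamma_law tau]_u (expR (- l * (u * D w)))%:E) =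
     (expR (- tau * \int[P]_w ln (1 + l * A w)))%:E)%E.
  move=> l0; have [_ [_ hL]] := DH.
  have := hL l l0; rewrite (integral_lne l0) -EFinM/= -mulNr => <-.
  have -> : (\int[pushforward (gamma_law tau \x distribution P' D) phi]_x (expR (- l * x))%:E =
      \int[gamma_law tau \x distribution P' D]_z k l z)%E.
    by rewrite (ge0_integral_pushforward mphi)//; exact: mexp.
  rewrite (fubini_tonelli2 _ (mk l) (k0 l)); apply/esym.
  have mG := measurable_fun_fubini_tonelli_G (m1 := gamma_law tau) (k l) (mk l) (k0 l).
  have G0 y : (0 <= fubini_G (gamma_law tau) (k l) y)%E by exact: integral_ge0.
  have mD : measurable_fun setT D by [].
  by rewrite /distribution (ge0_integral_pushforward mD).
(* [lambda = 0] gives the total mass, hence no property of [Gamma] is needed. *)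
have g1 : gamma_law tau setT = 1%E.
  have := key 0 (lexx _).
  have -> : \int[P]_w ln (1 + 0 * A w) = 0.
    rewrite /Rintegral (eq_integral (cst 0%E)) ?integral0// => w _.
    by rewrite mul0r addr0 ln1.
  rewrite mulr0 expR0 => <-.
  rewrite (eq_integral (cst (gamma_law tau setT))); last first.
    move=> w _; rewrite (eq_integral (cst 1%E)) ?integral_cst ?mul1e// => u _.
    by rewrite oppr0 mul0r expR0.
  by rewrite integral_cst// [X in (_ * X)%E]probability_setT mule1.
move=> l0; have := key lambda l0.
have mD : measurable_fun setT D by [].
have mG := measurable_fun_fubini_tonelli_G (m1 := gamma_law tau) (k lambda) (mk lambda) (k0 lambda).
rewrite (@ae_eq_integral _ _ _ P' setT (fun w => (rpow tau (1 + lambda * Num.max (D w) 0))%:E)).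
- by rewrite /Rintegral => ->.
- by [].
- exact: (measurableT_comp mG mD).
- apply/measurable_EFinP; apply: measurableT_comp => //.
    by apply: measurableT_comp => //; exact: measurable_funM.
  apply: measurable_funD => //; apply: measurable_funM => //.
  exact: measurable_maxr.
- apply: filterS is_D_ae_ge0 => w Dw _ /=.
  rewrite (max_idPl Dw) -gamma_laplace ?mulr_ge0//.
  apply: eq_integral => u _; rewrite (_ : - lambda * (u * D w) = - (lambda * D w) * u)//; ring.
Qed.

(** The Laplace identity at [lambda = 1 / z]; the same power of [z] comes out of both sides. *)
Lemma is_D_stieltjes z : 0 < z ->
  \int[P']_w rpow tau (z + Num.max (D w) 0) = expR (- tau * \int[P]_w ln (z + A w)).
Proof.
move=> z0; have zV0 : 0 <= z^-1 by rewrite invr_ge0 ltW.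
have iz := integrable_lnDA mA A0 iA z0.
have ic : P.-integrable setT (EFin \o (fun=> - ln z)).
  by apply: (@bounded_integrable _ _ _ P (fun=> - ln z) `|- ln z|).
have := is_D_laplace zV0.
have -> : \int[P]_w ln (1 + z^-1 * A w) = - ln z + \int[P]_w ln (z + A w).
  transitivity (\int[P]_w (- ln z + ln (z + A w))).
    apply: eq_Rintegral => w _.
    by rewrite -lnV ?posrE// -lnM ?posrE ?invr_gt0 ?ltr_wpDr// mulrDr mulVf ?gt_eqF.
  by rewrite RintegralD// Rintegral_cst// [X in fine X]probability_setT mulr1.
have m0 w : 0 <= Num.max (D w) 0 by rewrite le_max lexx orbT.
have -> : \int[P']_w rpow tau (1 + z^-1 * Num.max (D w) 0) =
    \int[P']_w (rpow tau z^-1 * rpow tau (z + Num.max (D w) 0)).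
  apply: eq_Rintegral => w _.
  by rewrite -rpowM ?invr_gt0 ?ltr_wpDr// mulrDr mulVf ?gt_eqF.
have mm : measurable_fun setT (fun w => Num.max (D w) 0).
  exact: measurable_maxr.
rewrite RintegralZl//; last exact: integrable_rpow.
rewrite mulrDr expRD -lnV ?posrE// => h.
by apply: (@mulfI _ (rpow tau z^-1)) => //; rewrite gt_eqF// rpow_gt0.
Qed.

End is_D_transform.

(** * Proof of the theorem *)

(* The half-Cauchy measure has a positive density and is invariant under [x |-> 1 / x]. *)
Section ae_inversion.
Context {R : realType}.
Notation mu := (@lebesgue_measure R).

Lemma atanV (a : R) : 0 < a -> atan a^-1 = pi / 2 - atan a.
Proof.
move=> a0.
have y0 : 0 < atan a by rewrite -atan0 lt_atan.
have y1 := atan_ltpi2 a.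
rewrite -[RHS]tanK; last by rewrite in_itv/=; move: y0 y1; lra.
congr atan; rewrite /tan sinB cosB sin_pihalf cos_pihalf !mul1r !mul0r subr0 add0r.
by rewrite -[in LHS](atanK a) /tan invf_div.
Qed.

Let g (x : R) : R := if 0 < x then (oneDsqr x)^-1 else 0.

Let g0 x : 0 <= g x.
Proof. by rewrite /g; case: ifP => // _; rewrite invr_ge0 (le_trans ler01)// oneDsqr_ge1. Qed.

Let mg : measurable_fun setT g.
Proof.
apply: measurable_fun_ifT => //; first exact: measurable_fun_ltr.
by apply: continuous_measurable_fun; exact: continuous_oneDsqrV.
Qed.

Let nu (A : set (measurableTypeR R)) := (\int[mu]_(x in A) (g x)%:E)%E.
Let nu0 : nu set0 = 0%E. Proof. by rewrite /nu integral_set0. Qed.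
Let nu_ge0 A : (0 <= nu A)%E.
Proof. by apply: integral_ge0 => x _; rewrite lee_fin. Qed.
Let nuS : semi_sigma_additive nu.
Proof.
by apply: semi_sigma_additive_nng_induced => //; exact/measurable_EFinP.
Qed.
HB.instance Definition _ := isMeasure.Build _ _ _ nu nu0 nu_ge0 nuS.

Let nu_itv a b : 0 < a -> a < b -> nu `[a, b] = (atan b - atan a)%:E.
Proof.
move=> a0 ab; rewrite /nu.
have -> : (\int[mu]_(x in `[a, b]) (g x)%:E = \int[mu]_(x in `[a, b]) ((oneDsqr x)^-1)%:E)%E.
  apply: eq_integral => x; rewrite inE/= in_itv/= => /andP[ax _].
  by rewrite /g (lt_le_trans a0 ax).
rewrite (@continuous_FTC2 _ (fun x => (oneDsqr x)^-1) atan)//.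
- by apply: continuous_subspaceT => x; exact: continuous_oneDsqrV.
- split.
  + by move=> x _; have [] := is_derive1_atan x.
  + by apply: cvg_at_right_filter; exact: continuous_atan.
  + by apply: cvg_at_left_filter; exact: continuous_atan.
- by move=> x _; rewrite derive1_atan.
Qed.

Let nuT : (nu setT < +oo)%E.
Proof.
have -> : nu setT = (\int[mu]_(x in `[0%R, +oo[) (g x)%:E)%E.
  rewrite /nu [RHS]integral_mkcond; apply: eq_integral => x _.
  rewrite patchE; case: ifPn => //; rewrite notin_setE/= in_itv/= andbT => /negP.
  by rewrite -ltNge => x0; rewrite /g ltNge ltW.
apply: (@le_lt_trans _ _ (pi / 2)%:E); last exact: ltry.
rewrite -integral0y_oneDsqr; apply: ge0_le_integral => //.
- by move=> x _; rewrite lee_fin.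
- by apply/measurable_EFinP; exact: measurable_funTS.
- apply/measurable_EFinP; apply: measurable_funTS.
  by apply: continuous_measurable_fun; exact: continuous_oneDsqrV.
- by move=> x _; rewrite lee_fin /g; case: ifP.
Qed.

Let nu_fin : fin_num_fun nu.
Proof.
move=> A mA; rewrite ge0_fin_numE//.
by apply: le_lt_trans nuT; apply: le_measure; rewrite ?inE.
Qed.
HB.instance Definition _ := Measure_isFinite.Build _ _ _ nu nu_fin.

(* the inverse on the positive half-line, which carries [nu] *)
Let phi (x : measurableTypeR R) : measurableTypeR R := x `^ (-1).
Let mphi : measurable_fun setT phi. Proof. exact: measurable_powR. Qed.
Let mpre B : measurable B -> measurable (phi @^-1` B).
Proof. by move=> mB; have := mphi measurableT mB; rewrite setTI. Qed.

Let nu_g x : ~ 0 < x -> g x = 0.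
Proof. by rewrite /g; case: ifP. Qed.

(** On []a, b]] with [0 < a] the invariance amounts to [atan a^-1 - atan b^-1 = atan b - atan a]. *)
Let nu_pushforward A : measurable A -> nu (phi @^-1` A) = nu A.
Proof.
pose m0 : {measure set (measurableTypeR R) -> \bar R} := pushforward nu phi.
pose m := m0 mphi.
have m_fin : fin_num_fun m.
  by move=> B mB; have := nu_fin (mpre mB).
pose mf : {finite_measure set (measurableTypeR R) -> \bar R} :=
  HB.pack (Measure.sort m) (Measure_isFinite.Build _ _ _ m m_fin).
move=> mA; apply: (@density_unique R mf g mg g0 _ _ _ A mA).
- by move=> x x0; apply: nu_g; apply/negP; rewrite -leNgt.
- rewrite /mf /= /m /m0 /= /pushforward /nu; apply: integral0_eq => x /=.
  rewrite in_itv/= => xV; rewrite nu_g// => x0; move: xV.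
  by rewrite leNgt powR_gt0.
- move=> a b a0 ab; have b0 := lt_trans a0 ab.
  have mgE : measurable_fun setT (fun x => (g x)%:E) by exact/measurable_EFinP.
  have hl : (\int[mu]_(x in phi @^-1` `]a, b]) (g x)%:E =
      \int[mu]_(x in `[b^-1%R, a^-1%R[) (g x)%:E)%E.
    rewrite integral_mkcond [RHS]integral_mkcond; apply: eq_integral => x _.
    have [x0|x0] := ltP 0 x; last by rewrite !patchE nu_g ?if_same//; apply/negP; rewrite -leNgt.
    rewrite !patchE; congr (if _ then _ else _); apply/idP/idP.
      rewrite !inE/= !in_itv/= /phi (powR_inv1 (ltW x0)) => /andP[h1 h2].
      by rewrite -[x]invrK lef_pV2 ?ltf_pV2 ?posrE ?invr_gt0// h2.
    rewrite !inE/= !in_itv/= /phi (powR_inv1 (ltW x0)) => /andP[h1 h2].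
    by rewrite -[a]invrK -[b]invrK lef_pV2 ?ltf_pV2 ?posrE ?invr_gt0// h1 h2.
  rewrite [LHS]hl.
  rewrite (@integral_itv_bndo_bndc R (BLeft b^-1) a^-1 (fun x => (g x)%:E)); last first.
    exact: measurable_funTS.
  rewrite [RHS](@integral_itv_obnd_cbnd R a (BRight b) (fun x => (g x)%:E)); last first.
    exact: measurable_funTS.
  apply: (etrans (@nu_itv b^-1 a^-1 _ _)); rewrite ?invr_gt0 ?ltf_pV2//.
  by apply: etrans (esym (nu_itv a0 ab)); rewrite !atanV//; congr EFin; ring.
Qed.

(** A Lebesgue null set is null for [nu], so is its preimage by invariance, and positivity of [g]
    leads back to Lebesgue measure. This makes the formula for the density of [D_1(1 / (G Y_t))]
    available at [1 / x]. *)
Lemma ae_inv (Q : R -> Prop) : {ae mu, forall x, 0 < x -> Q x} ->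
  {ae mu, forall x, 0 < x -> Q x^-1}.
Proof.
move=> [N [mN N0 QN]].
have h : nu (phi @^-1` N) = 0%E.
  rewrite nu_pushforward// /nu null_set_integral//.
  by apply/measurable_EFinP; exact: measurable_funTS.
have mpN := mpre mN.
have : ae_eq mu (phi @^-1` N) (EFin \o g) (cst 0%E).
  apply/(@ae_eq_integral_abs _ _ _ mu _ mpN); first exact/measurable_EFinP/measurable_funTS.
  rewrite -[RHS]h /nu; apply: eq_integral => x _ /=; by rewrite ger0_norm.
apply: ae_imply => x gx x0; apply: contrapT => nQ.
have : (phi @^-1` N) x.
  apply: QN; rewrite /phi powR_inv1 ?ltW//= => /(_ _) h1; apply: nQ; apply: h1.
  by rewrite invr_gt0.
move=> /gx /= []; rewrite /g x0 => /eqP; rewrite invr_eq0 => /eqP h1.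
by have := oneDsqr_ge1 x; rewrite h1 ler10.
Qed.

End ae_inversion.

Section densities.
Context {R : realType}.
Notation mu := (@lebesgue_measure R).

Lemma is_density_ae_eq d (T : measurableType d) (P : probability T R) (X : {RV P >-> R})
    (f g : R -> R) :
  is_density X f -> is_density X g -> {ae mu, forall x, f x = g x}.
Proof.
move=> [mf f0 fE] [mg g0 gE].
have mfE : measurable_fun setT (EFin \o f) by exact/measurable_EFinP.
have mgE : measurable_fun setT (EFin \o g) by exact/measurable_EFinP.
have i_f : mu.-integrable setT (EFin \o f).
  apply/integrableP; split=> //.
  have -> : (\int[mu]_x `|(EFin \o f) x| = distribution P X setT)%E.
    by rewrite fE//; apply: eq_integral => x _; rewrite /= ger0_norm.
  by apply: le_lt_trans (probability_le1 _ _) _; rewrite ?ltry.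
have h : ae_eq mu setT (EFin \o f) (EFin \o g).
  apply: (@integral_ae_eq _ _ _ mu _ measurableT _ _ i_f mgE) => S _ mS.
  by rewrite -[LHS](fE S mS) -[RHS](gE S mS).
by apply: ae_imply h => x /(_ I) [].
Qed.

Lemma ae_eq_distribution d (T : measurableType d) (P : probability T R) (X Y : T -> R) S :
  measurable_fun setT X -> measurable_fun setT Y -> measurable S ->
  {ae P, forall w, X w = Y w} -> P (X @^-1` S) = P (Y @^-1` S).
Proof.
move=> mX mY mS XY.
have e (Z : T -> R) : measurable_fun setT Z -> P (Z @^-1` S) = (\int[P]_w (\1_S (Z w))%:E)%E.
  move=> mZ; have mZS : measurable (Z @^-1` S) by have := mZ measurableT _ mS; rewrite setTI.
  have := @integral_indic _ _ _ P setT measurableT _ mZS; rewrite setIT => <-.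
  by apply: eq_integral => w _; rewrite !indicE.
rewrite !e//; apply: ae_eq_integral => //.
- by apply/measurable_EFinP; apply: (measurableT_comp (measurable_indic mS)).
- by apply/measurable_EFinP; apply: (measurableT_comp (measurable_indic mS)).
- by apply: filterS XY => w /= ->.
Qed.

End densities.

Section bernoulli_density.
Context {R : realType} d (T : measurableType d) (P : probability T R).
Context (E : set T) (B A1 : T -> R) (t : R) (H : T -> \bar R).
Context d' (T' : measurableType d') (P' : probability T' R) (D : {RV P' >-> R}).
Notation mu := (@lebesgue_measure R).
Hypotheses (mE : measurable E) (mB : measurable_fun setT B) (B0 : forall w, 0 < B w).
Hypotheses (t01 : 0 < t < 1) (PE : P E = t%:E).
Hypothesis indep : forall S, measurable S -> P (E `&` B @^-1` S) = (t%:E * P (B @^-1` S))%E.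
Hypothesis iB : P.-integrable setT (fun w => (ln (B w))%:E).
Hypotheses (mA1 : measurable_fun setT A1) (AA1 : {ae P, forall w, A1 w = bern_mul E B w}).
Hypothesis HA1 : forall w, H w = ((A1 w)%:E^-1)%E.
Hypothesis DH : is_D P 1 H D.

(** Serves twice: [B = 1 / G] for [D_1(G / Y_t)] and [B = G] for [D_1(1 / (G Y_t))]. *)
Lemma bernoulli_density : exists f, is_density D f /\
  {ae mu, forall x, 0 < x -> f x = stieltjes_pdf P B t x}.
Proof.
have Bge0 w : 0 <= B w by exact: ltW.
have A0 w : 0 <= bern_mul E B w by rewrite /bern_mul mulr_ge0// indicE.
have mA : measurable_fun setT (bern_mul E B) by exact: measurable_bern_mul.
have iB1 := integrable_ln1p mB B0 iB.
have mln : measurable_fun setT (fun x : R => ln (1 + x)).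
  by apply: measurableT_comp => //; exact: measurable_funD.
have [iA _] := integral_bern_mul mE mB t01 PE indep mln iB1.
have DA z : 0 < z -> \int[P']_w rpow 1 (z + Num.max (D w) 0) =
    expR (- 1 * \int[P]_w ln (z + bern_mul E B w)).
  exact: (is_D_stieltjes mA A0 iA mA1 AA1 HA1 ler01 DH).
have mDp : measurable_fun setT (fun w => Num.max (D w) 0) by exact: measurable_maxr.
have Dp0 w : 0 <= Num.max (D w) 0 by rewrite le_max lexx orbT.
have [f [mf f0 fE aef]] := stieltjes_density mE mB B0 t01 PE indep iB mDp Dp0 DA.
exists f; split => //; split => // S mS; rewrite -fE//.
have DDp : {ae P', forall w, D w = Num.max (D w) 0}.
  by apply: filterS (is_D_ae_ge0 DH) => w D0; rewrite (max_idPl D0).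
have mD : measurable_fun setT D by [].
exact: (ae_eq_distribution mD mDp mS DDp).
Qed.

End bernoulli_density.

Section boundary_values.
Context {R : realType} d (T : measurableType d) (P : probability T R) (A : T -> R) (t : R).
Context d' (T' : measurableType d') (P' : probability T' R) (D : T' -> R).
Hypotheses (mA : measurable_fun setT A) (A0 : forall w, 0 <= A w) (t01 : 0 < t < 1).
Hypothesis iA : P.-integrable setT (fun w => (ln (1 + A w))%:E).
Hypotheses (mD : measurable_fun setT D) (D0 : forall w, 0 <= D w).
Hypothesis DA : forall z, 0 < z ->
  \int[P']_w rpow t (z + D w) = expR (- t * \int[P]_w ln (z + A w)).

(** Real and imaginary parts of [a + exp (- i pi t) b = K exp (- i pi t q)], the boundary form at
    [-x] of the identity for complex arguments. *)
Lemma boundary_pos_powR x : regular_pt P A t x -> regular_pt P' D t x ->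
  let a := \int[P']_w pos_powR (D w - x) (- t) in
  let b := \int[P']_w pos_powR (x - D w) (- t) in
  let K := expR (- t * \int[P]_w ln `|A w - x|) in
  let q := fine (P [set w | A w < x]) in
  a + cos (pi * t) * b = K * cos (pi * t * q) /\ sin (pi * t) * b = K * sin (pi * t * q).
Proof.
move=> rA rD a b K q.
have t0 : 0 < t by case/andP: t01.
have C n := cpow_expectation mA A0 mD D0 iA t0 DA (- x) (eps_gt0 n).
have c1 := Cre_eps_cvg mD t01 rD.
have c2 := Cim_eps_cvg mD t01 rD.
have cL : expR (- t * Lmod P A (eps_ n) (- x)) @[n --> \oo] --> K.
  apply: (@cvg_comp _ _ _ (fun n => - t * Lmod P A (eps_ n) (- x)) expR).
    by apply: cvgM; [exact: cvg_cst|exact: (Lmod_eps_cvg mA A0 t01 iA rA)].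
  exact: continuous_expR.
have cT : t * Larg P A (eps_ n) (- x) @[n --> \oo] --> pi * t * q.
  rewrite [pi * t]mulrC -mulrA; apply: cvgM; first exact: cvg_cst.
  exact: (Larg_eps_cvg mA rA.1).
rewrite ![pi * t]mulrC; rewrite [pi * t]mulrC in cT; split.
- apply: (cvg_unique (@norm_hausdorff R R^o) c1).
  rewrite (_ : (fun n => _) = fun n => expR (- t * Lmod P A (eps_ n) (- x)) *
    cos (t * Larg P A (eps_ n) (- x))); last by apply/funext => n; exact: (C n).1.
  apply: cvgM => //; apply: (@cvg_comp _ _ _ _ cos); first exact: cT.
  exact: continuous_cos.
- apply: (cvg_unique (@norm_hausdorff R R^o) c2).
  rewrite (_ : (fun n => _) = fun n => expR (- t * Lmod P A (eps_ n) (- x)) *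
    sin (t * Larg P A (eps_ n) (- x))); last by apply/funext => n; exact: (C n).2.
  apply: cvgM => //; apply: (@cvg_comp _ _ _ _ sin); first exact: cT.
  exact: continuous_sin.
Qed.

End boundary_values.

(** * The inverse function [Lambda_t] *)

Section arctan.
Context {R : realType}.

(** The quotient is [tan phi]. The position of [phi] relative to [pi / 2] selects the branch of
    [arctan_quot], including the vanishing denominator at [pi / 2]. *)
Lemma arctan_quot_cot (s phi : R) : 0 < s -> 0 < phi < pi ->
  arctan_quot s (s * cos phi / sin phi) = phi.
Proof.
move=> s0 /andP[phi0 phipi].
have sphi : 0 < sin phi by rewrite sin_gt0_pi// phi0.
have q : s / (s * cos phi / sin phi) = tan phi.
  have [c0|c0] := eqVneq (cos phi) 0; first by rewrite /tan c0 mulr0 mul0r invr0 !mulr0.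
  by rewrite /tan; field; rewrite c0 !gt_eqF.
rewrite /arctan_quot q.
have pi0 := pi_gt0 R.
have [lt2|gt2|e2] := ltgtP phi (pi / 2).
- have c0 : 0 < cos phi by rewrite cos_gt0_pihalf// lt2 andbT; lra.
  rewrite gt_eqF ?divr_gt0 ?mulr_gt0// ltNge divr_ge0 ?(ltW c0) ?(ltW sphi)//=.
  by rewrite tanK// in_itv/= lt2 andbT; lra.
- have c0 : cos phi < 0.
    have -> : phi = (phi - pi) + pi by ring.
    rewrite cosDpi oppr_lt0 cos_gt0_pihalf//; apply/andP; split; lra.
  have t0 : tan phi < 0 by rewrite /tan pmulr_rlt0// invr_lt0.
  have r0 : s * cos phi / sin phi < 0 by rewrite pmulr_llt0 ?invr_gt0// pmulr_rlt0.
  rewrite lt_eqF// t0 -[phi in tan phi](subrK pi) tanDpi tanK ?subrK//.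
  by rewrite in_itv/=; apply/andP; split; lra.
- by rewrite e2 cos_pihalf mulr0 mul0r eqxx.
Qed.

Lemma angle_itv (t F : R) : 0 < t < 1 -> 0 <= F < 1 -> 0 < pi * t * (1 - F) < pi.
Proof.
move=> /andP[t0 t1] /andP[F0 F1]; have pi0 := pi_gt0 R.
rewrite !mulr_gt0 ?subr_gt0//= -mulrA gtr_pMr//; apply: le_lt_trans t1.
by rewrite ler_piMr ?(ltW t0)// gerBl.
Qed.

(** With [phi = pi t (1 - F)], dividing the two equations gives [cos (pi t) + a / b = sin (pi t) cos
    phi / sin phi], from which [arctan_quot] recovers [phi]. Both formulas involving [Lambda_t] are
    instances. *)
Lemma Lambda_eq (t F a b K : R) : 0 < t < 1 -> 0 <= F <= 1 -> 0 < K ->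
  a + cos (pi * t) * b = K * cos (pi * t * (1 - F)) ->
  sin (pi * t) * b = K * sin (pi * t * (1 - F)) ->
  F = Lambda t (a%:E / b%:E)%E.
Proof.
move=> /andP[t0 t1] /andP[F0 F1] K0 ea eb.
have pi0 := pi_gt0 R.
have s0 : 0 < sin (pi * t) by rewrite sin_gt0_pi// mulr_gt0//= gtr_pMr.
move: F1; rewrite le_eqVlt => /predU1P[F1|F1].
  (* At [F = 1] the denominator [b] vanishes while [a = K > 0], so the quotient is [+oo], where
     [Lambda] is [1]. *)
  rewrite F1 subrr mulr0 cos0 sin0 !mulr0 mulr1 in ea eb.
  have b0 : b = 0 by move/eqP: eb; rewrite mulf_eq0 gt_eqF//= => /eqP.
  have a0 : 0 < a by move: ea; rewrite b0 mulr0 addr0 => ->.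
  by rewrite b0 inve0 gt0_muley ?lte_fin.
set phi := pi * t * (1 - F) in ea eb.
have /andP[phi0 phipi] : 0 < phi < pi by apply: angle_itv; [rewrite t0|rewrite F0].
have sphi : 0 < sin phi by rewrite sin_gt0_pi// phi0.
have bE : b = K * sin phi / sin (pi * t) by rewrite -eb mulrAC mulfV ?mul1r// gt_eqF.
have b0 : 0 < b by rewrite bE divr_gt0// mulr_gt0.
rewrite inver gt_eqF// -EFinM /Lambda /Lambda_fin.
have -> : cos (pi * t) + a / b = sin (pi * t) * cos phi / sin phi.
  have -> : a = K * cos phi - cos (pi * t) * b by rewrite -ea addrK.
  rewrite mulrBl mulfK ?gt_eqF// addrC subrK bE.
  by field; rewrite !gt_eqF.
rewrite arctan_quot_cot ?phi0// /phi mulrA mulVf ?mul1r ?gt_eqF ?mulr_gt0//.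
by rewrite opprB addrC subrK.
Qed.

End arctan.

Section support.
Context {R : realType} d (T : measurableType d) (P : probability T R) (X : {RV P >-> R}).

(** Every point of [[a, +oo[] has a neighbourhood of mass zero, which may be taken with rational end
    points; countably many such intervals cover the half-line. They are enumerated by [unpickle]. *)
Lemma cdf_above_support (a : R) : (forall y, dist_support X y -> y < a) -> F_ X a = 1.
Proof.
move=> ha.
pose F (n : nat) : set R := if unpickle n is Some pq then
  let I := `](ratr pq.1 : R), (ratr pq.2 : R)[%classic in
  if distribution P X I == 0%E then I else set0 else set0.
have F0 n : (distribution P X).-negligible (F n).
  rewrite /F; case: (unpickle n) => [[p q]|]; last exact: negligible_set0.
  case: ifPn => [/eqP I0|_]; last exact: negligible_set0.
  by exists `](ratr p : R), (ratr q : R)[%classic; split.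
have cover : `[a, +oo[ `<=` \bigcup_n F n.
  move=> y; rewrite /= in_itv/= andbT => ay.
  have : ~ dist_support X y by move=> /ha; rewrite ltNge ay.
  move=> /existsNP[e /not_implyP[e0 /negP]]; rewrite -leNgt => De.
  have ye1 : y - e < y by rewrite gtrBl.
  have ye2 : y < y + e by rewrite ltrDl.
  have [p] := rat_in_itvoo ye1.
  rewrite in_itv/= => /andP[p1 p2].
  have [q] := rat_in_itvoo ye2.
  rewrite in_itv/= => /andP[q1 q2].
  have DI : distribution P X `](ratr p : R), (ratr q : R)[%classic = 0%E.
    apply/eqP; rewrite eq_le measure_ge0 andbT; apply: le_trans De.
    apply: le_measure; rewrite ?inE//; first exact: measurable_ball.
    move=> z; rewrite /= in_itv/= /ball/= => /andP[z1 z2].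
    by rewrite ltr_distlC; apply/andP; split; [exact: lt_trans p1 z1|exact: lt_trans z2 q2].
  have Fpq : F (pickle (p, q)) = `](ratr p : R), (ratr q : R)[%classic.
    by rewrite /F pickleK DI eqxx.
  by exists (pickle (p, q)); [exact: I|rewrite Fpq /= in_itv; apply/andP; split].
have N0 : distribution P X `]a, +oo[%classic = 0%E.
  apply/negligibleP => //; apply: negligibleS (negligible_bigcup F0).
  apply: subset_trans cover => y; rewrite /= !in_itv/= !andbT; exact: ltW.
have -> : F_ X a = fine (distribution P X (~` `]a, +oo[%classic)).
  rewrite /F_ /cdf; congr (fine (distribution P X _)).
  by apply/seteqP; split => y /=; rewrite !in_itv/= andbT leNgt => /negP.
have -> : (distribution P X (~` `]a, +oo[%classic) = 1 - distribution P X `]a, +oo[%classic)%E.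
  by apply: probability_setC.
by rewrite N0 sube0.
Qed.

End support.

(** * The densities in terms of [F_G] and their duality *)

Section inverse_density.
Context {R : realType} d (T : measurableType d) (P : probability T R) (G : {RV P >-> R}).
Context (t : R).
Hypotheses (G_gt0 : forall w, 0 < G w) (t01 : 0 < t < 1).
Hypothesis G_log : P.-integrable setT (fun w => (ln (G w))%:E).

Notation B := (fun w => (G w)^-1).

Lemma measurable_RVV : measurable_fun setT B.
Proof.
rewrite (_ : (fun w => _) = fun w => G w `^ (-1)); last first.
  by apply/funext => w; rewrite powR_inv1// ltW.
exact: measurableT_comp (measurable_powR _) _.
Qed.

Let B0 w : 0 < (G w)^-1. Proof. by rewrite invr_gt0. Qed.

Let leGV x w : 0 < x -> (x <= (G w)^-1) = (G w <= x^-1).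
Proof. by move=> x0; rewrite -[in LHS](invrK x) lef_pV2 ?posrE ?invr_gt0. Qed.

Lemma integrable_lnV : P.-integrable setT (fun w => (ln ((G w)^-1))%:E).
Proof.
have iN := integrableN G_log.
apply: (@eq_integrable _ _ _ P _ measurableT _ _ _ iN) => w _ /=.
by rewrite lnV ?posrE.
Qed.

Notation C x := (pi^-1 * x `^ (t - 1) * expR (- t * \int[P]_w ln `|(G w)^-1 - x|)).

Lemma density_coef_gt0 x : 0 < x -> 0 < C x.
Proof. by move=> x0; rewrite !mulr_gt0 ?invr_gt0 ?pi_gt0 ?powR_gt0 ?expR_gt0. Qed.

Lemma F_ge0_le1 a : 0 <= F_ G a <= 1.
Proof.
rewrite /F_ fine_ge0 ?cdf_ge0//= -lee_fin fineK ?cdf_le1//.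
by rewrite fin_num_measure.
Qed.

Lemma stieltjes_pdfV x : 0 < x ->
  stieltjes_pdf P B t x = sin (pi * t * F_ G x^-1) * C x.
Proof.
move=> x0; rewrite /stieltjes_pdf.
have -> : [set w | x <= (G w)^-1] = G @^-1` `]-oo, x^-1].
  by apply/seteqP; split => w /=; rewrite in_itv/= leGV.
by rewrite !mulrA.
Qed.

Let probG x : 0 < x -> P [set w | (G w)^-1 = x] = 0%E ->
  fine (P [set w | (G w)^-1 < x]) = 1 - F_ G x^-1 /\
  fine (P [set w | x^-1 <= G w]) = 1 - F_ G x^-1.
Proof.
move=> x0 Bx.
have mGx : measurable (G @^-1` `]-oo, x^-1]).
  by rewrite -[X in measurable X]setTI; exact: measurable_funPT.
have e1 : [set w | (G w)^-1 < x] = ~` (G @^-1` `]-oo, x^-1]).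
  by apply/seteqP; split => w /=; rewrite in_itv/= ltNge leGV// => /negP.
have e2 : [set w | x^-1 <= G w] = [set w | (G w)^-1 < x] `|` [set w | (G w)^-1 = x].
  apply/seteqP; split => w /=; rewrite [_^-1 < x]ltNge leGV// -ltNge.
    rewrite le_eqVlt => /predU1P[<-|h]; [by right; rewrite invrK|by left].
  by move=> [/ltW|<-]//; rewrite invrK.
have p1 : fine (P [set w | (G w)^-1 < x]) = 1 - F_ G x^-1.
  by rewrite e1 probability_setC// fineB// fin_num_measure.
have m1 : measurable [set w | (G w)^-1 < x] by rewrite e1; exact: measurableC.
have m2 : measurable [set w | (G w)^-1 = x].
  by have := measurable_RVV measurableT (measurable_set1 x); rewrite setTI.
have dis : [set w | (G w)^-1 < x] `&` [set w | (G w)^-1 = x] = set0.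
  by apply/seteqP; split => w //= -[+ h]; rewrite h ltxx.
split => //; rewrite -p1 e2 (measureU _ m1 m2 dis); congr fine.
by apply: etrans (adde0 _); congr (_ + _)%E; exact: Bx.
Qed.

Lemma prob_ltV x : 0 < x -> regular_pt P B t x ->
  fine (P [set w | (G w)^-1 < x]) = 1 - F_ G x^-1.
Proof. by move=> x0 [Bx _]; have [] := probG x0 Bx. Qed.

Let iB1 : P.-integrable setT (fun w => (ln (1 + (G w)^-1))%:E).
Proof. exact: (integrable_ln1p measurable_RVV B0 integrable_lnV). Qed.

Let iln x : regular_pt P B t x -> P.-integrable setT (fun w => (ln `|(G w)^-1 - x|)%:E).
Proof.
apply: (integrable_ln_dist measurable_RVV _ t01 iB1) => w; exact: ltW.
Qed.

(** Comes from [|G - 1 / x| = |1 / G - x| G / x]. The factor [G] is the source of [exp (t E log G)]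
    in the duality formula. *)
Lemma integral_ln_dist_inv x : 0 < x -> regular_pt P B t x ->
  \int[P]_w ln `|G w - x^-1| =
  \int[P]_w ln `|(G w)^-1 - x| + \int[P]_w ln (G w) - ln x.
Proof.
move=> x0 rx; have i1 := iln rx.
have ic : P.-integrable setT (EFin \o (fun=> - ln x)).
  by apply: (@bounded_integrable _ _ _ P (fun=> - ln x) `|- ln x|).
have i2 := integrableD measurableT i1 G_log.
have i3 := integrableD measurableT i2 ic.
transitivity (\int[P]_w (ln `|(G w)^-1 - x| + ln (G w) + - ln x)).
  rewrite /Rintegral; congr fine; apply: ae_eq_integral => //.
  - apply/measurable_EFinP; apply: measurableT_comp => //; apply: measurableT_comp => //.
    exact: measurable_funB.
  - exact: (measurable_int _ i3).
  - apply: filterS (ae_neq measurable_RVV rx.1) => w Gx _ /=.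
    have -> : G w - x^-1 = - (((G w)^-1 - x) * (G w * x^-1)).
      by field; rewrite !gt_eqF.
    rewrite normrN normrM (gtr0_norm (mulr_gt0 (G_gt0 w) _)) ?invr_gt0//.
    rewrite lnM ?posrE ?mulr_gt0 ?invr_gt0 ?normr_gt0 ?subr_eq0//.
    by rewrite lnM ?posrE ?invr_gt0// lnV ?posrE// addrA.
rewrite RintegralD// RintegralD// Rintegral_cst// [X in fine X]probability_setT.
by rewrite mulr1.
Qed.

(** The common factor [C x] also appears in [stieltjes_pdfV], so the duality formula reduces to a
    quotient of two sines. *)
Lemma stieltjes_pdf_inv x : 0 < x -> regular_pt P B t x ->
  x `^ (t - 2) * stieltjes_pdf P G t x^-1 * expR (t * \int[P]_w ln (G w)) =
  sin (pi * t * (1 - F_ G x^-1)) * C x.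
Proof.
move=> x0 rx; rewrite /stieltjes_pdf (integral_ln_dist_inv x0 rx).
have -> : fine (P [set w | x^-1 <= G w]) = 1 - F_ G x^-1.
  by have [] := probG x0 rx.1.
set s := sin _; set LG := \int[P]_w ln (G w); set L := Rintegral _ _ _.
rewrite /powR !gt_eqF ?invr_gt0// lnV ?posrE//.
have -> : expR ((t - 2) * ln x) * (s / pi * expR ((t - 1) * - ln x) *
    expR (- t * (L + LG - ln x))) * expR (t * LG) =
  s * (pi^-1 * (expR ((t - 2) * ln x) * expR ((t - 1) * - ln x) *
    expR (- t * (L + LG - ln x)) * expR (t * LG))) by ring.
by rewrite -[in RHS]mulrA -!expRD; congr (s * (pi^-1 * expR _)); ring.
Qed.

Lemma D1_densityE s x : 0 < x -> regular_pt P B t x ->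
  D1_density G t s x = (s * C x)%:E.
Proof.
move=> x0 rx; rewrite /D1_density.
have -> : 'E_P[fun w => (ln `|x - (G w)^-1| * (x != (G w)^-1)%:R)%R]%E =
    (\int[P]_w ln `|(G w)^-1 - x|)%:E.
  rewrite unlock /Rintegral fineK; last first.
    exact: (integrable_fin_num measurableT (iln rx)).
  apply: eq_integral => w _; rewrite distrC.
  (* Where [x = 1 / G] the indicator gives [0], in agreement with [ln 0 = 0]. *)
  have [->|_] := eqVneq x (G w)^-1; last by rewrite mulr1.
  by rewrite mulr0 subrr normr0 ln0.
by rewrite [- t * _]mulNr !mulrA EFinM.
Qed.

End inverse_density.

Section bernoulli.
Context {R : realType} d (T : measurableType d) (P : probability T R).
Context (G Y : {RV P >-> R}) (t : R).
Hypotheses (Y_bern : bernoulli_RV t Y) (GY : independent_RV G Y).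

Lemma bernoulli_indep (h : R -> R) S : measurable_fun setT h -> measurable S ->
  P (Y @^-1` [set 1] `&` (fun w => h (G w)) @^-1` S) =
  (t%:E * P ((fun w => h (G w)) @^-1` S))%E.
Proof.
move=> mh mS.
have mhS : measurable (h @^-1` S) by have := mh measurableT _ mS; rewrite setTI.
have -> : (fun w => h (G w)) @^-1` S = G @^-1` (h @^-1` S) by [].
by rewrite setIC GY// Y_bern.1 muleC.
Qed.

Lemma bernoulli_ae : {ae P, forall w, Y w = \1_(Y @^-1` [set 1]) w :> R}.
Proof.
have mY r : measurable (Y @^-1` [set r]).
  by rewrite -[X in measurable X]setTI; exact: measurable_funPT.
exists (~` (Y @^-1` [set 1] `|` Y @^-1` [set 0])); split.
- by apply: measurableC; exact: measurableU.
- have m10 := measurableU _ _ (mY 1) (mY 0).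
  have dis : Y @^-1` [set 1] `&` Y @^-1` [set 0] = set0.
    by apply/seteqP; split => w //= -[-> /eqP]; rewrite oner_eq0.
  rewrite probability_setC// (measureU _ (mY 1) (mY 0) dis).
  apply: (@etrans _ _ (1 - (t%:E + (1 - t)%:E))%E).
    by congr (1 - (_ + _))%E; [exact: Y_bern.1|exact: Y_bern.2].
  have -> : (t%:E + (1 - t)%:E = 1)%E by rewrite -EFinD addrC subrK.
  by rewrite subee.
- move=> w /= nY h; apply: nY.
  case: h => Yw; rewrite indicE Yw; first by rewrite mem_set.
  by rewrite memNset//= Yw => /esym/eqP; rewrite oner_eq0.
Qed.

End bernoulli.

Theorem theorem2p3 (R : realType)
  (d : measure_display) (T : measurableType d) (P : probability T R)
  (G : {RV P >-> R})
  (G_gt0 : forall w, 0 < G w)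
  (G_log : P.-integrable setT (fun w => (ln (G w))%:E))
  (t : R) (t_gt0 : 0 < t) (t_lt1 : t < 1)
  (Y : {RV P >-> R}) (Y_bern : bernoulli_RV t Y) (GY : independent_RV G Y)
  (* D0 = D_t(G) *)
  (d0 : measure_display) (T0 : measurableType d0) (P0 : probability T0 R)
  (D0 : {RV P0 >-> R}) (hD0 : is_D P t (fun w => (G w)%:E) D0)
  (* D1 = D_1(G / Y_t) *)
  (d1 : measure_display) (T1 : measurableType d1) (P1 : probability T1 R)
  (D1 : {RV P1 >-> R})
  (hD1 : is_D P 1 (fun w => (G w)%:E / (Y w)%:E)%E D1)
  (* D2 = D_1(1 / (G Y_t)) *)
  (d2 : measure_display) (T2 : measurableType d2) (P2 : probability T2 R)
  (D2 : {RV P2 >-> R})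
  (hD2 : is_D P 1 (fun w => (G w * Y w)%:E^-1)%E D2) :
  [/\ exists f1, is_density D1 f1,
      exists f2, is_density D2 f2 &
  forall f1 f2 : R -> R, is_density D1 f1 -> is_density D2 f2 ->
  [/\ (* 1) *)
      {ae @lebesgue_measure R, forall x : R, 0 < x ->
         (f1 x)%:E = D1_density G t (sin (pi * t * F_ G x^-1)) x} /\
      {ae @lebesgue_measure R, forall x : R, 0 < x ->
         (forall y, dist_support G y -> y < x^-1) ->
         (f1 x)%:E = D1_density G t (sin (pi * (1 - t))) x},
      (* 2) *)
      {ae @lebesgue_measure R, forall x : R, 0 < x ->
         (F_ G x^-1 < 1 ->
          f1 x = sin (pi * t * F_ G x^-1) / sin (pi * t * (1 - F_ G x^-1)) *
                 x `^ (t - 2) * f2 x^-1 *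
                 expR (t * fine 'E_P[fun w => ln (G w)]%E)) /\
         (F_ G x^-1 = 1 -> f2 x^-1 = 0)},
      (* 3) *)
      {ae @lebesgue_measure R, forall x : R, 0 < x ->
         F_ G x^-1 =
         Lambda t ((f1 x)%:E /
           (x `^ (t - 2) * f2 x^-1 *
            expR (t * fine 'E_P[fun w => ln (G w)]%E))%:E)%E} &
      (* 4) *)
      {ae @lebesgue_measure R, forall x : R, 0 < x ->
         F_ G x^-1 =
         Lambda t ('E_P0[fun w => pos_powR (D0 w - x) (- t)] /
                   'E_P0[fun w => pos_powR (x - D0 w) (- t)])%E}]].
Proof.
have t01 : 0 < t < 1 by rewrite t_gt0.
have pi0 := pi_gt0 R.
pose E := Y @^-1` [set 1]; pose B w := (G w)^-1.
have mE : measurable E by rewrite -[X in measurable X]setTI; exact: measurable_funPT.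
have mG : measurable_fun setT G by [].
have mY : measurable_fun setT Y by [].
have mB : measurable_fun setT B by exact: measurable_RVV.
have B0 w : 0 < B w by rewrite invr_gt0.
have iB : P.-integrable setT (fun w => (ln (B w))%:E) by exact: integrable_lnV.
have indepG S : measurable S -> P (E `&` G @^-1` S) = (t%:E * P (G @^-1` S))%E.
  by move=> mS; apply: (bernoulli_indep Y_bern GY (h := id)).
have indepB S : measurable S -> P (E `&` B @^-1` S) = (t%:E * P (B @^-1` S))%E.
  move=> mS; have -> : B = (fun w => G w `^ (-1)).
    by apply/funext => w; rewrite powR_inv1// ltW.
  exact: (bernoulli_indep Y_bern GY (h := fun x => x `^ (-1))).
have [g1 [dg1 g1E]] : exists f, is_density D1 f /\
    {ae @lebesgue_measure R, forall x : R, 0 < x -> f x = stieltjes_pdf P B t x}.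
  apply: (bernoulli_density mE mB B0 t01 Y_bern.1 indepB iB
    (A1 := fun w => Y w * B w) _ _ _ hD1).
  - exact: measurable_funM.
  - by apply: filterS (bernoulli_ae Y_bern) => w {1}->.
  - move=> w; rewrite !inver mulf_eq0 [B w == 0]gt_eqF// orbF.
    (* Where [Y] vanishes both sides are [+oo], by positivity of [G]. *)
    case: ifPn => _; first by rewrite gt0_muley ?lte_fin.
    by rewrite -EFinM /B invfM invrK mulrC.
have [g2 [dg2 g2E]] : exists f, is_density D2 f /\
    {ae @lebesgue_measure R, forall x : R, 0 < x -> f x = stieltjes_pdf P G t x}.
  apply: (bernoulli_density mE mG G_gt0 t01 Y_bern.1 indepG G_log
    (A1 := fun w => G w * Y w) _ _ _ hD2).
  - exact: measurable_funM.
  - by apply: filterS (bernoulli_ae Y_bern) => w {1}->; rewrite mulrC.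
  - by [].
split; [by exists g1|by exists g2|move=> f1 f2 df1 df2].
pose Dp w := Num.max (D0 w) 0.
have mDp : measurable_fun setT Dp by exact: measurable_maxr.
have Dp0 w : 0 <= Dp w by rewrite le_max lexx orbT.
have Bge0 w : 0 <= B w by exact: ltW.
have iB1 := integrable_ln1p mB B0 iB.
have DA z : 0 < z ->
    \int[P0]_w rpow t (z + Dp w) = expR (- t * \int[P]_w ln (z + B w)).
  apply: (is_D_stieltjes mB Bge0 iB1 mB _ _ (ltW t_gt0) hD0) => [|w]; first exact: aeW.
  by rewrite inver gt_eqF// /B invrK.
have EG : fine 'E_P[fun w => ln (G w)]%E = \int[P]_w ln (G w) by rewrite unlock.
pose C x : R := pi^-1 * x `^ (t - 1) * expR (- t * \int[P]_w ln `|B w - x|).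
have C0 x : 0 < x -> 0 < C x by exact: density_coef_gt0.
have F01 x := F_ge0_le1 G x^-1.
have spt : 0 < sin (pi * t) by rewrite sin_gt0_pi// mulr_gt0//= gtr_pMr.
(* All four claims are read off at the same points: the two densities, one of them taken at [1 / x],
   become sines times [C x], and the last claim uses the regularity of [x] for both [B] and [Dp]. *)
have good : {ae @lebesgue_measure R, forall x, 0 < x ->
  [/\ regular_pt P B t x, regular_pt P0 Dp t x, f1 x = sin (pi * t * F_ G x^-1) * C x &
    x `^ (t - 2) * f2 x^-1 * expR (t * fine 'E_P[fun w => ln (G w)]%E) =
    sin (pi * t * (1 - F_ G x^-1)) * C x]}.
  have r := ae_imply2 (fun x => @conj _ _) (ae_regular_pt P mB t01) (ae_regular_pt P0 mDp t01).
  have e1 : {ae @lebesgue_measure R, forall x, 0 < x -> f1 x = stieltjes_pdf P B t x}.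
    by apply: ae_imply2 (is_density_ae_eq df1 dg1) g1E => x ->.
  have e2 : {ae @lebesgue_measure R, forall x, 0 < x -> f2 x = stieltjes_pdf P G t x}.
    by apply: ae_imply2 (is_density_ae_eq df2 dg2) g2E => x ->.
  have e12 := ae_imply2 (fun x => @conj _ _) e1 (ae_inv e2).
  apply: ae_imply2 r e12 => x [rB rD] [h1 h2] x0; split => //.
    by rewrite h1// stieltjes_pdfV.
  by rewrite h2// EG stieltjes_pdf_inv.
split.
- split.
  + apply: ae_imply good => x h x0; have [rB _ e1 _] := h x0.
    by rewrite D1_densityE// e1.
  + apply: ae_imply good => x h x0 hF; have [rB _ e1 _] := h x0.
    rewrite D1_densityE// e1 cdf_above_support// mulr1.
    by rewrite mulrBr mulr1 sinB sinpi cospi mul0r sub0r mulN1r opprK.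
- apply: ae_imply good => x h x0; have [_ _ e1 e2] := h x0; split => hF.
    have s0 : sin (pi * t * (1 - F_ G x^-1)) != 0.
      have F01' : 0 <= F_ G x^-1 < 1 by rewrite hF andbT; case/andP: (F01 x).
      by rewrite gt_eqF// sin_gt0_pi// angle_itv.
    by rewrite -mulrA -[in RHS]mulrA [X in _ / _ * X]mulrA e2 mulrA divfK.
  move: e2; rewrite hF subrr mulr0 sin0 mul0r => /eqP.
  by rewrite !mulf_eq0 [expR _ == 0]gt_eqF ?expR_gt0// orbF gt_eqF ?powR_gt0//= => /eqP.
- apply: ae_imply good => x h x0; have [_ _ e1 e2] := h x0; rewrite e2.
  (* With [phi = pi t (1 - F)], the identity [sin (pi t - phi) + cos (pi t) sin phi = sin (pi t) cos
     phi] dictates this constant. *)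
  apply: (@Lambda_eq _ t _ _ _ (C x * sin (pi * t))) => //; first by rewrite mulr_gt0// C0.
    rewrite e1; have -> : pi * t * F_ G x^-1 = pi * t - pi * t * (1 - F_ G x^-1) by ring.
    by rewrite sinB; ring.
  ring.
- apply: ae_imply good => x h x0; have [rB rD _ _] := h x0.
  have [ba bb] := boundary_pos_powR mB Bge0 t01 iB1 mDp Dp0 DA rB rD.
  rewrite (prob_ltV G_gt0 x0 rB) in ba bb.
  have mpow (X : T0 -> R) : measurable_fun setT X ->
      measurable_fun setT (fun w => (pos_powR (X w) (- t))%:E).
    by move=> mX; apply/measurable_EFinP; exact: (measurableT_comp (measurable_pos_powR t)).
  have -> : 'E_P0[fun w => pos_powR (D0 w - x) (- t)]%E =
      (\int[P0]_w pos_powR (Dp w - x) (- t))%:E.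
    rewrite unlock /Rintegral fineK; last first.
      exact: (integrable_fin_num measurableT (integrable_pos_powRl mDp rD)).
    apply: ae_eq_integral => //.
    - by apply: mpow; exact: measurable_funB.
    - by apply: mpow; exact: measurable_funB.
    - by apply: filterS (is_D_ae_ge0 hD0) => w Dw _; rewrite /Dp (max_idPl Dw).
  have -> : 'E_P0[fun w => pos_powR (x - D0 w) (- t)]%E =
      (\int[P0]_w pos_powR (x - Dp w) (- t))%:E.
    rewrite unlock /Rintegral fineK; last first.
      exact: (integrable_fin_num measurableT (integrable_pos_powRr mDp rD)).
    apply: ae_eq_integral => //.
    - by apply: mpow; exact: measurable_funB.
    - by apply: mpow; exact: measurable_funB.
    - by apply: filterS (is_D_ae_ge0 hD0) => w Dw _; rewrite /Dp (max_idPl Dw).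
  exact: (Lambda_eq t01 (F01 x) (expR_gt0 _) ba bb).
Qed.
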